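(* Let $\Omega$ be an open set of $\mathbb R^d$ with Lipschitz boundary. Let $u_\varepsilon:\varepsilon X\to\mathbb R$ be a sequence of functions, with $u^\varepsilon_i=u_\varepsilon(\varepsilon i)$, such that $$\sup_{\varepsilon>0}\Bigl(\sum_{l\in\mathcal L_\varepsilon}\ \sum_{i\in(Q^l_{T,d}\times Q_{T,k})\cap X}\varepsilon^d|u^\varepsilon_i|^2+F_\varepsilon(u_\varepsilon)\Bigr)\le C$$ for some constant $C$, where $F_\varepsilon(u)=\sum_{i,j\in X}\varepsilon^{d}a_{ij}\bigl(\frac{u_i-u_j}{\varepsilon}\bigr)^2$ with $u_i=u(\varepsilon i)$. Then, up to a subsequence (as $\varepsilon\to0$), $$\int_{\widetilde\Omega_\varepsilon}|u_\varepsilon-u|^2\,\chi_{\bigcup_{i\in X}\varepsilon Q_d^{i^d}\times Q_k^{i^k}}\,dx\to0,$$ where $u\in H^1(\Omega)$ is the strong limit in $L^2_{\rm loc}(\Omega)$ of the sequence $\overline u_\varepsilon$ of piecewise-constant coarse-grained functions defined in the context.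
   Context: Setting. Let $d,k\ge1$ and $T\in\mathbb N$, $T\ge1$. Points of $\mathbb Z^d\times\mathbb Z^k$ are written $i=(i^d,i^k)$. Put $Q_{T,d}=[0,T)^d$, $Q^l_{T,d}=lT+[0,T)^d$ and $Q_d^l=l+[0,1)^d$ for $l\in\mathbb Z^d$; $Q_{T,k}=[0,T)^k$ and $Q_k^n=n+[0,1)^k$ for $n\in\mathbb Z^k$. $X\subset\mathbb Z^d\times\{0,\dots,T-1\}^k$ is a fixed nonempty set and $\mathcal E\subset X\times X$ is a set of edges such that: (i) $X$ is $T$-periodic in $e_1,\dots,e_d$ ($X+Te_m=X$ for $m=1,\dots,d$); (ii) for all $i,j\in X$ there is a finite sequence $i_0=i,i_1,\dots,i_N=j$ in $X$ with $(i_n,i_{n+1})\in\mathcal E$ for every $n$, and $\mathcal E$ is $T$-periodic, i.e. invariant under $(i,j)\mapsto(i+Te_m,j+Te_m)$, $m=1,\dots,d$; (iii) there is $R>0$ with $|i-j|\le R$ for all $(i,j)\in\mathcal E$; upon replacing $T$ by a multiple, $R\le T$ is assumed. The coefficients $a_{ij}$, $i,j\in X$, satisfy $a_{i+Te_m\,j+Te_m}=a_{ij}$ for $m=1,\dots,d$, $a_{ij}>0$ if $(i,j)\in\mathcal E$, and $a_{ij}=0$ if $(i,j)\notin\mathcal E$. Notation. $\tilde u^l_\varepsilon=\frac1{\#[(Q_{T,d}\times Q_{T,k})\cap X]}\sum_{i\in(Q^l_{T,d}\times Q_{T,k})\cap X}u^\varepsilon_i$; $I_\varepsilon=\{l\in\mathbb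 Z^d:\varepsilon Q^l_{T,d}\subset\Omega\}$; $\overline u_\varepsilon(x^d)=\sum_{l\in I_\varepsilon}\tilde u^l_\varepsilon\chi_{\varepsilon Q^l_{T,d}}(x^d)$. $\mathcal L_\varepsilon=\{l\in\mathbb Z^d:\ \varepsilon Tl\in\Omega,\ \operatorname{dist}(\varepsilon Tl,\partial\Omega)>2\varepsilon\sqrt d\,T\}$ and $\widetilde\Omega_\varepsilon=\bigcup_{l\in\mathcal L_\varepsilon}\varepsilon Q^l_{T,d}\times Q_{T,k}$. $\chi_E$ denotes the characteristic function of a set $E$. In the integral, $u_\varepsilon$ is understood to take the value $u_\varepsilon(\varepsilon i)$ on $\varepsilon Q_d^{i^d}\times Q_k^{i^k}$, $i\in X$ (the last $k$ variables being unscaled), and $u(x)=u(x^d)$ for $x=(x^d,x^k)$.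
   Formalization: As worded the claim fails for unbounded Ω (Ω=R^d, a bump translated to infinity as ε→0); convergence of the integral over all of Ω~_ε is proved for bounded Ω, and for general Ω the integral is taken over Ω~_ε∩{|x^d|<r}, for every r>0. *)

(* Defs.v *)
From HB Require Import structures.
From mathcomp Require Import all_boot all_order all_algebra finmap.
From mathcomp Require Import all_classical all_reals all_analysis.

Set Implicit Arguments.
Unset Strict Implicit.
Unset Printing Implicit Defensive.

Import Order.TTheory GRing.Theory Num.Theory.
Import numFieldNormedType.Exports.

Local Open Scope classical_set_scope.
Local Open Scope ring_scope.

(* Points of R^n are the row vectors 'rV[R]_n.  Their topology is the library's
   (from the sup norm); every length in the statement is Euclidean. *)

(** * Lebesgue measure on R^n *)

Definition rV_display : measure_display -> measure_display.
Proof. exact. Qed.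

Section measurable_rV.
Context {d} {T : sigmaRingType d}.
Variable n : nat.

(* the product sigma-algebra, i.e. the Borel sets when T is the real line;
   same construction as the library's for n.-tuple T *)
Let coors : 'I_n -> 'rV[T]_n -> T := fun i x => x ord0 i.

Let rV_set0 : g_sigma_preimage coors set0.
Proof. exact: sigma_algebra0. Qed.

Let rV_setC A : g_sigma_preimage coors A -> g_sigma_preimage coors (~` A).
Proof. exact: sigma_algebraC. Qed.

Let rV_bigcup (F : _^nat) : (forall i, g_sigma_preimage coors (F i)) ->
  g_sigma_preimage coors (\bigcup_i (F i)).
Proof. exact: sigma_algebra_bigcup. Qed.

HB.instance Definition _ := @isMeasurable.Build (rV_display d)
  'rV[T]_n (g_sigma_preimage coors) rV_set0 rV_setC rV_bigcup.

End measurable_rV.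

Lemma measurable_rV_coord d (T : sigmaRingType d) n (i : 'I_n) :
  measurable_fun [set: 'rV[T]_n] (fun x : 'rV[T]_n => x ord0 i).
Proof.
move=> _ Y mY; rewrite setTI; apply: sub_sigma_algebra => /=.
rewrite -bigcup_seq/=; exists i => /=; first by rewrite mem_index_enum.
by exists Y => //; rewrite setTI.
Qed.

Lemma measurable_fun_rVP d1 d2 (T1 : measurableType d1) (T2 : measurableType d2)
    n (f : T1 -> 'rV[T2]_n) :
  measurable_fun [set: T1] f <->
  forall i, measurable_fun [set: T1] (fun x => f x ord0 i).
Proof.
split=> [mf i|mf].
  by apply: (measurableT_comp (measurable_rV_coord i) mf).
apply: (@measurability _ _ _ _ _ _
  (\big[setU/set0]_(i < n) preimage_set_system setT
     (fun x : 'rV[T2]_n => x ord0 i) measurable)) => //.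
move=> _ [B + <-]; rewrite -bigcup_seq => -[i /= _ [C mC <-]].
by rewrite setTI -comp_preimage; apply: mf.
Qed.

Section rV_cons.
Context {R : realType} (n : nat).

Definition rV_cons (p : R * 'rV[R]_n) : 'rV[R]_n.+1 :=
  \row_i (if unlift ord0 i is Some j then p.2 ord0 j else p.1).

Definition rV_uncons (x : 'rV[R]_n.+1) : R * 'rV[R]_n :=
  (x ord0 ord0, \row_j x ord0 (lift ord0 j)).

Lemma rV_consK : cancel rV_cons rV_uncons.
Proof.
case=> t y; rewrite /rV_uncons; congr pair; first by rewrite mxE unlift_none.
by apply/rowP => j; rewrite !mxE liftK.
Qed.

Lemma measurable_rV_cons : measurable_fun setT rV_cons.
Proof.
apply/measurable_fun_rVP => i; under eq_fun do rewrite mxE.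
case: unliftP => [j _|_]; last exact: measurable_fst.
exact: (measurableT_comp (measurable_rV_coord j) measurable_snd).
Qed.

Lemma measurable_rV_uncons : measurable_fun setT rV_uncons.
Proof.
apply: measurable_fun_pair; first exact: measurable_rV_coord.
apply/measurable_fun_rVP => i; under eq_fun do rewrite mxE.
exact: measurable_rV_coord.
Qed.

Variable m : {sigma_finite_measure set 'rV[R]_n -> \bar R}.

(* the product of the one-dimensional Lebesgue measure with m, carried to R^n.+1 *)
Definition lebesgue_step : set 'rV[R]_n.+1 -> \bar R :=
  pushforward (@lebesgue_measure R \x m)%E rV_cons.

Let step0 : lebesgue_step set0 = 0%E.
Proof. by rewrite /lebesgue_step /pushforward preimage_set0 measure0. Qed.

Let step_ge0 A : (0 <= lebesgue_step A)%E.
Proof. by rewrite /lebesgue_step /pushforward measure_ge0. Qed.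

Let step_sigma_additive : semi_sigma_additive lebesgue_step.
Proof.
move=> F mF tF mUF; rewrite /lebesgue_step /pushforward preimage_bigcup.
have mcons B : measurable B -> measurable (rV_cons @^-1` B).
  by move=> mB; rewrite -[X in measurable X]setTI; exact: measurable_rV_cons.
apply: measure_semi_sigma_additive.
- by move=> i; exact: mcons.
- apply/trivIsetP => /= i j _ _ ij; rewrite -preimage_setI.
  by move/trivIsetP : tF => /(_ _ _ _ _ ij) ->//; rewrite preimage_set0.
- by rewrite -preimage_bigcup; exact: mcons.
Qed.

HB.instance Definition _ := isMeasure.Build _ _ _ lebesgue_step
  step0 step_ge0 step_sigma_additive.

Let step_sigma_finite : sigma_finite setT lebesgue_step.
Proof.
have /sigma_finiteP[F [TF ndF Foo]] := sigma_finiteT (@lebesgue_measure R).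
have /sigma_finiteP[G [TG ndG Goo]] := sigma_finiteT m.
exists (fun k => rV_uncons @^-1` (F k `*` G k)).
  apply/esym; rewrite -subTset => x _.
  have [i _ Fi] : (\bigcup_i F i) (rV_uncons x).1 by rewrite -TF.
  have [j _ Gj] : (\bigcup_j G j) (rV_uncons x).2 by rewrite -TG.
  exists (maxn i j) => //; split.
  - by move: Fi; exact/subsetPset/ndF/leq_maxl.
  - by move: Gj; exact/subsetPset/ndG/leq_maxr.
move=> k; have [mF Flt] := Foo k; have [mG Glt] := Goo k; split.
  rewrite -[X in measurable X]setTI.
  by apply: measurable_rV_uncons => //; exact: measurableX.
rewrite /lebesgue_step /pushforward -comp_preimage.
rewrite (_ : _ \o _ = id); last exact/funext/rV_consK.
by rewrite preimage_id product_measure1E// lte_mul_pinfty// ge0_fin_numE.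
Qed.

HB.instance Definition _ := Measure_isSigmaFinite.Build _ _ _ lebesgue_step
  step_sigma_finite.

End rV_cons.

Fixpoint lebesgue_rV (R : realType) n :
    {sigma_finite_measure set 'rV[R]_n -> \bar R} :=
  if n is m.+1 then lebesgue_step (lebesgue_rV R m) else \d_(0 : 'rV[R]_0).

(** * Euclidean geometry *)

Section euclidean.
Context {R : realType} {n : nat}.
Implicit Types (x y nu : 'rV[R]_n) (A : set 'rV[R]_n).

Definition dotp x y : R := \sum_(i < n) x ord0 i * y ord0 i.

Definition enorm x : R := Num.sqrt (dotp x x).

(* extended-valued, so that the distance to the empty set is +oo *)
Definition edist x A : \bar R := ereal_inf [set (enorm (x - y))%:E | y in A].

Definition boundary A : set 'rV[R]_n := closure A `\` interior A.

Definition hyperplane nu : set 'rV[R]_n := [set x | dotp x nu = 0].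

(* Near each of its boundary points A is the part lying strictly above the graph
   of a Lipschitz function gamma over a hyperplane; nu is the unit normal of the
   hyperplane, and (x - dotp x nu *: nu, dotp x nu) are the coordinates of x in
   the splitting hyperplane + R nu. *)
Definition lipschitz_boundary A : Prop :=
  forall p, boundary A p ->
    exists (nu : 'rV[R]_n) (gamma : 'rV[R]_n -> R^o) (r : R),
      [/\ enorm nu = 1, 0 < r,
          [lipschitz gamma x | x in hyperplane nu] &
          forall x, enorm (x - p) < r ->
            (A x <-> gamma (x - dotp x nu *: nu) < dotp x nu)].

(* [p_1, p_1 + s) x ... x [p_n, p_n + s) *)
Definition cube (p : 'rV[R]_n) (s : R) : set 'rV[R]_n :=
  [set x | forall m, p ord0 m <= x ord0 m < p ord0 m + s].

Definition scale (eps : R) A : set 'rV[R]_n := [set eps *: x | x in A].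

(* the inclusion of Z^n in R^n *)
Definition of_int (i : 'rV[int]_n) : 'rV[R]_n := map_mx intr i.

End euclidean.

(** * The spaces L^2 and H^1 *)

Section sobolev.
Context {R : realType} {n : nat}.
Implicit Types (f g phi : 'rV[R]_n -> R) (A : set 'rV[R]_n).

Definition L2 A f : Prop :=
  measurable_fun A f /\ finite_norm (lebesgue_rV R n) 2%:E (f \_ A).

Definition partial_deriv (m : 'I_n) f : 'rV[R]_n -> R :=
  fun x => 'D_(delta_mx ord0 m) f x.

Fixpoint C_k (k : nat) f : Prop :=
  continuous (f : _ -> R^o) /\
  if k is k'.+1 then
    forall m, (forall x, derivable f x (delta_mx ord0 m)) /\ C_k k' (partial_deriv m f)
  else True.

Definition test_function A phi : Prop :=
  [/\ forall k, C_k k phi,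
      compact (closure [set x | phi x != 0]) &
      closure [set x | phi x != 0] `<=` A].

Definition weak_partial A (m : 'I_n) f g : Prop :=
  forall phi, test_function A phi ->
    (\int[lebesgue_rV R n]_(x in A) (f x * partial_deriv m phi x)%:E =
     - \int[lebesgue_rV R n]_(x in A) (g x * phi x)%:E)%E.

Definition H1 A f : Prop :=
  L2 A f /\ forall m, exists2 g, L2 A g & weak_partial A m f g.

End sobolev.

(** * The discrete setting *)

Section discrete.
Context {R : realType} {d k : nat}.
Variables (T : nat) (X : set ('rV[int]_d * 'rV[int]_k)).
Implicit Types (i j : 'rV[int]_d * 'rV[int]_k) (l : 'rV[int]_d) (eps : R).

(* i |-> i + T e_m, for one of the first d directions *)
Definition translate (m : 'I_d) i : 'rV[int]_d * 'rV[int]_k :=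
  (i.1 + T%:Z *: delta_mx ord0 m, i.2).

Definition lattice_dist i j : R :=
  enorm (row_mx (of_int (i.1 - j.1)) (of_int (i.2 - j.2))).

(* the point eps i of R^d x R^k *)
Definition node eps i : 'rV[R]_d * 'rV[R]_k :=
  (eps *: of_int i.1, eps *: of_int i.2).

Definition Qd l : set 'rV[R]_d := cube (T%:R *: of_int l) T%:R.

Definition Qk : set 'rV[R]_k := cube 0 T%:R.

(* (Q^l_{T,d} x Q_{T,k}) cap X *)
Definition cell l : set ('rV[int]_d * 'rV[int]_k) :=
  [set i | [/\ X i, Qd l (of_int i.1) & Qk (of_int i.2)]].

(* eps Q_d^{i^d} x Q_k^{i^k} *)
Definition voxel eps i : set ('rV[R]_d * 'rV[R]_k) :=
  scale eps (cube (of_int i.1) 1) `*` cube (of_int i.2) 1.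

Definition energy (a : 'rV[int]_d * 'rV[int]_k -> 'rV[int]_d * 'rV[int]_k -> R)
    eps (u : 'rV[R]_d * 'rV[R]_k -> R) : \bar R :=
  \esum_(ij in X `*` X)
    (eps ^+ d * a ij.1 ij.2 *
     ((u (node eps ij.1) - u (node eps ij.2)) / eps) ^+ 2)%:E.

Variable Omega : set 'rV[R]_d.

(* I_eps *)
Definition inner_cells eps : set 'rV[int]_d :=
  [set l | scale eps (Qd l) `<=` Omega].

(* L_eps *)
Definition deep_cells eps : set 'rV[int]_d :=
  [set l | Omega ((eps * T%:R) *: of_int l) /\
    ((2 * eps * Num.sqrt d%:R * T%:R)%:E <
     edist ((eps * T%:R) *: of_int l) (boundary Omega))%E].

Definition Omega_tilde eps : set ('rV[R]_d * 'rV[R]_k) :=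
  (\bigcup_(l in deep_cells eps) scale eps (Qd l)) `*` Qk.

Definition sum_sq eps (u : 'rV[R]_d * 'rV[R]_k -> R) : \bar R :=
  \esum_(l in deep_cells eps) \esum_(i in cell l)
    (eps ^+ d * `|u (node eps i)| ^+ 2)%:E.

Definition cell_average eps (u : 'rV[R]_d * 'rV[R]_k -> R) l : R :=
  (#|` fset_set (cell 0)|)%:R^-1 * \sum_(i \in cell l) u (node eps i).

Definition coarse eps (u : 'rV[R]_d * 'rV[R]_k -> R) (x : 'rV[R]_d) : R :=
  \sum_(l \in inner_cells eps) cell_average eps u l * \1_(scale eps (Qd l)) x.

(* the value u (eps i) on eps Q_d^{i^d} x Q_k^{i^k}, and 0 off their union *)
Definition interpolation eps (u : 'rV[R]_d * 'rV[R]_k -> R)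
    (x : 'rV[R]_d * 'rV[R]_k) : R :=
  \sum_(i \in X) u (node eps i) * \1_(voxel eps i) x.

(* the integral over D of |u_eps - v|^2 times the characteristic function of the
   union of the voxels, v being extended constantly in the last k variables *)
Definition sq_error eps (u : 'rV[R]_d * 'rV[R]_k -> R) (v : 'rV[R]_d -> R)
    (D : set ('rV[R]_d * 'rV[R]_k)) : \bar R :=
  (\int[lebesgue_rV R d \x lebesgue_rV R k]_(x in D)
     (`|interpolation eps u x - v x.1| ^+ 2 *
      \1_(\bigcup_(i in X) voxel eps i) x)%:E)%E.

End discrete.

(* Main.v *)
(* The energy is summed over all of X, not only over the part above Omega.
   Joining the points of two adjacent periodicity cells by paths in the graph
   therefore bounds the increments of the cell averages by O(eps) in L^2(R^d),
   and likewise the deviation of u_eps from its cell averages. Averaging over the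
   cubes of a fixed mesh of size delta moves the coarse functions by O(delta) in
   L^2(R^d) and leaves countably many real numbers, bounded because one of them
   is controlled by the L^2 bound in Omega. This gives strong convergence in
   L^2_loc(R^d) along a subsequence. Weak limits of the difference quotients are
   the weak derivatives of the limit. *)

Require Import Defs.
From HB Require Import structures.
From mathcomp Require Import all_boot all_order all_algebra finmap.
From mathcomp Require Import all_classical all_reals all_analysis.
From mathcomp Require Import measurable_realfun ring lra zify.

Set Implicit Arguments.
Unset Strict Implicit.
Unset Printing Implicit Defensive.

Import Order.TTheory GRing.Theory Num.Theory.
Import numFieldNormedType.Exports.

Local Open Scope classical_set_scope.
Local Open Scope ring_scope.

(** * Strong and weak compactness in L^2 *)

(** Lattice functions are never summed as series. A bound is a [sum_le], an inequality for every
    finite duplicate-free list, so that translating, reindexing along an injection and telescoping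
    along a path remain finite algebra; [integral_lattice_le] multiplies it by the volume of a mesh
    cube and makes it an integral bound for a step function. The L^2 bound holds only on the deep
    cells, which vary with [eps], whereas increments are controlled on all of Z^d. So the limit [v]
    is built on the whole space, with rate 1/(k+1) on the k-th box along the subsequence: one
    statement that serves every compact set. Its square integrability on [Omega] is recovered
    afterwards by Fatou's lemma. Energy bounds carry eta^2 / eta^n. Multiplication by eta^n leaves
    one factor eta per increment, which keeps difference quotients bounded and makes the deviation
    inside a cell vanish. The final error is split at the cell average; the last k variables
    contribute only the volume T^k of [Qk]. *)

Section integral_bounds.
Context d (X : measurableType d) (R : realType) (mu : {measure set X -> \bar R}).

(** The integral of a nonnegative function is a supremum over the simple functions below it, so the
    comparison is an inclusion between competitors and involves no measurability. This matters for
    the integrand of [sq_error], whose measurability is never established. *)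
Lemma le_integral_ge0 (D D' : set X) (f g : X -> \bar R) :
  (forall x, D x -> 0 <= f x)%E -> (forall x, D' x -> 0 <= g x)%E ->
  (forall x, D x -> D' x /\ (f x <= g x)%E) ->
  (\int[mu]_(x in D) f x <= \int[mu]_(x in D') g x)%E.
Proof.
move=> f0 g0 fg; rewrite !ge0_integralE//; apply: le_ereal_sup => _ [h /= hf <-].
exists h => //= x; apply: le_trans (hf x) _; rewrite !patchE.
case: ifPn => [/set_mem Dx|_]; last by case: ifPn => // /set_mem /g0.
by have [D'x fgx] := fg x Dx; rewrite (mem_set D'x).
Qed.

(** Stands in for Minkowski's inequality: squares are split pointwise, typically by (x - z)^2 <= 2
    (x - y)^2 + 2 (y - z)^2, and the split is integrated. *)
Lemma le_integral_lin2 (D : set X) (F G H : X -> R) (a b A B : R) :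
  measurable D -> 0 <= a -> 0 <= b ->
  (forall x, D x -> 0 <= F x) ->
  (forall x, D x -> 0 <= G x) -> (forall x, D x -> 0 <= H x) ->
  measurable_fun D G -> measurable_fun D H ->
  (forall x, D x -> F x <= a * G x + b * H x) ->
  (\int[mu]_(x in D) (G x)%:E <= A%:E)%E ->
  (\int[mu]_(x in D) (H x)%:E <= B%:E)%E ->
  (\int[mu]_(x in D) (F x)%:E <= (a * A + b * B)%:E)%E.
Proof.
move=> mD a0 b0 F0 G0 H0 mG mH FGH GA HB.
apply: (@le_trans _ _ (\int[mu]_(x in D) (a%:E * (G x)%:E + b%:E * (H x)%:E))%E).
  apply: le_integral_ge0 => x Dx; first by rewrite lee_fin F0.
    by rewrite -!EFinM -EFinD lee_fin addr_ge0 ?mulr_ge0 ?G0 ?H0.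
  by split=> //; rewrite -!EFinM -EFinD lee_fin FGH.
rewrite ge0_integralD//; last 4 first.
- by move=> x Dx; rewrite -EFinM lee_fin mulr_ge0 ?G0.
- by apply: measurable_funeM; exact/measurable_EFinP.
- by move=> x Dx; rewrite -EFinM lee_fin mulr_ge0 ?H0.
- by apply: measurable_funeM; exact/measurable_EFinP.
have Z (c : R) (K : X -> R) : 0 <= c -> (forall x, D x -> 0 <= K x) -> measurable_fun D K ->
    (\int[mu]_(x in D) (c%:E * (K x)%:E) = c%:E * \int[mu]_(x in D) (K x)%:E)%E.
  move=> c0 K0 mK; rewrite ge0_integralZl_EFin//.
    exact/measurable_EFinP.
rewrite !Z// EFinD !EFinM.
by apply: leeD; apply: lee_wpmul2l.
Qed.

End integral_bounds.

Section L2_completeness.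
Context d (X : measurableType d) (R : realType) (mu : {measure set X -> \bar R}).

Lemma sum_half_pow (n : nat) : \sum_(0 <= i < n) (2^-1 : R) ^+ i <= 2.
Proof.
suff -> : \sum_(0 <= i < n) (2^-1 : R) ^+ i = 2 - 2 * 2^-1 ^+ n.
  by rewrite gerBl mulr_ge0// exprn_ge0// invr_ge0.
elim: n => [|n IH]; first by rewrite big_geq// expr0 mulr1 subrr.
by rewrite big_nat_recr//= IH exprS; field.
Qed.

(* The weights 2^j make the series of squared increments control the square of
   their sum. *)
Lemma sqr_telescope_weighted (h : nat -> R) (p n : nat) :
  (h (p + n)%N - h p) ^+ 2 <=
  \sum_(0 <= i < n) 2 * 2 ^+ i * (h (p + i).+1 - h (p + i)%N) ^+ 2.
Proof.
elim: n p => [|n IH] p; first by rewrite big_geq// addn0 subrr expr0n.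
rewrite big_nat_recl//= addn0 expr0 mulr1.
apply: (@le_trans _ _ (2 * (h p.+1 - h p) ^+ 2 +
    2 * (h (p.+1 + n)%N - h p.+1) ^+ 2)).
  rewrite addSnnS; set x := h (p + n.+1)%N; set y := h p.+1; set z := h p.
  have := sqr_ge0 (x - y - (y - z)); nra.
rewrite lerD2l; apply: le_trans (ler_wpM2l _ (IH p.+1)) _ => //.
rewrite big_distrr/=; apply: ler_sum => i _; rewrite !addSn !addnS.
by rewrite (exprS _ i) le_eqVlt; apply/orP; left; apply/eqP; ring.
Qed.

(** A quantitative Riesz-Fischer theorem. Squared increments decaying like 4^-p survive the weights
    2^i: the weighted series has integral at most 2 C 4^-p (1 + 1/2 + ...) <= 4 C 4^-p, and it
    dominates (h p - g)^2 pointwise. *)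
Lemma L2_fast_cauchy (h : nat -> X -> R) (C : R) :
  (forall p, measurable_fun setT (h p)) ->
  (forall p, (\int[mu]_x ((h p.+1 x - h p x) ^+ 2)%:E <= (C * 4^-1 ^+ p)%:E)%E) ->
  exists2 g : X -> R, measurable_fun setT g &
    forall p, (\int[mu]_x ((h p x - g x) ^+ 2)%:E <= (4 * C * 4^-1 ^+ p)%:E)%E.
Proof.
move=> mh hC.
pose w p i x := 2 * 2 ^+ i * (h (p + i).+1 x - h (p + i)%N x) ^+ 2.
have w0 p i x : 0 <= w p i x by rewrite /w mulr_ge0 ?sqr_ge0// mulr_ge0// exprn_ge0.
have mw p i : measurable_fun setT (w p i).
  by apply: measurable_funM => //; apply: measurable_funX; exact: measurable_funB.
pose W p x : \bar R := (\sum_(0 <= i <oo) (w p i x)%:E)%E.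
(* The upper limit, replaced by 0 where it is infinite, is measurable without isolating the points
   of convergence. *)
pose g x : R := fine (limn_esup (fun n => (h n x)%:E)).
exists g.
  rewrite /g; apply: (measurableT_comp (@fine_measurable R setT measurableT)) => //.
  by apply: measurable_fun_limn_esup => n; exact/measurable_EFinP.
have W0 p x : (0 <= W p x)%E by apply: nneseries_ge0 => i _ _; rewrite lee_fin.
have wW p x n : ((\sum_(0 <= i < n) w p i x)%:E <= W p x)%E.
  rewrite -sumEFin; apply: nneseries_lim_ge => i _ _; by rewrite lee_fin.
(* Up to the factor 2^p, [W p] is the tail of [W 0]. *)
have tail p x : W p x != +oo%E -> W 0%N x != +oo%E.
  apply: contra => /eqP W0oo; rewrite -leye_eq.
  have : (W 0%N x <= (\sum_(0 <= i < p) w 0%N i x)%:E + (2 ^+ p)%:E * W p x)%E.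
    apply: lime_le; first by apply: is_cvg_nneseries => i _ _; rewrite lee_fin.
    near=> n; have pn : (p <= n)%N by near: n; exact: nbhs_infty_ge.
    rewrite (big_cat_nat (leq0n p) pn)/= !sumEFin leeD2l//.
    rewrite -[in X in (X <= _)%E](subnK pn) -{1}(add0n p) big_addn addnK.
    rewrite [X in (X%:E <= _)%E](_ : _ = 2 ^+ p * \sum_(0 <= i < (n - p)%N) w p i x).
      by rewrite EFinM lee_wpmul2l// lee_fin exprn_ge0.
    rewrite big_distrr/=; apply: eq_bigr => i _; rewrite /w add0n addnC exprD; ring.
  rewrite W0oo leye_eq.
  case: (W p x) (W0 p x) => //= r _.
(* Where the series diverges the bound is void, and where it converges the sequence is Cauchy. It
   therefore holds at every point, with no exceptional null set. *)
have key p x : (((h p x - g x) ^+ 2)%:E <= W p x)%E.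
  have [->|Wfin] := eqVneq (W p x) +oo%E; first exact: leey.
  have W0fin := tail _ _ Wfin.
  pose M := fine (W 0%N x).
  have M0 : 0 <= M by exact: fine_ge0.
  have WM : W 0%N x = M%:E by rewrite fineK// ge0_fin_numE// ltey.
  have hp q n : (h (q + n)%N x - h q x) ^+ 2 <= M * 2^-1 ^+ q.
    apply: le_trans (sqr_telescope_weighted (h ^~ x) q n) _.
    rewrite exprVn ler_pdivlMr ?exprn_gt0// -lee_fin -WM.
    apply: le_trans (wW 0%N x (q + n)%N); rewrite lee_fin.
    rewrite (big_cat_nat (leq0n q) (leq_addr n q))/= -[leLHS]add0r lerD//.
      by apply: sumr_ge0 => i _.
    rewrite (_ : \sum_(q <= i < q + n) _ = \sum_(0 <= i < n) w 0%N (i + q)%N x); last first.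
      by rewrite -{1}(add0n q) big_addn addKn.
    rewrite mulrC big_distrr/= le_eqVlt; apply/orP; left; apply/eqP/eq_bigr => i _.
    by rewrite /w add0n addnC exprD; ring.
  have cvgh : cvgn (h ^~ x).
    apply/cauchy_cvgP/cauchy_ballP => e e0.
    have [q hq] : exists q, M * 2^-1 ^+ q < (e / 2) ^+ 2.
      have : M * 2^-1 ^+ q @[q --> \oo] --> M * 0.
        by apply: cvgMr; apply: cvg_expr; rewrite ger0_norm ?invr_ge0// invf_lt1// ltr1n.
      rewrite mulr0 => /cvgrPdist_lt /(_ ((e / 2) ^+ 2)).
      rewrite exprn_gt0 ?divr_gt0// => /(_ isT)[q _ /(_ _ (leqnn q))].
      by rewrite /= sub0r normrN ger0_norm ?mulr_ge0 ?exprn_ge0 ?invr_ge0//; exists q.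
    have close n : (q <= n)%N -> `|h n x - h q x| < e / 2.
      move=> qn; rewrite -(subnKC qn) -(@ltr_pXn2r _ 2) ?nnegrE ?divr_ge0 ?(ltW e0)//.
      by rewrite real_normK ?num_real//; exact: le_lt_trans (hp _ _) hq.
    near_simpl; near=> a b.
    rewrite /ball/=; apply: le_lt_trans (ler_distD (h q x) _ _) _.
    rewrite [ltRHS](splitr e) ltrD//; first by apply: close; near: a; exact: nbhs_infty_ge.
    by rewrite distrC; apply: close; near: b; exact: nbhs_infty_ge.
  have gl : g x = limn (h ^~ x).
    have cE : (h n x)%:E @[n --> \oo] --> (limn (h ^~ x))%:E by apply: cvg_EFin => //; exact: nearW.
    by rewrite /g is_cvg_limn_esupE ?(cvg_lim _ cE)//; apply/cvg_ex; exists (limn (h ^~ x))%:E.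
  have Wp : W p x = (fine (W p x))%:E by rewrite fineK// ge0_fin_numE// ltey.
  rewrite Wp lee_fin.
  have : (h p x - h n x) ^+ 2 @[n --> \oo] --> (h p x - g x) ^+ 2.
    by rewrite gl; apply: cvgM; apply: cvgB => //; exact: cvg_cst.
  move=> cv; rewrite -(cvg_lim _ cv)//; apply: limr_le; first exact: cvgP cv.
  near=> n; have pn : (p <= n)%N by near: n; exact: nbhs_infty_ge.
  rewrite -sqrrN opprB -(subnKC pn) -lee_fin -Wp.
  apply: le_trans (wW p x (n - p)%N); rewrite lee_fin.
  exact: (sqr_telescope_weighted (h ^~ x)).
move=> p; apply: (@le_trans _ _ (\int[mu]_x W p x)%E).
  by apply: le_integral_ge0 => // x _; rewrite lee_fin sqr_ge0.
rewrite /W integral_nneseries//; last 2 first.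
- by move=> i; exact/measurable_EFinP.
- by move=> i x _; rewrite lee_fin.
apply: lime_le; first by apply: is_cvg_nneseries => i _ _; apply: integral_ge0 => x _; rewrite lee_fin.
near=> n.
apply: (@le_trans _ _ (\sum_(0 <= i < n) (2 * C * 4^-1 ^+ p * 2^-1 ^+ i)%:E)%E).
  apply: lee_sum => i _; rewrite /w.
  under eq_integral do rewrite EFinM.
  rewrite ge0_integralZl_EFin//; last 2 first.
  - by move=> x _; rewrite lee_fin sqr_ge0.
  - by apply/measurable_EFinP/measurable_funX; exact: measurable_funB.
  apply: le_trans (lee_wpmul2l _ (hC _)) _; first by rewrite lee_fin mulr_ge0 ?exprn_ge0.
  rewrite -EFinM lee_fin exprD le_eqVlt; apply/orP; left; apply/eqP.
  rewrite [X in _ = _ * X](_ : _ = 2 ^+ i * 4^-1 ^+ i); first ring.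
  rewrite -exprMn; congr (_ ^+ _); lra.
have C0 : 0 <= C.
  have := hC 0%N; rewrite expr0 mulr1 -lee_fin; apply: le_trans.
  by apply: integral_ge0 => x _; rewrite lee_fin sqr_ge0.
rewrite sumEFin lee_fin -big_distrr/=.
apply: le_trans (ler_wpM2l _ (sum_half_pow n)) _; last lra.
by rewrite !mulr_ge0// exprn_ge0// invr_ge0.
Unshelve. all: by end_near. Qed.

End L2_completeness.

Section weak_compactness.
Context d (X : measurableType d) (R : realType) (mu : {measure set X -> \bar R}).
Implicit Types f g h phi : X -> R.

Lemma integrable_sqr f (A : R) : measurable_fun setT f ->
  (\int[mu]_x (f x ^+ 2)%:E <= A%:E)%E ->
  mu.-integrable setT (EFin \o (fun x => f x ^+ 2)).
Proof.
move=> mf fA; apply/integrableP; split.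
  by apply/measurable_EFinP; exact: measurable_funX.
apply: le_lt_trans (ltry A); apply: le_trans fA.
by apply: le_integral_ge0 => x _ //=; rewrite ?abse_ge0 ?lee_fin ?sqr_ge0// ger0_norm ?sqr_ge0.
Qed.

Lemma integrable_mul f g (A B : R) :
  measurable_fun setT f -> measurable_fun setT g ->
  (\int[mu]_x (f x ^+ 2)%:E <= A%:E)%E -> (\int[mu]_x (g x ^+ 2)%:E <= B%:E)%E ->
  mu.-integrable setT (EFin \o (fun x => f x * g x)).
Proof.
move=> mf mg fA gB.
have := integrableD measurableT (integrable_sqr mf fA) (integrable_sqr mg gB).
apply: le_integrable => //; first by apply/measurable_EFinP; exact: measurable_funM.
move=> x _; rewrite /comp /= lee_fin.
rewrite [leRHS]ger0_norm ?addr_ge0 ?sqr_ge0// normrM.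
rewrite -(real_normK (num_real (f x))) -(real_normK (num_real (g x))).
have := sqr_ge0 (`|f x| - `|g x|); have := sqr_ge0 (`|f x| + `|g x|); nra.
Qed.

(** Young's inequality with a free weight, in the role of Cauchy-Schwarz: a large [lam] makes the
    [B] term small, and a sufficiently small [A] pays for it. *)
Lemma norm_Rintegral_mul_le f g (A B lam : R) : 0 < lam ->
  measurable_fun setT f -> measurable_fun setT g ->
  (\int[mu]_x (f x ^+ 2)%:E <= A%:E)%E -> (\int[mu]_x (g x ^+ 2)%:E <= B%:E)%E ->
  `|\int[mu]_x (f x * g x)| <= lam * A + lam^-1 * B.
Proof.
move=> l0 mf mg fA gB; have I := integrable_mul mf mg fA gB.
rewrite -lee_fin EFin_normr_Rintegral//.
apply: le_trans (le_abse_integral _ measurableT (measurable_int _ I)) _.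
rewrite (_ : \int[mu]_x _ = \int[mu]_x (`|f x * g x|)%:E)%E//.
apply: (@le_integral_lin2 _ _ _ _ _ _ (fun x => f x ^+ 2) (fun x => g x ^+ 2)) => //.
- exact: ltW.
- by rewrite invr_ge0 ltW.
- by move=> x _; exact: sqr_ge0.
- by move=> x _; exact: sqr_ge0.
- exact: measurable_funX.
- exact: measurable_funX.
move=> x _; rewrite normrM -(real_normK (num_real (f x))) -(real_normK (num_real (g x))).
have a0 : 0 <= `|f x| by []; have b0 : 0 <= `|g x| by [].
move: `|f x| `|g x| a0 b0 => a b a0 b0.
rewrite -(ler_pM2l l0) mulrDr !mulrA divff ?gt_eqF// mul1r.
have := sqr_ge0 (lam * a - b); have : 0 <= lam * a * b by rewrite !mulr_ge0// ltW.
by rewrite sqrrB exprMn expr2; lra.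
Qed.

(** Convex combinations of the tail with dyadic weights. Midpoints are all that the parallelogram
    law requires, and convex conditions pass to the hull by induction on this predicate. *)
Inductive midpoint_hull (g : nat -> X -> R) (n : nat) : (X -> R) -> Prop :=
| midpoint_hull_gen m : (n <= m)%N -> midpoint_hull g n (g m)
| midpoint_hull_mid f h : midpoint_hull g n f -> midpoint_hull g n h ->
    midpoint_hull g n (fun x => 2^-1 * (f x + h x)).

Lemma midpoint_hull_le (g : nat -> X -> R) n m f : (n <= m)%N ->
  midpoint_hull g m f -> midpoint_hull g n f.
Proof.
move=> nm; elim=> [i mi|f1 h1 _ H1 _ H2]; last exact: midpoint_hull_mid.
exact/midpoint_hull_gen/(leq_trans nm).
Qed.

Lemma midpoint_hull_L2 (g : nat -> X -> R) (C : R) n f : (forall n, measurable_fun setT (g n)) ->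
  (forall n, (\int[mu]_x (g n x ^+ 2)%:E <= C%:E)%E) -> midpoint_hull g n f ->
  measurable_fun setT f /\ (\int[mu]_x (f x ^+ 2)%:E <= C%:E)%E.
Proof.
move=> mg gC; elim=> [//|{}f h _ [mf fC] _ [mh hC]]; split.
  by apply: measurable_funM => //; exact: measurable_funD.
rewrite [C](_ : _ = 2^-1 * C + 2^-1 * C); last by field.
apply: (@le_integral_lin2 _ _ _ _ _ _ (fun x => f x ^+ 2) (fun x => h x ^+ 2)) => //.
- by move=> x _; exact: sqr_ge0.
- by move=> x _; exact: sqr_ge0.
- by move=> x _; exact: sqr_ge0.
- exact: measurable_funX.
- exact: measurable_funX.
by move=> x _; have := sqr_ge0 (f x - h x); lra.
Qed.

Lemma midpoint_hull_Rintegral (g : nat -> X -> R) (C B e L : R) n f phi :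
  (forall n, measurable_fun setT (g n)) ->
  (forall n, (\int[mu]_x (g n x ^+ 2)%:E <= C%:E)%E) ->
  measurable_fun setT phi -> (\int[mu]_x (phi x ^+ 2)%:E <= B%:E)%E ->
  (forall m, (n <= m)%N -> `|\int[mu]_x (g m x * phi x) - L| <= e) ->
  midpoint_hull g n f -> `|\int[mu]_x (f x * phi x) - L| <= e.
Proof.
move=> mg gC mphi phiB ge; elim=> [m nm|{}f h Hf IHf Hh IHh]; first exact: ge.
have [mf fC] := midpoint_hull_L2 mg gC Hf.
have [mh hC] := midpoint_hull_L2 mg gC Hh.
have If := integrable_mul mf mphi fC phiB; have Ih := integrable_mul mh mphi hC phiB.
under [in leLHS]eq_Rintegral do rewrite -mulrA mulrDl.
rewrite RintegralZl//; last exact: (integrableD measurableT If Ih).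
rewrite RintegralD//.
set a := (X in 2^-1 * (X + _)); set b := (X in 2^-1 * (_ + X)).
rewrite (_ : _ - L = 2^-1 * ((a - L) + (b - L))); last by field.
by rewrite normrM ger0_norm//; have := ler_normD (a - L) (b - L); lra.
Qed.

(* Komlos's argument: by the parallelogram law, almost minimal elements of the
   convex hulls of the tails form a Cauchy sequence. *)
Lemma L2_weak_compactness (g : nat -> X -> R) (C : R) :
  (forall n, measurable_fun setT (g n)) ->
  (forall n, (\int[mu]_x (g n x ^+ 2)%:E <= C%:E)%E) ->
  exists G : X -> R, exists D : R, [/\ measurable_fun setT G,
    (\int[mu]_x (G x ^+ 2)%:E <= D%:E)%E &
    forall phi (B L : R), measurable_fun setT phi ->
      (\int[mu]_x (phi x ^+ 2)%:E <= B%:E)%E ->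
      (\int[mu]_x (g n x * phi x) @[n --> \oo] --> L) ->
      \int[mu]_x (G x * phi x) = L].
Proof.
move=> mg gC.
pose N2 f := fine (\int[mu]_x (f x ^+ 2)%:E)%E.
have N20 f : 0 <= N2 f.
  by apply/fine_ge0/integral_ge0 => x _; rewrite lee_fin sqr_ge0.
have N2E f (A : R) : (\int[mu]_x (f x ^+ 2)%:E <= A%:E)%E ->
    (\int[mu]_x (f x ^+ 2)%:E = (N2 f)%:E)%E.
  move=> fA; rewrite fineK// ge0_fin_numE ?(le_lt_trans fA) ?ltry//.
  by apply: integral_ge0 => x _; rewrite lee_fin sqr_ge0.
have hullE n f : midpoint_hull g n f -> (\int[mu]_x (f x ^+ 2)%:E = (N2 f)%:E)%E.
  by move=> /(midpoint_hull_L2 mg gC)[_ /N2E].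
have hullC n f : midpoint_hull g n f -> N2 f <= C.
  by move=> H; rewrite -lee_fin -(hullE _ _ H); have [] := midpoint_hull_L2 mg gC H.
pose S n := [set N2 f | f in midpoint_hull g n].
have Sinf n : has_inf (S n).
  split; first by exists (N2 (g n)), (g n) => //; exact: midpoint_hull_gen.
  by exists 0 => _ [f _ <-].
(* The hulls shrink as n grows, so [inf (S n)] is nondecreasing; it is bounded by [C], and [D] is
   its limit. *)
pose D := sup (range (fun n => inf (S n))).
have infSC n : inf (S n) <= C.
  apply: (@le_trans _ _ (N2 (g n))).
    by apply: ge_inf; [exact: (Sinf n).2|exists (g n) => //; exact: midpoint_hull_gen].
  by apply: hullC; exact: midpoint_hull_gen (leqnn n).
have Dsup : has_sup (range (fun n => inf (S n))).
  by split; [exists (inf (S 0%N)), 0%N|exists C => _ [n _ <-]].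
have near_inf j : exists h, exists n : nat, [/\ (j <= n)%N, midpoint_hull g n h,
    D - 4^-1 ^+ j <= inf (S n) & N2 h <= D + 4^-1 ^+ j].
  have e0 : 0 < 4^-1 ^+ j :> R by rewrite exprn_gt0// invr_gt0.
  have [_ [n _ <-] hn] := sup_adherent e0 Dsup.
  pose m := maxn n j.
  have SS : S m `<=` S n.
    move=> _ [f hf <-]; exists f => //; apply: midpoint_hull_le hf; exact: leq_maxl.
  have hm : inf (S n) <= inf (S m).
    apply: lb_le_inf; first exact: (Sinf m).1.
    by move=> x /SS Sx; apply: ge_inf => //; exact: (Sinf n).2.
  have [_ [h Hh <-] hh] := inf_adherent e0 (Sinf m).
  exists h, m; split=> //; first exact: leq_maxr.
    by apply: le_trans hm; exact: ltW.
  apply: (le_trans (ltW hh)); rewrite lerD2r.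
  by apply: sup_ubound; [exact: Dsup.2|exists m].
have [h hP] := choice near_inf.
have [n {}hP] := choice hP.
have hh j : (\int[mu]_x ((h j.+1 x - h j x) ^+ 2)%:E <= (8 * 4^-1 ^+ j)%:E)%E.
  have [jn Hj Dj Nj] := hP j; have [jn1 Hj1 Dj1 Nj1] := hP j.+1.
  have [mh1 _] := midpoint_hull_L2 mg gC Hj; have [mh2 _] := midpoint_hull_L2 mg gC Hj1.
  have pj : 4^-1 ^+ j.+1 <= 4^-1 ^+ j :> R.
    by rewrite exprS; have : 0 <= 4^-1 ^+ j :> R; [rewrite exprn_ge0// invr_ge0|lra].
  (* The midpoint lies in the larger of the two hulls, whose infimum is still at least D - 4^-j. *)
  have [m Hm Dm] : exists2 m, midpoint_hull g m (fun x => 2^-1 * (h j x + h j.+1 x)) &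
      D - 4^-1 ^+ j <= inf (S m).
    exists (minn (n j) (n j.+1)).
      apply: midpoint_hull_mid.
        by apply: midpoint_hull_le Hj; exact: geq_minl.
      by apply: midpoint_hull_le Hj1; exact: geq_minr.
    case: leqP => _ //; apply: le_trans Dj1; lra.
  set mid := (fun x => _) in Hm.
  have NDm : D - 4^-1 ^+ j <= N2 mid.
    apply: le_trans Dm _; apply: ge_inf; first exact: (Sinf m).2.
    by exists mid.
  have [mmid _] := midpoint_hull_L2 mg gC Hm.
  (* Parallelogram law. The terms in [D] cancel, leaving 2 * 4^-j + 2 * 4^-(j+1) + 4 * 4^-j <= 8 *
     4^-j. *)
  have : (\int[mu]_x ((h j.+1 x - h j x) ^+ 2)%:E + (4 * N2 mid)%:E <=
          (2 * N2 (h j) + 2 * N2 (h j.+1))%:E)%E.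
    rewrite EFinM -(hullE _ _ Hm) -ge0_integralZl_EFin//; last 2 first.
    - by move=> x _; rewrite lee_fin sqr_ge0.
    - by apply/measurable_EFinP; exact: measurable_funX.
    rewrite -ge0_integralD//; last 4 first.
    - by move=> x _; rewrite lee_fin sqr_ge0.
    - by apply/measurable_EFinP; apply: measurable_funX; exact: measurable_funB.
    - by move=> x _; rewrite -EFinM lee_fin mulr_ge0 ?sqr_ge0.
    - by apply: measurable_funeM; apply/measurable_EFinP; exact: measurable_funX.
    under eq_integral do rewrite -EFinM -EFinD.
    apply: (@le_integral_lin2 _ _ _ _ _ _ (fun x => h j x ^+ 2) (fun x => h j.+1 x ^+ 2)) => //.
    - by move=> x _; have := sqr_ge0 (h j.+1 x - h j x); have := sqr_ge0 (mid x); lra.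
    - by move=> x _; exact: sqr_ge0.
    - by move=> x _; exact: sqr_ge0.
    - exact: measurable_funX.
    - exact: measurable_funX.
    - by move=> x _; rewrite /mid; lra.
    - by rewrite (hullE _ _ Hj).
    - by rewrite (hullE _ _ Hj1).
  rewrite -leeBrDr// -EFinB => /le_trans; apply; rewrite lee_fin; lra.
have mh j : measurable_fun setT (h j).
  by have [_ /(midpoint_hull_L2 mg gC)[]] := hP j.
have [G mG hG] := L2_fast_cauchy mh hh.
exists G, (2 * C + 2 * (4 * 8)); split=> //.
  apply: (@le_integral_lin2 _ _ _ _ _ _ (fun x => h 0%N x ^+ 2) (fun x => (h 0%N x - G x) ^+ 2)) => //.
  - by move=> x _; exact: sqr_ge0.
  - by move=> x _; exact: sqr_ge0.
  - by move=> x _; exact: sqr_ge0.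
  - exact: measurable_funX.
  - by apply: measurable_funX; exact: measurable_funB.
  - by move=> x _; have := sqr_ge0 (2 * h 0%N x - G x); lra.
  - by have [_ /(midpoint_hull_L2 mg gC)[]] := hP 0%N.
  - by have := hG 0%N; rewrite expr0 mulr1.
move=> phi B L mphi phiB cvgL.
apply/eqP; rewrite -subr_eq0 -normr_le0; apply/ler_addgt0Pl => e e0; rewrite addr0.
have B0 : 0 <= B.
  by rewrite -lee_fin; apply: le_trans phiB; apply: integral_ge0 => x _; rewrite lee_fin sqr_ge0.
have [n0 _ hn0] : \forall n \near \oo, `|\int[mu]_x (g n x * phi x) - L| <= e / 2.
  by move/cvgrPdistC_le : cvgL; apply; rewrite divr_gt0.
have [j0 _ hj0] : \forall j \near \oo, (32 + B) * 2^-1 ^+ j <= e / 2 :> R.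
  have : (32 + B) * 2^-1 ^+ j @[j --> \oo] --> (32 + B) * 0.
    by apply: cvgMr; apply: cvg_expr; rewrite ger0_norm ?invr_ge0// invf_lt1// ltr1n.
  by rewrite mulr0 => /cvgr_le; apply; rewrite divr_gt0.
pose j := maxn n0 j0.
have [jn Hj _ _] := hP j.
have E1 : `|\int[mu]_x (h j x * phi x) - L| <= e / 2.
  apply: midpoint_hull_Rintegral Hj => // [|m nm]; first exact: phiB.
  apply: hn0; apply: leq_trans nm; apply: leq_trans jn; exact: leq_maxl.
have [_ hjC] := midpoint_hull_L2 mg gC Hj.
have mhG : measurable_fun setT (fun x => h j x - G x) by exact: measurable_funB.
have E2 : `|\int[mu]_x ((h j x - G x) * phi x)| <= e / 2.
  (* The weight 2^j balances the rate 4^-j of [hG]: both terms of Young's inequality become of order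
     2^-j. *)
  have l0 : 0 < 2 ^+ j :> R by rewrite exprn_gt0.
  apply: le_trans (norm_Rintegral_mul_le l0 mhG mphi (hG j) phiB) _.
  apply: le_trans (hj0 j _); last exact: leq_maxr.
  have -> : 4^-1 = 2^-1 * 2^-1 :> R by field.
  rewrite exprMn (_ : 2 ^- j = 2^-1 ^+ j); last by rewrite exprVn.
  have -> : 2 ^+ j * (4 * 8 * (2^-1 ^+ j * 2^-1 ^+ j)) =
      32 * 2^-1 ^+ j * (2 ^+ j * 2^-1 ^+ j) :> R by ring.
  have -> : 2 ^+ j * 2^-1 ^+ j = 1 :> R by rewrite -exprMn mulfV ?pnatr_eq0// expr1n.
  by rewrite mulr1 (mulrDl 32 B) lerD2l mulrC.
have IG : mu.-integrable setT (EFin \o (fun x => (h j x - G x) * phi x)).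
  exact: integrable_mul mhG mphi (hG j) phiB.
have Ih := integrable_mul (mh j) mphi hjC phiB.
rewrite (_ : \int[mu]_x (G x * phi x) =
    \int[mu]_x (h j x * phi x) - \int[mu]_x ((h j x - G x) * phi x)).
  rewrite addrAC [leRHS](splitr e); apply: le_trans (ler_normB _ _) _; exact: lerD.
rewrite -RintegralB//; apply: eq_Rintegral => x _; ring.
Qed.

End weak_compactness.

(** * Lebesgue measure and functions constant on lattice cubes *)

Section lattice.
Context {R : realType} {n : nat}.
Implicit Types (x y : 'rV[R]_n) (l : 'rV[int]_n) (eta : R).

Definition lattice_floor eta x : 'rV[int]_n :=
  \row_i Num.floor (x ord0 i / eta).

Lemma lattice_floorP eta x l : 0 < eta ->
  (lattice_floor eta x = l) <-> cube (eta *: of_int l) eta x.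
Proof.
move=> e0.
have E l' m : (Num.floor (x ord0 m / eta) == l' ord0 m) =
    (eta * (l' ord0 m)%:~R <= x ord0 m < eta * (l' ord0 m)%:~R + eta).
  by rewrite floor_eq ler_pdivlMr// ltr_pdivrMr// intrD mulrDl mul1r [_ * eta]mulrC.
split=> [<- m|H].
  by rewrite [X in X <= _ < X + _]mxE [X in _ * X <= _ < _ * X + _]mxE -E mxE.
by apply/rowP => m; rewrite mxE; apply/eqP; rewrite E; have := H m; rewrite !mxE.
Qed.

Lemma measurable_cube (p : 'rV[R]_n) (s : R) : measurable (cube p s).
Proof.
rewrite (_ : cube p s = \bigcap_(i in [set: 'I_n])
    (fun x : 'rV[R]_n => x ord0 i) @^-1` `[p ord0 i, p ord0 i + s[%classic); last first.
  apply/seteqP; split=> x H i; have := H i; first by move=> h _ /=; rewrite in_itv.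
  by move=> /(_ I) /=; rewrite in_itv.
apply: fin_bigcap_measurable => [|i _]; first exact: finite_finset.
rewrite -[X in measurable X]setTI; exact: measurable_rV_coord.
Qed.

(** The lattice is countable, so an arbitrary set of indices gives a countable union of cubes. Step
    functions are thus measurable whatever their values. *)
Lemma measurable_lattice_preimage eta (Y : set 'rV[int]_n) : 0 < eta ->
  measurable (lattice_floor eta @^-1` Y).
Proof.
move=> e0; rewrite (_ : _ @^-1` Y = \bigcup_l (if l \in Y then cube (eta *: of_int l) eta else set0)).
  apply: countable_bigcupT_measurable => [|l]; first exact: countableP.
  by case: ifP => _; [exact: measurable_cube|exact: measurable0].
apply/seteqP; split=> [x /= Yx|x [l _]].
  exists (lattice_floor eta x) => //; rewrite (mem_set Yx).
  exact/lattice_floorP.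
by case: ifPn => // /set_mem Yl /(lattice_floorP _ _ e0); rewrite /preimage/= => ->.
Qed.

Lemma measurable_lattice_comp d (T : measurableType d) (G : 'rV[int]_n -> T) eta : 0 < eta ->
  measurable_fun setT (fun x => G (lattice_floor eta x)).
Proof.
move=> e0 _ Y mY; rewrite setTI.
exact: (@measurable_lattice_preimage eta (G @^-1` Y)).
Qed.

End lattice.

Lemma lebesgue_cube (R : realType) n (p : 'rV[R]_n) (s : R) : 0 <= s ->
  lebesgue_rV R n (cube p s) = (s ^+ n)%:E.
Proof.
move=> s0; elim: n p => [|n IH] p /=.
  rewrite expr0 diracE mem_set//; by move=> [].
rewrite /lebesgue_step /pushforward.
rewrite (_ : @rV_cons R n @^-1` cube p s =
    `[p ord0 ord0, p ord0 ord0 + s[%classic `*` cube (\row_j p ord0 (lift ord0 j)) s).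
  rewrite product_measure1E ?IH; last 2 first.
  - exact: measurable_itv.
  - exact: measurable_cube.
  transitivity (s%:E * (s ^+ n)%:E)%E; last by rewrite exprS EFinM.
  congr (_ * _)%E; rewrite [LHS]lebesgue_measure_itv/= lte_fin.
  case: ltP => [_|]; first by rewrite -EFinB addrAC subrr add0r.
  by rewrite gerDl => s00; congr (_%:E); apply/eqP; rewrite eq_le s0 s00.
apply/seteqP; split=> [[t y] /= H|[t y] [/= Ht Hy]].
  split; first by have := H ord0; rewrite mxE unlift_none/= in_itv.
  by move=> j; have := H (lift ord0 j); rewrite !mxE liftK.
by move=> j; rewrite mxE; case: unliftP => [i ->|->]; [have := Hy i; rewrite mxE|move: Ht; rewrite /= in_itv].
Qed.

(** For nonnegative [g] this is the bound of the sum over [A] by [D], expressed with finite real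
    sums only. *)
Definition sum_le (I : eqType) (R : realType) (A : set I) (g : I -> R) (D : R) :=
  forall s : seq I, uniq s -> (forall i, i \in s -> A i) -> \sum_(i <- s) g i <= D.

(** The space is a countable disjoint union of cubes of volume eta^n, enumerated by the codes of
    lattice points; an integer that codes no point receives the empty set. *)
Lemma integral_lattice_le (R : realType) n (g : 'rV[int]_n -> R) (D eta : R) :
  0 < eta -> (forall l, 0 <= g l) -> sum_le setT g D ->
  (\int[lebesgue_rV R n]_x (g (lattice_floor eta x))%:E <= (eta ^+ n * D)%:E)%E.
Proof.
move=> e0 g0 gD.
pose F k : set 'rV[R]_n := if pickle_inv k is Some l then cube (eta *: of_int l) eta else set0.
have FT : \bigcup_k F k = [set: 'rV[R]_n].
  apply/seteqP; split=> // x _; exists (choice.pickle (lattice_floor eta x)) => //.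
  by rewrite /F pickleK_inv; apply/lattice_floorP.
have mF k : measurable (F k).
  by rewrite /F; case: pickle_inv => [l|]; [exact: measurable_cube|exact: measurable0].
rewrite -FT ge0_integral_bigcup//; last 3 first.
- by apply/measurable_EFinP/measurable_funTS; exact: measurable_lattice_comp.
- by move=> x _; rewrite lee_fin.
- apply/trivIsetP => i j _ _ ij; apply/seteqP; split=> // x; rewrite /F.
  case Ei: (pickle_inv i) => [l|]; case Ej: (pickle_inv j) => [l'|]; try by case.
  move=> [/(lattice_floorP _ _ e0) h1 /(lattice_floorP _ _ e0) h2].
  have hi := (choice.pickle_invK i : oapp _ i (choice.pickle_inv i : option 'rV[int]_n) = i).
  have hj := (choice.pickle_invK j : oapp _ j (choice.pickle_inv j : option 'rV[int]_n) = j).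
  move: hi hj; rewrite Ei Ej /=.
  by rewrite -h1 -h2 => hi hj; rewrite -hi -hj eqxx in ij.
have IF k : (\int[lebesgue_rV R n]_(x in F k) (g (lattice_floor eta x))%:E =
    (if pickle_inv k is Some l then eta ^+ n * g l else 0)%:E)%E.
  rewrite /F; case: pickle_inv => [l|]; last by rewrite integral_set0.
  rewrite (eq_integral (cst (g l)%:E)).
    rewrite integral_cst; last exact: measurable_cube.
    rewrite EFinM muleC; congr (_ * _)%E.
    by apply: lebesgue_cube; exact: ltW.
  by move=> x /set_mem /(lattice_floorP _ _ e0) ->.
apply: lime_le; first by apply: is_cvg_nneseries => k _ _; apply: integral_ge0 => x _; rewrite lee_fin.
apply: nearW => N; rewrite (eq_bigr _ (fun k _ => IF k)) sumEFin lee_fin.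
pose s := pmap (@pickle_inv 'rV[int]_n) (index_iota 0 N).
have us : uniq s.
  apply: pmap_uniq (iota_uniq _ _) => k; exact: pickle_invK.
rewrite (_ : \sum_(0 <= i < N) _ = \sum_(l <- s) eta ^+ n * g l).
  by rewrite -big_distrr/= ler_wpM2l ?gD// exprn_ge0// ltW.
rewrite /s; elim: (index_iota 0 N) => [|k r IH]; first by rewrite !big_nil.
by rewrite big_cons IH /=; case: pickle_inv => [l|] /=; rewrite ?big_cons ?add0r.
Qed.

Section euclidean_topology.
Context {R : realType} {n : nat}.
Implicit Types (x y : 'rV[R]_n).

Lemma rV_ballE x (r : R) y : ball x r y <-> 0 < r /\ forall i, `|x ord0 i - y ord0 i| < r.
Proof.
split=> [[r0 H]|[r0 H]]; split=> //; first by move=> i; exact: H.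
by move=> i j; rewrite ord1; exact: H.
Qed.

Lemma lattice_floor_close (eta : R) x i : 0 < eta ->
  0 <= x ord0 i - eta * (lattice_floor eta x ord0 i)%:~R < eta.
Proof.
move=> e0; have /(lattice_floorP _ _ e0)/(_ i) : lattice_floor eta x = lattice_floor eta x by [].
by rewrite !mxE; lra.
Qed.

(** The sigma-algebra is generated by the coordinates, so an open set is reached as the countable
    union of the lattice cubes of side 1/(k+1) contained in it. *)
Lemma open_measurable_rV (A : set 'rV[R]_n) : open A -> measurable A.
Proof.
move=> oA.
pose e k : R := k.+1%:R^-1.
have e0 k : 0 < e k by rewrite invr_gt0.
rewrite (_ : A = \bigcup_k (lattice_floor (e k) @^-1`
    [set l | cube (e k *: of_int l) (e k) `<=` A])).
  by apply: bigcup_measurable => k _; exact: measurable_lattice_preimage.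
apply/seteqP; split=> [x Ax|x [k _] /=]; last first.
  by apply; exact/lattice_floorP.
have /nbhs_ballP[r /= r0 rA] := open_nbhs_nbhs (conj oA Ax).
have [k kr] : exists k, e k < r.
  have [k _ /(_ _ (leqnn k))] := near_infty_natSinv_lt (PosNum r0).
  by exists k.
exists k => //= y Cy; apply: rA; apply/rV_ballE; split=> // i.
have := Cy i; have := lattice_floor_close x i (e0 k); rewrite !mxE => h1 h2.
by rewrite ltr_norml; lra.
Qed.

Lemma continuous_measurable_rV (f : 'rV[R]_n -> R) :
  continuous (f : _ -> R^o) -> measurable_fun setT f.
Proof.
move=> cf; apply: (measurability _ (RGenOInfty.measurableE R)) => //.
move=> _ [_ [a ->] <-]; rewrite setTI; apply: open_measurable_rV.
by apply: open_comp => // x _; exact: cf.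
Qed.

End euclidean_topology.

Section translation_invariance.
Context {R : realType}.

Definition shift_R (a : R) : measurableTypeR R -> measurableTypeR R := fun t => t + a.

Lemma measurable_shift_R a : measurable_fun setT (shift_R a).
Proof. by apply: measurable_funD. Qed.

Lemma lebesgue_measure_shift (a : R) (A : set R) : measurable A ->
  pushforward (@lebesgue_measure R) (shift_R a) A = lebesgue_measure A.
Proof.
move=> mA; apply/esym/lebesgue_measure_unique => //.
  exact: measurable_shift_R.
move=> _ _ [[p q] _ <-] /=.
rewrite /pushforward (_ : _ @^-1` _ = `]p - a, q - a]%classic).
  by rewrite !lebesgue_measure_itv/= !lte_fin ltrD2r; case: ifP => // _; congr (_%:E); ring.
by apply/seteqP; split=> t /=; rewrite !in_itv/= /shift_R; lra.
Qed.

Definition shift_rV n (a x : 'rV[R]_n) : 'rV[R]_n := x + a.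

Lemma measurable_shift_rV n (a : 'rV[R]_n) : measurable_fun setT (shift_rV a).
Proof.
apply/measurable_fun_rVP => i; under eq_fun do rewrite mxE.
by apply: measurable_funD => //; exact: measurable_rV_coord.
Qed.

(** Induction on the dimension through sections: the induction hypothesis moves each section, and
    one-dimensional invariance moves the outer integral. *)
Lemma lebesgue_rV_shift n (a : 'rV[R]_n) (A : set 'rV[R]_n) : measurable A ->
  pushforward (lebesgue_rV R n) (shift_rV a) A = lebesgue_rV R n A.
Proof.
elim: n a A => [|n IH] a A mA.
  by rewrite /pushforward (_ : _ @^-1` _ = A)//; apply/seteqP; split=> x /=; rewrite /shift_rV (thinmx0 a) addr0.
rewrite /pushforward /= /lebesgue_step /pushforward/=.
pose a' : 'rV[R]_n := \row_j a ord0 (lift ord0 j).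
have mcA : measurable (@rV_cons R n @^-1` A).
  by rewrite -[X in measurable X]setTI; exact: measurable_rV_cons.
rewrite /product_measure1.
pose F (t : measurableTypeR R) := lebesgue_rV R n (xsection (@rV_cons R n @^-1` A) t).
have mF : measurable_fun setT F by exact: measurable_fun_xsection.
have F0 t : (0 <= F t)%E by exact: measure_ge0.
transitivity (\int[lebesgue_measure]_t F (shift_R (a ord0 ord0) t))%E.
  apply: eq_integral => t _ /=.
  have mx : measurable (xsection (@rV_cons R n @^-1` A) (shift_R (a ord0 ord0) t)).
    exact: measurable_xsection.
  rewrite /F -(IH a' _ mx) /pushforward.
  congr (lebesgue_rV R n _); apply/seteqP.
  have E y : shift_rV a (rV_cons (t, y)) =
      rV_cons (shift_R (a ord0 ord0) t, shift_rV a' y).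
    by apply/rowP => j; rewrite !mxE; case: unliftP => [i ->|->] //=; rewrite !mxE.
  by split=> y; rewrite /xsection/= !inE/= E.
have := ge0_integral_pushforward (measurable_shift_R (a ord0 ord0))
  (lebesgue_measure : {measure set (measurableTypeR R) -> \bar R}) measurableT mF (fun t _ => F0 t).
rewrite preimage_setT => <-.
apply: eq_measure_integral => [|? B mB _]; first exact: measurable_shift_R.
exact: lebesgue_measure_shift.
Qed.

Lemma ge0_integral_shift n (a : 'rV[R]_n) (f : 'rV[R]_n -> R) :
  measurable_fun setT f -> (forall x, 0 <= f x) ->
  (\int[lebesgue_rV R n]_x (f (x + a))%:E = \int[lebesgue_rV R n]_x (f x)%:E)%E.
Proof.
move=> mf f0; have mEf : measurable_fun setT (EFin \o f) by exact/measurable_EFinP.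
have f0E x : x \in [set: 'rV[R]_n] -> (0 <= (EFin \o f) x)%E by rewrite lee_fin.
have := ge0_integral_pushforward (measurable_shift_rV a) (lebesgue_rV R n) measurableT mEf f0E.
rewrite preimage_setT => <-.
apply: eq_measure_integral => [|? B mB _]; first exact: measurable_shift_rV.
exact: lebesgue_rV_shift.
Qed.

Lemma integrable_shift n (a : 'rV[R]_n) (f : 'rV[R]_n -> R) :
  (lebesgue_rV R n).-integrable setT (EFin \o f) ->
  (lebesgue_rV R n).-integrable setT (EFin \o (fun x => f (x + a))).
Proof.
move=> /integrableP[/measurable_EFinP mf fI]; apply/integrableP; split.
  by apply/measurable_EFinP; apply: (measurableT_comp mf (measurable_shift_rV a)).
have := @ge0_integral_shift n a (fun x => `|f x|); rewrite /= => -> //.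
exact: measurableT_comp.
Qed.

Lemma Rintegral_shift n (a : 'rV[R]_n) (f : 'rV[R]_n -> R) :
  (lebesgue_rV R n).-integrable setT (EFin \o f) ->
  \int[lebesgue_rV R n]_x f (x + a) = \int[lebesgue_rV R n]_x f x.
Proof.
move=> If; rewrite /Rintegral; congr fine.
have := integral_pushforward (measurable_shift_rV a) (measurable_int _ If) _ measurableT.
rewrite preimage_setT => /(_ _ (integrable_shift a If)) <-.
apply: eq_measure_integral => [|? B mB _]; first exact: measurable_shift_rV.
exact: lebesgue_rV_shift.
Qed.

End translation_invariance.

(** * Translation estimates on the lattice *)

Section finite_sums.
Context {R : realType}.

Lemma sqr_sum_le (I : Type) (r : seq I) (a : I -> R) :
  (\sum_(i <- r) a i) ^+ 2 <= (size r)%:R * \sum_(i <- r) a i ^+ 2.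
Proof.
elim: r => [|i r IH]; first by rewrite !big_nil mulr0 expr0n.
rewrite !big_cons [size _]/= -[(size r).+1]addn1 natrD.
case: r IH => [|j r]; first by rewrite !big_nil !addr0 add0r mul1r.
set S := \sum_(_ <- _) a _; set Q := \sum_(_ <- _) _ ^+ 2; set N := (size (j :: r))%:R.
have N0 : 0 < N by rewrite ltr0n.
move: (a i) => x SQ; rewrite -(ler_pM2l N0).
have := sqr_ge0 (S - N * x); nra.
Qed.

Lemma sqr_sum_card_le (I : finType) (a : I -> R) :
  (\sum_i a i) ^+ 2 <= #|I|%:R * \sum_i a i ^+ 2.
Proof.
by have := sqr_sum_le (enum I) a; rewrite !big_enum -cardE.
Qed.

Lemma ler_sum_inj (A B : finType) (h : A -> B) (G : B -> R) : injective h ->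
  (forall b, 0 <= G b) -> \sum_a G (h a) <= \sum_b G b.
Proof.
move=> hI G0; rewrite -(big_imset (h := h) (A := predT) G (in2W hI))/=.
by rewrite [leRHS](bigID (mem [set h x | x in predT]%SET))/= lerDl sumr_ge0.
Qed.

Implicit Types (I J : eqType).

Lemma sum_le_mono I (A : set I) (g g' : I -> R) D D' :
  (forall i, A i -> g i <= g' i) -> D' <= D -> sum_le A g' D' -> sum_le A g D.
Proof.
move=> gg' DD' H s us sA; apply: le_trans DD'; apply: le_trans (H s us sA).
by rewrite big_seq [leRHS]big_seq; apply: ler_sum => i /sA; exact: gg'.
Qed.

Lemma sum_le_ge0 I (A : set I) (g : I -> R) D : sum_le A g D -> 0 <= D.
Proof. by move=> /(_ [::] isT); rewrite big_nil; apply. Qed.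

Lemma sum_le_reindex I J (A : set I) (B : set J) (h : I -> J) (g : J -> R) D :
  injective h -> (forall i, A i -> B (h i)) ->
  sum_le B g D -> sum_le A (fun i => g (h i)) D.
Proof.
move=> hI AB H s us sA; have := H (map h s); rewrite big_map map_inj_uniq//; apply => //.
by move=> j /mapP[i /sA /AB ? ->].
Qed.

Lemma sum_le_sum I (K : Type) (r : seq K) (A : set I) (g : K -> I -> R) (D : K -> R) :
  (forall k, sum_le A (g k) (D k)) ->
  sum_le A (fun i => \sum_(k <- r) g k i) (\sum_(k <- r) D k).
Proof.
by move=> H s us sA; rewrite exchange_big; apply: ler_sum => k _; exact: H.
Qed.

Lemma sum_leZ I (A : set I) (g : I -> R) (c D : R) : 0 <= c ->
  sum_le A g D -> sum_le A (fun i => c * g i) (c * D).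
Proof. by move=> c0 H s us sA; rewrite -big_distrr/= ler_wpM2l// H. Qed.

(** Telescoping followed by Cauchy-Schwarz on the N increments, whence the factor N. Each [D k]
    bounds the k-th increment over all indices simultaneously. *)
Lemma sum_le_path I (A : set I) (N : nat) (F : nat -> I -> R) (D : nat -> R) :
  (forall k, (k < N)%N -> sum_le A (fun i => (F k.+1 i - F k i) ^+ 2) (D k)) ->
  sum_le A (fun i => (F N i - F 0%N i) ^+ 2) (N%:R * \sum_(k < N) D k).
Proof.
move=> H; apply: (@sum_le_mono _ _ _
  (fun i => N%:R * \sum_(k < N) (F k.+1 i - F k i) ^+ 2) _ (N%:R * \sum_(k < N) D k)) => //.
  move=> i _; rewrite -(telescope_sumr (F ^~ i) (leq0n N)) big_mkord.
  by have := sqr_sum_card_le (fun k : 'I_N => F k.+1 i - F k i); rewrite card_ord.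
by apply: sum_leZ => //; apply: sum_le_sum => k; exact: H.
Qed.

End finite_sums.

Section lattice_translation.
Context {R : realType} {n : nat}.
Implicit Types (f : 'rV[int]_n -> R) (l t : 'rV[int]_n) (D : R).
Local Notation e m := (delta_mx ord0 m : 'rV[int]_n).

Lemma sum_le_translate1 f D m (N : nat) :
  sum_le setT (fun l => (f (l + e m) - f l) ^+ 2) D ->
  sum_le setT (fun l => (f (l + N%:Z *: e m) - f l) ^+ 2) (N%:R ^+ 2 * D).
Proof.
move=> H.
apply: (@sum_le_mono _ _ _ _ (fun l => (f (l + N%:Z *: e m) - f (l + 0%:Z *: e m)) ^+ 2)
  _ (N%:R * \sum_(k < N) D)).
- by move=> l _; rewrite scale0r addr0.
- by rewrite sumr_const card_ord -[D *+ N]mulr_natl mulrA -expr2.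
apply: (@sum_le_path _ _ _ N (fun k l => f (l + k%:Z *: e m)) (fun=> D)) => k _.
have h : injective (fun l => l + k%:Z *: e m) by exact: addIr.
apply: sum_le_mono (sum_le_reindex h (fun _ _ => I) H) => // l _.
have -> : k.+1%:Z = k%:Z + 1 by lia.
by rewrite scalerDl scale1r addrA.
Qed.

Lemma sum_le_translate1z f D m (z : int) (N : nat) : (`|z| <= N)%N ->
  sum_le setT (fun l => (f (l + e m) - f l) ^+ 2) D ->
  sum_le setT (fun l => (f (l + z *: e m) - f l) ^+ 2) (N%:R ^+ 2 * D).
Proof.
move=> zN H.
have D0 := sum_le_ge0 H.
have zND : `|z|%N%:R ^+ 2 * D <= N%:R ^+ 2 * D.
  by rewrite ler_wpM2r// lerXn2r ?nnegrE ?ler0n// ler_nat.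
have K := sum_le_translate1 `|z|%N H.
case: (ltrP z 0) => z0; last first.
  by apply: sum_le_mono K => // l _; rewrite gez0_abs.
(* For negative z, reindexing by l + z e_m turns the backward difference into a forward one. *)
have h : injective (fun l => l + z *: e m) by exact: addIr.
apply: sum_le_mono (sum_le_reindex h (fun _ _ => I) K) => // l _.
by rewrite -sqrrN opprB -addrA -scalerDl ltz0_abs// subrr scale0r addr0.
Qed.

Lemma sum_le_translate f D t (N : nat) : (forall m, (`|t ord0 m| <= N)%N) ->
  (forall m, sum_le setT (fun l => (f (l + e m) - f l) ^+ 2) D) ->
  sum_le setT (fun l => (f (l + t) - f l) ^+ 2) ((n * N)%:R ^+ 2 * D).
Proof.
move=> tN H.
(* [z k] keeps the first k coordinates of [t], which gives a path of n axis-parallel moves from 0 to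
   [t]. *)
pose z k := \sum_(i < n | (i < k)%N) t ord0 i *: e i.
have zn : z n = t.
  by rewrite [RHS]row_sum_delta; apply: eq_bigl => i; rewrite ltn_ord.
have z0 : z 0%N = 0 by rewrite /z big_pred0.
apply: (@sum_le_mono _ _ _ _ (fun l => (f (l + z n) - f (l + z 0%N)) ^+ 2)
  _ (n%:R * \sum_(k < n) (N%:R ^+ 2 * D))).
- by move=> l _; rewrite zn z0 addr0.
- rewrite sumr_const card_ord -[_ *+ n]mulr_natl natrM le_eqVlt; apply/orP; left; apply/eqP; ring.
apply: (@sum_le_path _ _ _ n (fun k l => f (l + z k)) (fun=> N%:R ^+ 2 * D)) => k kn.
have h : injective (fun l => l + z k) by exact: addIr.
have K := sum_le_translate1z (tN (Ordinal kn)) (H (Ordinal kn)).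
apply: sum_le_mono (sum_le_reindex h (fun _ _ => I) K) => // l _.
rewrite -addrA /z [in X in f (l + X)](bigD1 (Ordinal kn))//= addrC.
rewrite [in X in f X](_ : \sum_(i < n | _) _ = z k) //.
apply: eq_bigl => i; rewrite ltnS andbC leq_eqVlt -(inj_eq val_inj)/=.
by case: (ltngtP i k).
Qed.

End lattice_translation.

Section block_average.
Context {R : realType} {n : nat}.
Implicit Types (f : 'rV[int]_n -> R) (l : 'rV[int]_n) (D : R) (M : nat).
Local Notation e m := (delta_mx ord0 m : 'rV[int]_n).

Definition box_point M (h : 'rV['I_M]_n) : 'rV[int]_n := map_mx (fun i : 'I_M => i%:Z) h.

Lemma box_point_inj M : injective (@box_point M).
Proof.
move=> h h' /rowP H; apply/rowP => i; apply/val_inj.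
by have := H i; rewrite !mxE => -[].
Qed.

Definition block_average f M l : R :=
  (M%:R ^+ n)^-1 * \sum_(h : 'rV['I_M]_n) f (l + box_point h).

Lemma card_box M : #|{: 'rV['I_M]_n}| = (M ^ n)%N.
Proof. by rewrite card_mx card_ord mul1n. Qed.

Lemma sqr_block_average_le f M l (x : R) : (0 < M)%N ->
  (block_average f M l - x) ^+ 2 <=
  (M%:R ^+ n)^-1 * \sum_(h : 'rV['I_M]_n) (f (l + box_point h) - x) ^+ 2.
Proof.
move=> M0; have Mn : 0 < M%:R ^+ n :> R by rewrite exprn_gt0// ltr0n.
have -> : block_average f M l - x =
    (M%:R ^+ n)^-1 * \sum_(h : 'rV['I_M]_n) (f (l + box_point h) - x).
  rewrite sumrB mulrBr -/(block_average f M l) sumr_const card_box -[x *+ _]mulr_natl natrX.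
  by rewrite mulrA mulVf ?mul1r// gt_eqF.
rewrite exprMn expr2 -mulrA ler_wpM2l ?invr_ge0 ?(ltW Mn)// ler_pdivrMl//.
rewrite -natrX -card_box.
exact: sqr_sum_card_le.
Qed.

Lemma block_average_bound f M l (A : set 'rV[int]_n) D : (0 < M)%N ->
  (forall h : 'rV['I_M]_n, A (l + box_point h)) ->
  sum_le A (fun l => f l ^+ 2) D ->
  block_average f M l ^+ 2 <= (M%:R ^+ n)^-1 * D.
Proof.
move=> M0 lA H; rewrite -[block_average _ _ _]subr0.
apply: le_trans (sqr_block_average_le _ _ _ M0) _.
rewrite ler_wpM2l ?invr_ge0 ?exprn_ge0//.
have hI : injective (fun h => l + @box_point M h) by move=> h h' /addrI /box_point_inj.
have := sum_le_reindex hI (A := setT) (fun h _ => lA h) H.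
move=> /(_ (index_enum _) (index_enum_uniq _)) /(_ (fun _ _ => I)).
by under [in X in _ -> X]eq_bigr do rewrite subr0.
Qed.

(** The difference of two block averages is the block average of a translation difference. The
    factor M^-n left by Jensen's inequality is what later absorbs the 1 / eta^n of the gradient
    bound. *)
Lemma block_average_diff f M l l' D (N : nat) : (0 < M)%N ->
  (forall m, (`|l' ord0 m - l ord0 m| <= N)%N) ->
  (forall m, sum_le setT (fun l => (f (l + e m) - f l) ^+ 2) D) ->
  (block_average f M l' - block_average f M l) ^+ 2 <=
  (M%:R ^+ n)^-1 * ((n * N)%:R ^+ 2 * D).
Proof.
move=> M0 ll' H.
have -> : block_average f M l' - block_average f M l =
    block_average (fun i => f (i + (l' - l)) - f i) M l - 0.
  rewrite /block_average -mulrBr -sumrB subr0; congr (_ * _); apply: eq_bigr => h _.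
  by congr (f _ - _); rewrite [RHS]addrC addrA subrK.
apply: le_trans (sqr_block_average_le _ _ _ M0) _.
rewrite ler_wpM2l ?invr_ge0 ?exprn_ge0//.
have hI : injective (fun h => l + @box_point M h) by move=> h h' /addrI /box_point_inj.
have K : sum_le setT (fun i => (f (i + (l' - l)) - f i) ^+ 2) ((n * N)%:R ^+ 2 * D).
  by apply: sum_le_translate => // m; rewrite !mxE.
have := sum_le_reindex hI (A := setT) (fun h _ => I) K.
move=> /(_ (index_enum _) (index_enum_uniq _)) /(_ (fun _ _ => I)).
by under [in X in _ -> X]eq_bigr do rewrite subr0.
Qed.

(* The box of offsets is wide enough to contain the cells of any block of side M
   whose base is within M + 1 of l, wherever that block lies. *)
Definition block_variation f M l : R :=
  (M%:R ^+ n)^-1 * \sum_(t : 'rV['I_(2 * M + 3)]_n)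
    (f (l + (box_point t - const_mx M.+1%:Z)) - f l) ^+ 2.

Lemma block_variation_ge0 f M l : 0 <= block_variation f M l.
Proof.
rewrite mulr_ge0 ?invr_ge0 ?exprn_ge0// sumr_ge0// => t _; exact: sqr_ge0.
Qed.

(** After Jensen's inequality every term of the average is a term of the variation. The shift by M +
    1 makes the offsets from [l] nonnegative, so that they index the box injectively. *)
Lemma block_average_close f M l l' : (0 < M)%N ->
  (forall m, 0 <= l ord0 m - l' ord0 m <= M.+1%:Z) ->
  (block_average f M l' - f l) ^+ 2 <= block_variation f M l.
Proof.
move=> M0 ll'; apply: le_trans (sqr_block_average_le _ _ _ M0) _.
rewrite ler_wpM2l ?invr_ge0 ?exprn_ge0//.
pose z (h : 'rV['I_M]_n) m : int := l' ord0 m - l ord0 m + M.+1%:Z + (h ord0 m)%:Z.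
have z0 h m : 0 <= z h m by rewrite /z; have := ll' m; lia.
have zlt h m : (`|z h m| < 2 * M + 3)%N.
  by rewrite /z; have := ll' m; have := ltn_ord (h ord0 m); lia.
pose g (h : 'rV['I_M]_n) : 'rV['I_(2 * M + 3)]_n := \row_m Ordinal (zlt h m).
have gI : injective g.
  move=> h h' /rowP H; apply/rowP => m; have := H m; rewrite !mxE => -[].
  move=> E; suff : h ord0 m = h' ord0 m :> nat by move/val_inj.
  by move: (z0 h m) (z0 h' m) E; rewrite /z; lia.
rewrite (eq_bigr (fun h => (f (l + (box_point (g h) - const_mx M.+1%:Z)) - f l) ^+ 2)).
  by apply: (@ler_sum_inj _ _ _ g (fun t => (f (l + (box_point t - const_mx M.+1%:Z)) - f l) ^+ 2)) => // b; exact: sqr_ge0.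
move=> h _; congr ((f _ - _) ^+ 2); apply/rowP => m; rewrite !mxE/= gez0_abs//.
rewrite (_ : z h m = l' 0 m - l 0 m + M.+1%:Z + (h 0 m)%:Z)//; lia.
Qed.

(** There are (2M + 3)^n <= (5M)^n offsets, whence 5^n after division by M^n; their coordinates are
    at most M + 1 <= 2M in absolute value, whence (2n)^2 M^2. *)
Lemma sum_le_block_variation f M D : (0 < n)%N -> (0 < M)%N ->
  (forall m, sum_le setT (fun l => (f (l + e m) - f l) ^+ 2) D) ->
  sum_le setT (block_variation f M) (5 ^+ n * (2 * n%:R) ^+ 2 * (M%:R ^+ 2 * D)).
Proof.
move=> n0 M0 H.
have D0 : 0 <= D by have := sum_le_ge0 (H (Ordinal n0)).
have K (t : 'rV['I_(2 * M + 3)]_n) :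
    sum_le setT (fun l => (f (l + (box_point t - const_mx M.+1%:Z)) - f l) ^+ 2)
      ((n * M.+1)%:R ^+ 2 * D).
  by apply: sum_le_translate => // m; rewrite !mxE; have := ltn_ord (t ord0 m); lia.
apply: sum_le_mono (sum_leZ (c := (M%:R ^+ n)^-1) _ (sum_le_sum (index_enum _) K)) => //.
rewrite sumr_const -[_ *+ #|_|]mulr_natl.
rewrite (_ : #|_| = ((2 * M + 3) ^ n)%N); last by rewrite -card_box.
rewrite natrX mulrA -exprVn -exprMn -!mulrA; apply: ler_pM.
- by rewrite exprn_ge0// mulr_ge0// invr_ge0.
- by rewrite !mulr_ge0.
- rewrite lerXn2r ?nnegrE ?mulr_ge0 ?invr_ge0// ler_pdivrMl ?ltr0n//.
  by rewrite -natrM ler_nat; lia.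
by rewrite !mulrA ler_wpM2r// -!natrM ler_nat; nia.
Qed.

End block_average.

(** * Compactness of lattice functions *)

Section ultrafilter_limits.
Context {R : realType}.

(** The limit is the supremum of the numbers that lie below [a] on a set of [F]. The ultrafilter
    decides whether [a] exceeds this supremum by e, and maximality forbids it. *)
Lemma ultra_bounded_cvg (F : set_system nat) (a : nat -> R) (B : R) :
  UltraFilter F -> (\forall N \near F, `|a N| <= B) ->
  exists l : R, a N @[N --> F] --> l.
Proof.
move=> UF aB.
pose S := [set x | \forall N \near F, x <= a N].
have S0 : S (- B) by apply: filterS aB => N; rewrite ler_norml => /andP[].
have SB : ubound S B.
  move=> x Sx; have [N [xN]] := filter_ex (filterI Sx aB); rewrite ler_norml => /andP[_].
  exact: le_trans.
have Ssup : has_sup S by split; [exists (- B)|exists B].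
exists (sup S); apply/cvgrPdist_le => e e0.
have [x Sx xe] := sup_adherent e0 Ssup.
have nS : ~ S (sup S + e).
  move=> /(sup_upper_bound Ssup); rewrite gerDl leNgt e0//.
have [//|nS'] := in_ultra_setVsetC [set N | sup S + e <= a N] UF.
near=> N.
have h1 : x <= a N by near: N.
have h2 : ~ (sup S + e <= a N) by near: N.
rewrite ler_norml; move: h2 => /negP; rewrite -ltNge => h2.
rewrite lerNl opprB lerBlDr; lra.
Unshelve. all: by end_near. Qed.

Lemma extraction (P : nat -> nat -> Prop) :
  (forall k m, exists N, (m < N)%N /\ P k N) ->
  exists2 s : nat -> nat, {homo s : m n / (m < n)%N} & forall k, P k (s k).
Proof.
move=> H.
have [g gP] := choice (fun km : nat * nat => H km.1 km.2).
pose s := fix s k := if k is k'.+1 then g (k, s k') else g (0%N, 0%N).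
exists s.
  by apply: homo_ltn => [? ? ?|k]; [exact: ltn_trans|exact: (gP (k.+1, s k)).1].
by case=> [|k]; [exact: (gP (0%N, 0%N)).2|exact: (gP (k.+1, s k)).2].
Qed.

End ultrafilter_limits.

Section boxes.
Context {R : realType} {n : nat}.

Definition big_cube (r : nat) : set 'rV[R]_n := cube (const_mx (- r%:R)) (r%:R + r%:R).

Lemma big_cubeP r (x : 'rV[R]_n) : big_cube r x <-> forall i, - r%:R <= x ord0 i < r%:R.
Proof. by split=> H i; have := H i; rewrite mxE addrA addNr add0r. Qed.

Lemma measurable_big_cube r : measurable (big_cube r).
Proof. exact: measurable_cube. Qed.

Lemma big_cube_le r r' : (r <= r')%N -> big_cube r `<=` big_cube r'.
Proof.
move=> rr' x /big_cubeP H; apply/big_cubeP => i; have := H i.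
have : r%:R <= r'%:R :> R by rewrite ler_nat. 
lra.
Qed.

Lemma in_big_cube (x : 'rV[R]_n) : exists r, big_cube r x.
Proof.
exists (\sum_i (Num.truncn `|x ord0 i|).+1)%N; apply/big_cubeP => i.
have : `|x ord0 i| < (\sum_i (Num.truncn `|x ord0 i|).+1)%N%:R.
  by apply: lt_le_trans (truncnS_gt _) _; rewrite ler_nat (bigD1 i)//= leq_addr.
by rewrite ltr_norml => /andP[/ltW -> ->].
Qed.

Lemma lattice_box_seq (c : nat) : exists s : seq 'rV[int]_n, uniq s /\
  forall q : 'rV[int]_n, (forall i, (`|q ord0 i| <= c)%N) -> q \in s.
Proof.
exists [seq box_point h - const_mx c%:Z | h : 'rV['I_(2 * c + 1)]_n]; split.
  rewrite map_inj_uniq ?enum_uniq// => h h' /addIr; exact: box_point_inj.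
move=> q qc; pose z i : int := q ord0 i + c%:Z.
have zlt i : (`|z i| < 2 * c + 1)%N by rewrite /z; have := qc i; lia.
apply/mapP; exists (\row_i Ordinal (zlt i)); first by rewrite mem_enum.
apply/rowP => i; rewrite !mxE/= gez0_abs.
  by rewrite (_ : z i = q 0 i + c%:Z)//; lia.
by rewrite /z; have := qc i; lia.
Qed.

Lemma big_cube_finite (delta : R) (r : nat) : 0 < delta ->
  exists s : seq 'rV[int]_n, uniq s /\
  forall x, big_cube r x -> lattice_floor delta x \in s.
Proof.
move=> d0; have [s [us sP]] := lattice_box_seq (Num.truncn (r%:R / delta)).+1.
exists s; split=> // x /big_cubeP H; apply: sP => i.
rewrite mxE; have := H i => /andP[h1 h2].
have := truncnS_gt (r%:R / delta); set c := (Num.truncn _).+1 => hc.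
have hf := floor_itv (x ord0 i / delta).
have u1 : x ord0 i / delta < c%:R.
  by apply: lt_trans hc; rewrite ltr_pM2r ?invr_gt0.
have u2 : - c%:R < x ord0 i / delta.
  by rewrite ltrNl -mulNr; apply: le_lt_trans hc; rewrite ler_pM2r ?invr_gt0//; lra.
move: hf; set z := Num.floor _ => /andP[k1 k2].
have z1 : z < c%:Z by rewrite -(ltr_int R); apply: le_lt_trans k1 u1.
have z2 : - c%:Z < z + 1 by rewrite -(ltr_int R) mulrNz; apply: lt_trans u2 k2.
lia.
Qed.

Lemma step_function_bounded (G : 'rV[int]_n -> R) (delta : R) (r : nat) : 0 < delta ->
  exists b, forall x, big_cube r x -> `|G (lattice_floor delta x)| <= b.
Proof.
move=> /(big_cube_finite r)[s [us sP]]; exists (\sum_(q <- s) `|G q|) => x /sP xs.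
by rewrite (bigD1_seq _ xs us)/= lerDl sumr_ge0.
Qed.

Lemma step_function_sq_integral (G : 'rV[int]_n -> R) (delta : R) (r : nat)
    (s : seq 'rV[int]_n) : 0 < delta -> uniq s -> (forall q, 0 <= G q) ->
  (forall x, big_cube r x -> lattice_floor delta x \in s) ->
  (\int[lebesgue_rV R n]_(x in big_cube r) (G (lattice_floor delta x))%:E <=
   (delta ^+ n * \sum_(q <- s) G q)%:E)%E.
Proof.
move=> d0 us G0 sP.
apply: le_trans (integral_lattice_le (g := fun q => if q \in s then G q else 0)
  (D := \sum_(q <- s) G q) d0 _ _).
- apply: le_integral_ge0 => x; rewrite ?lee_fin//; first by case: ifP.
  by move=> /sP ->.
- by move=> q; case: ifP.
move=> s' us' _; rewrite -big_mkcond/=.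
rewrite -big_filter [leRHS](bigID (fun q => q \in s'))/= -[leLHS]addr0 lerD ?sumr_ge0//.
rewrite -[X in _ <= X]big_filter le_eqVlt; apply/orP; left; apply/eqP/perm_big.
apply: uniq_perm; rewrite ?filter_uniq// => q.
by rewrite !mem_filter andbC.
Qed.

Lemma le_integral_big_cube (f : 'rV[R]_n -> R) (D : R) : measurable_fun setT f ->
  (forall x, 0 <= f x) ->
  (forall r, (\int[lebesgue_rV R n]_(x in big_cube r) (f x)%:E <= D%:E)%E) ->
  (\int[lebesgue_rV R n]_x (f x)%:E <= D%:E)%E.
Proof.
move=> mf f0 H.
have -> : [set: 'rV[R]_n] = \bigcup_r big_cube r.
  by apply/seteqP; split=> // x _; have [r rx] := in_big_cube x; exists r.
have cv := @ge0_nondecreasing_set_cvg_integral _ _ R big_cube (EFin \o f) (lebesgue_rV R n).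
have {}cv := cv _ measurable_big_cube _ _.
apply: cvge_to_le (cv _ _ _) _.
- by move=> m k mk; apply/subsetPset; exact: big_cube_le.
- by move=> r; apply/measurable_EFinP; exact: measurable_funTS.
- by move=> r x _; rewrite lee_fin.
by apply: nearW => r; exact: H.
Qed.

End boxes.

Section lattice_rellich.
Context {R : realType} {n : nat}.
Variables (eta : nat -> R) (f : nat -> 'rV[int]_n -> R) (K : R).
Variables (Omega : set 'rV[R]_n) (A : nat -> set 'rV[int]_n).
Hypotheses (n_gt0 : (0 < n)%N) (eta_gt0 : forall N, 0 < eta N).
Hypothesis eta_to0 : eta N @[N --> \oo] --> 0.
Hypothesis f_grad : forall N m, sum_le setT
  (fun l => (f N (l + delta_mx ord0 m) - f N l) ^+ 2) (K * eta N ^+ 2 / eta N ^+ n).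
Hypothesis f_L2 : forall N, sum_le (A N) (fun l => f N l ^+ 2) (K / eta N ^+ n).
Hypothesis A_near : forall x, Omega x -> exists2 r : R, 0 < r &
  \forall N \near \oo, forall l : 'rV[int]_n, (forall i, `|eta N * (l ord0 i)%:~R - x ord0 i| < r) -> A N l.

Let mu := lebesgue_rV R n.
Let U N x := f N (lattice_floor (eta N) x).

Let K_ge0 : 0 <= K.
Proof.
have := sum_le_ge0 (f_L2 (N := 0%N)).
by rewrite pmulr_lge0// invr_gt0 exprn_gt0.
Qed.

Let eta_le (e : R) : 0 < e -> \forall N \near \oo, eta N <= e.
Proof. by move=> e0; move/cvgr_le : eta_to0; exact. Qed.

(** The fine cell that contains the corner of the coarse cube [q]. Since [h] need not divide
    [delta], a block of whole fine cells starting there only nearly fills that cube. *)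
Definition block_base (h delta : R) (q : 'rV[int]_n) : 'rV[int]_n :=
  lattice_floor h (delta *: of_int q).

Definition mesh_average (delta : R) N q : R :=
  block_average (f N) (Num.truncn (delta / eta N)) (block_base (eta N) delta q).

Lemma truncn_div (delta h : R) : 0 < h -> h <= delta ->
  [/\ (0 < Num.truncn (delta / h))%N,
      (Num.truncn (delta / h))%:R * h <= delta &
      delta < ((Num.truncn (delta / h)).+1)%:R * h].
Proof.
move=> h0 hd; have d0 : 0 <= delta / h by rewrite divr_ge0// ltW// (lt_le_trans h0).
have /andP[t1 t2] := truncn_itv d0; split.
- by rewrite lt0n; apply: contraTneq t2 => ->; rewrite -leNgt ler_pdivlMr// mul1r.
- by rewrite -ler_pdivlMr.
- by rewrite -ltr_pdivrMr.
Qed.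

(** Despite the misfit of the meshes, the cell of x is between 0 and M + 1 steps beyond the base of
    its block in every direction. Integrating the block variation gives the factor K (M eta)^2, and
    M eta <= delta. *)
Lemma mesh_average_close delta N : 0 < delta -> eta N <= delta ->
  (\int[mu]_x ((mesh_average delta N (lattice_floor delta x) - U N x) ^+ 2)%:E <=
   (5 ^+ n * (2 * n%:R) ^+ 2 * K * delta ^+ 2)%:E)%E.
Proof.
move=> d0 hd; have h0 := eta_gt0 N; set h := eta N in hd h0 *.
have [M0 Mh1 Mh2] := truncn_div h0 hd; set M := Num.truncn _ in M0 Mh1 Mh2.
have H := sum_le_block_variation n_gt0 M0 (f_grad N).
apply: (@le_trans _ _ (\int[mu]_x (block_variation (f N) M (lattice_floor h x))%:E)%E).
  apply: le_integral_ge0 => x _; rewrite ?lee_fin ?sqr_ge0 ?block_variation_ge0//.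
  split=> //; apply: block_average_close => // m; rewrite /block_base !mxE.
  have := lattice_floor_close x m d0; rewrite mxE.
  set q := Num.floor (x ord0 m / delta) => /andP[q1 q2].
  have := floor_itv (x ord0 m / h); have := floor_itv (delta * q%:~R / h).
  set a := Num.floor (x ord0 m / h); set b := Num.floor _ => /andP[b1 b2] /andP[a1 a2].
  have ba : b <= a.
    by rewrite /a floor_ge_int; apply: le_trans b1 _; rewrite ler_pM2r ?invr_gt0//; lra.
  rewrite subr_ge0 ba/=.
  rewrite -/h -/M; have : a < b + 1 + M.+1%:Z.
    rewrite -(ltr_int R); apply: le_lt_trans a1 _.
    rewrite intrD; apply: (@lt_trans _ _ (delta * q%:~R / h + delta / h)).
      by rewrite -mulrDl ltr_pM2r ?invr_gt0//; lra.
    by rewrite ltrD//; exact: truncnS_gt.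
  clearbody a b M; clear; lia.
apply: le_trans (integral_lattice_le h0 _ H) _; first by move=> l; exact: block_variation_ge0.
rewrite lee_fin.
have hn : h ^+ n != 0 by rewrite expf_neq0// gt_eqF.
rewrite (_ : _ * _ = 5 ^+ n * (2 * n%:R) ^+ 2 * K * (M%:R * h) ^+ 2); last first.
  by rewrite exprMn -/h; field.
rewrite ler_wpM2l ?mulr_ge0 ?exprn_ge0 ?sqr_ge0 ?mulr_ge0//.
rewrite lerXn2r ?nnegrE ?mulr_ge0 ?(ltW d0) ?(ltW h0)//.
Qed.

(** The block attached to the coarse cube of [x0] stays within 2 delta of [x0], hence inside [A N].
    For eta <= delta / 2 the block has side M eta >= delta / 2, which explains 2 / delta. *)
Lemma mesh_average_seed (delta : R) (x0 : 'rV[R]_n) (r : R) : 0 < delta -> 0 < r -> 2 * delta <= r ->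
  (\forall N \near \oo, forall l : 'rV[int]_n, (forall i, `|eta N * (l ord0 i)%:~R - x0 ord0 i| < r) -> A N l) ->
  \forall N \near \oo,
    mesh_average delta N (lattice_floor delta x0) ^+ 2 <= K * (2 / delta) ^+ n.
Proof.
move=> d0 r0 rd HA; near=> N.
have h0 := eta_gt0 N.
have hd2 : eta N <= delta / 2 by near: N; apply: eta_le; rewrite divr_gt0.
have hd : eta N <= delta by lra.
have HAN : forall l : 'rV[int]_n, (forall i, `|eta N * (l ord0 i)%:~R - x0 ord0 i| < r) -> A N l by near: N.
have [M0 Mh1 Mh2] := truncn_div h0 hd.
set h := eta N in hd hd2 h0 HAN Mh1 Mh2 *; set M := Num.truncn _ in M0 Mh1 Mh2 *.
have Mh3 : delta / 2 <= M%:R * h by move: Mh2; rewrite -addn1 natrD mulrDl mul1r; lra.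
apply: le_trans (block_average_bound M0 _ (f_L2 (N := N))) _.
  move=> t; apply: HAN => i; rewrite /block_base !mxE/=.
  have := lattice_floor_close x0 i d0; rewrite mxE.
  set q := Num.floor (x0 ord0 i / delta) => /andP[q1 q2].
  have := floor_itv (delta * q%:~R / h); set b := Num.floor _.
  rewrite ler_pdivlMr// ltr_pdivrMr// intrD mulrDl mul1r => /andP[b1 b2].
  have ti : (t ord0 i).+1%:R * h <= M%:R * h by rewrite ler_pM2r// ler_nat.
  have t0 : 0 <= (t ord0 i)%:R * h by rewrite mulr_ge0// ltW.
  rewrite -addn1 natrD mulrDl mul1r in ti.
  by rewrite intrD mulrDr ltr_norml; lra.
rewrite -exprVn mulrCA ler_wpM2l// -exprVn -exprMn.
rewrite lerXn2r ?nnegrE ?divr_ge0 ?(ltW d0)// -?invfM ?invr_ge0 ?mulr_ge0 ?(ltW h0)//.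
rewrite -[leRHS]invrK invf_div lef_pV2 ?posrE ?divr_gt0 ?mulr_gt0 ?ltr0n//.
Unshelve. all: by end_near. Qed.

(** The bases of the two blocks are at most (Q + 1)(M + 1) fine steps apart in each direction. The
    powers of eta combine into M eta >= delta / 2 and (M + 1) eta <= 2 delta, so the bound does not
    depend on N. *)
Lemma mesh_average_shift delta q q' : 0 < delta -> exists B, \forall N \near \oo,
  (mesh_average delta N q' - mesh_average delta N q) ^+ 2 <= B.
Proof.
move=> d0; pose Q := (\sum_i `|q' ord0 i - q ord0 i|)%N.
exists ((2 / delta) ^+ n * (n%:R * Q.+1%:R * (2 * delta)) ^+ 2 * K).
near=> N.
have h0 := eta_gt0 N.
have hd2 : eta N <= delta / 2 by near: N; apply: eta_le; rewrite divr_gt0.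
have hd : eta N <= delta by lra.
have [M0 Mh1 Mh2] := truncn_div h0 hd.
set h := eta N in hd hd2 h0 Mh1 Mh2 *; set M := Num.truncn _ in M0 Mh1 Mh2 *.
have Mh3 : delta / 2 <= M%:R * h by move: Mh2; rewrite -addn1 natrD mulrDl mul1r; lra.
apply: le_trans (block_average_diff (N := (Q.+1 * M.+1)%N) M0 _ (f_grad N)) _.
  move=> m; rewrite /block_base !mxE -/h.
  have qQ : (`|q' ord0 m - q ord0 m| <= Q)%N by rewrite /Q (bigD1 m)//= leq_addr.
  have := floor_itv (delta * (q ord0 m)%:~R / h); have := floor_itv (delta * (q' ord0 m)%:~R / h).
  set a := Num.floor _; set b := Num.floor _ => /andP[a1 a2] /andP[b1 b2].
  have dd : `|delta * (q' ord0 m)%:~R / h - delta * (q ord0 m)%:~R / h| <= Q%:R * M.+1%:R.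
    rewrite -mulrBl -mulrBr -intrB !normrM normfV (gtr0_norm d0) (gtr0_norm h0).
    rewrite mulrAC mulrC ler_pM ?divr_ge0 ?(ltW d0) ?(ltW h0)//.
      by rewrite -intr_norm -abszE -pmulrn ler_nat.
    by apply/ltW; exact: truncnS_gt.
  move: dd; rewrite ler_norml => /andP[dd1 dd2].
  have c1 : a < b + 1 + (Q * M.+1)%N%:Z.
    by rewrite -(ltr_int R) intrD -pmulrn natrM; lra.
  have c2 : b < a + 1 + (Q * M.+1)%N%:Z.
    by rewrite -(ltr_int R) intrD -pmulrn natrM; lra.
  move: c1 c2; rewrite -/h -/M mulSn; move: (Q * M.+1)%N => P; clearbody a b M; clear; lia.
have hn : h ^+ n != 0 by rewrite expf_neq0// gt_eqF.
have Mn : M%:R ^+ n != 0 :> R by rewrite expf_neq0// pnatr_eq0 -lt0n.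
rewrite (_ : _ * _ = ((M%:R * h) ^+ n)^-1 * (n%:R * (Q.+1 * M.+1)%:R * h) ^+ 2 * K); last first.
  rewrite [in RHS]exprMn -/h (natrM _ n) -!exprVn invfM !exprVn; field.
  by rewrite hn Mn.
rewrite ler_wpM2r//; apply: ler_pM => //.
- by rewrite invr_ge0 exprn_ge0// mulr_ge0// ltW.
- exact: sqr_ge0.
- rewrite -exprVn lerXn2r ?nnegrE ?invr_ge0 ?mulr_ge0 ?divr_ge0 ?(ltW d0) ?(ltW h0)//.
    by rewrite invr_ge0 ltW.
  by rewrite -[leRHS]invrK invf_div lef_pV2 ?posrE ?divr_gt0 ?mulr_gt0 ?ltr0n.
rewrite lerXn2r ?nnegrE ?mulr_ge0 ?(ltW d0) ?(ltW h0)//.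
rewrite natrM !mulrA -!mulrA ler_wpM2l// ler_wpM2l// -addn1 natrD mulrDl mul1r; lra.
Unshelve. all: by end_near. Qed.

Lemma sq_integral_triangle (D : set 'rV[R]_n) (a b c : 'rV[R]_n -> R) (x y : R) :
  measurable D -> measurable_fun setT a -> measurable_fun setT b -> measurable_fun setT c ->
  (\int[mu]_(z in D) ((a z - b z) ^+ 2)%:E <= x%:E)%E ->
  (\int[mu]_(z in D) ((b z - c z) ^+ 2)%:E <= y%:E)%E ->
  (\int[mu]_(z in D) ((a z - c z) ^+ 2)%:E <= (2 * x + 2 * y)%:E)%E.
Proof.
move=> mD ma mb mc; apply: le_integral_lin2 => //.
- by move=> z _; exact: sqr_ge0.
- by move=> z _; exact: sqr_ge0.
- by move=> z _; exact: sqr_ge0.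
- by apply/measurable_funTS/measurable_funX; exact: measurable_funB.
- by apply/measurable_funTS/measurable_funX; exact: measurable_funB.
by move=> z _; have := sqr_ge0 ((a z - b z) - (b z - c z)); lra.
Qed.

Let measurable_U N : measurable_fun setT (U N).
Proof. exact: measurable_lattice_comp. Qed.

(** The cube [q] may lie outside [Omega], where no L^2 bound is given; its average is compared with
    the one at [x0]. *)
Lemma mesh_average_bounded (delta : R) (x0 : 'rV[R]_n) (r : R) q :
  0 < delta -> 0 < r -> 2 * delta <= r ->
  (\forall N \near \oo, forall l : 'rV[int]_n,
     (forall i, `|eta N * (l ord0 i)%:~R - x0 ord0 i| < r) -> A N l) ->
  exists B, \forall N \near \oo, `|mesh_average delta N q| <= B.
Proof.
move=> d0 r0 rd HA.
have H1 := mesh_average_seed d0 r0 rd HA.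
have [B H2] := mesh_average_shift (lattice_floor delta x0) q d0.
exists (1 + (2 * (K * (2 / delta) ^+ n) + 2 * B)); near=> N.
have h1 : mesh_average delta N (lattice_floor delta x0) ^+ 2 <= K * (2 / delta) ^+ n by near: N.
have h2 : (mesh_average delta N q - mesh_average delta N (lattice_floor delta x0)) ^+ 2 <= B by near: N.
move: h1 h2; set a := mesh_average _ _ q; set b := mesh_average _ _ _ => h1 h2.
apply: (@le_trans _ _ (1 + a ^+ 2)).
  by rewrite -(real_normK (num_real a)); have := sqr_ge0 (`|a| - 1); have := normr_ge0 a; nra.
by rewrite lerD2l; have := sqr_ge0 (a - b - b); nra.
Unshelve. all: by end_near. Qed.

(* Limits of the mesh averages along an ultrafilter exist for all meshes at once,
   which replaces a diagonal extraction. *)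
Lemma lattice_rellich (x0 : 'rV[R]_n) : Omega x0 ->
  exists2 s : nat -> nat, {homo s : m n / (m < n)%N} &
  exists2 v : 'rV[R]_n -> R, measurable_fun setT v &
  forall k, (\int[mu]_(x in big_cube k) ((U (s k) x - v x) ^+ 2)%:E <= (k.+1%:R^-1)%:E)%E.
Proof.
move=> /A_near[r r0 HA].
(* Starting at r / 2 keeps every mesh within the range of [mesh_average_seed]; halving produces the
   rate 4^-p that [L2_fast_cauchy] expects. *)
pose delta p : R := r / 2 * 2^-1 ^+ p.
have d0 p : 0 < delta p by rewrite mulr_gt0 ?exprn_gt0 ?invr_gt0// divr_gt0.
have dr p : 2 * delta p <= r.
  rewrite /delta mulrA mulrCA divff ?pnatr_eq0// mulr1 ger_pMr//.
  by rewrite exprn_ile1// ?invr_ge0// invf_le1 ?ler1n.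
have [F [UF FG]] := ultraFilterLemma eventually_filter.
have lim_ex (pq : nat * 'rV[int]_n) :
    exists l : R, mesh_average (delta pq.1) N pq.2 @[N --> F] --> l.
  have [B HB] := mesh_average_bounded pq.2 (d0 pq.1) r0 (dr pq.1) HA.
  by apply: (@ultra_bounded_cvg _ _ _ B) => //; exact: FG.
have [c cP] := choice lim_ex.
pose V p N x := mesh_average (delta p) N (lattice_floor (delta p) x).
pose S p x := c (p, lattice_floor (delta p) x).
have mV p N : measurable_fun setT (V p N).
  exact: (measurable_lattice_comp (mesh_average (delta p) N)).
have mS p : measurable_fun setT (S p).
  exact: (measurable_lattice_comp (fun q => c (p, q))).
have VS p k e : 0 < e -> \forall N \near F,
    (\int[mu]_(x in big_cube k) ((V p N x - S p x) ^+ 2)%:E <= e%:E)%E.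
  move=> e0; have [s [us sP]] := @big_cube_finite R n _ k (d0 p).
  have : delta p ^+ n * \sum_(q <- s) (mesh_average (delta p) N q - c (p, q)) ^+ 2 @[N --> F] -->
      delta p ^+ n * \sum_(q <- s) (c (p, q) - c (p, q)) ^+ 2.
    apply: cvgMr; apply: cvg_big => [|q _]; first exact: add_continuous.
    by apply: cvgM; apply: cvgB; [exact: (cP (p, q))|exact: cvg_cst|exact: (cP (p, q))|exact: cvg_cst].
  rewrite big1 ?mulr0; last by move=> q _; rewrite subrr expr0n.
  move=> /cvgr_le /(_ _ e0); apply: filterS => N HN.
  apply: le_trans (step_function_sq_integral
    (G := fun q => (mesh_average (delta p) N q - c (p, q)) ^+ 2) (d0 p) us _ sP) _.
    by move=> q; exact: sqr_ge0.
  by rewrite lee_fin.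
pose K1 := 5 ^+ n * (2 * n%:R) ^+ 2 * K.
have K10 : 0 <= K1 by rewrite !mulr_ge0 ?exprn_ge0.
have VU p k : \forall N \near F,
    (\int[mu]_(x in big_cube k) ((V p N x - U N x) ^+ 2)%:E <= (K1 * delta p ^+ 2)%:E)%E.
  apply: FG; apply: filterS (eta_le (d0 p)) => N HN.
  apply: le_trans (mesh_average_close (d0 p) HN).
  by apply: le_integral_ge0 => x; rewrite ?lee_fin ?sqr_ge0.
have SU p k e : 0 < e -> \forall N \near F,
    (\int[mu]_(x in big_cube k) ((S p x - U N x) ^+ 2)%:E <= (e + 2 * (K1 * delta p ^+ 2))%:E)%E.
  move=> e0; near=> N.
  rewrite (_ : e = 2 * (e / 2)); last by field.
  apply: sq_integral_triangle (measurable_big_cube k) (mS p) (mV p N) _ _ _ => //.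
    rewrite (eq_integral (fun x => ((V p N x - S p x) ^+ 2)%:E)).
      by near: N; apply: VS; rewrite divr_gt0.
    by move=> x _; rewrite -sqrrN opprB.
  by near: N; exact: VU.
have dS p : delta p.+1 ^+ 2 <= delta p ^+ 2.
  rewrite lerXn2r ?nnegrE ?(ltW (d0 _))// /delta exprS.
  have : 0 <= r / 2 * 2^-1 ^+ p by rewrite ltW// d0.
  lra.
have delta2 p : delta p ^+ 2 = (r / 2) ^+ 2 * 4^-1 ^+ p.
  rewrite /delta exprMn -[in LHS]exprM mulnC exprM; congr (_ * _ ^+ _); by field.
(* Both step functions are compared with one and the same [U N], on each box up to an arbitrary e;
   the resulting bound depends neither on the box nor on N. *)
have SS p : (\int[mu]_x ((S p.+1 x - S p x) ^+ 2)%:E <=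
    (8 * K1 * (r / 2) ^+ 2 * 4^-1 ^+ p)%:E)%E.
  apply: le_integral_big_cube => [|x|k].
  - by apply/measurable_funX; exact: measurable_funB.
  - exact: sqr_ge0.
  apply/lee_addgt0Pr => e e0.
  have e4 : 0 < e / 4 by rewrite divr_gt0.
  have [N [HN1 HN2]] := filter_ex (filterI (SU p k _ e4) (SU p.+1 k _ e4)).
  have swap : (\int[mu]_(x in big_cube k) ((U N x - S p x) ^+ 2)%:E <=
      (e / 4 + 2 * (K1 * delta p ^+ 2))%:E)%E.
    rewrite (eq_integral (fun x => ((S p x - U N x) ^+ 2)%:E)) => [//|x _].
    by rewrite -sqrrN opprB.
  apply: le_trans (sq_integral_triangle (measurable_big_cube k) (mS p.+1)
    (measurable_U N) (mS p) HN2 swap) _.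
  rewrite -EFinD lee_fin -mulrA -delta2.
  have : K1 * delta p.+1 ^+ 2 <= K1 * delta p ^+ 2 by rewrite ler_wpM2l.
  lra.
have [v mv Sv] := L2_fast_cauchy mS SS.
have Uv k m : exists N, (m < N)%N /\
    (\int[mu]_(x in big_cube k) ((U N x - v x) ^+ 2)%:E <= (k.+1%:R^-1)%:E)%E.
  pose e : R := k.+1%:R^-1.
  have e0 : 0 < e by rewrite invr_gt0.
  (* 68 = 2 * 2 + 2 * 32: the distance from [U N] to [S p], then from [S p] to [v], where 32 = 4 * 8
     comes from [L2_fast_cauchy] and [SS]. *)
  have [p Hp] : exists p, 68 * (K1 * delta p ^+ 2) <= e / 2.
    have : 68 * K1 * (r / 2) ^+ 2 * 4^-1 ^+ p @[p --> \oo] --> 68 * K1 * (r / 2) ^+ 2 * 0.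
      by apply: cvgMr; apply: cvg_expr; rewrite ger0_norm ?invr_ge0// invf_lt1// ltr1n.
    rewrite mulr0 => /cvgr_le /(_ (e / 2)); rewrite divr_gt0// => /(_ isT).
    move=> /filter_ex[p Hp]; exists p; apply: le_trans Hp; rewrite delta2.
    by rewrite le_eqVlt; apply/orP; left; apply/eqP; ring.
  have e4 : 0 < e / 4 by rewrite divr_gt0.
  (* The ultrafilter refines the eventual filter, so a good index can be taken beyond any m; this
     returns from the ultrafilter to a subsequence. *)
  have [N [HN Nm]] := filter_ex (filterI (SU p k _ e4) (FG _ (nbhs_infty_gt m))).
  exists N; split=> //.
  have swap : (\int[mu]_(x in big_cube k) ((U N x - S p x) ^+ 2)%:E <=
      (e / 4 + 2 * (K1 * delta p ^+ 2))%:E)%E.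
    rewrite (eq_integral (fun x => ((S p x - U N x) ^+ 2)%:E)) => [//|x _].
    by rewrite -sqrrN opprB.
  have Svk : (\int[mu]_(x in big_cube k) ((S p x - v x) ^+ 2)%:E <=
      (32 * (K1 * delta p ^+ 2))%:E)%E.
    apply: le_trans (le_trans _ (Sv p)) _.
      by apply: le_integral_ge0 => x; rewrite ?lee_fin ?sqr_ge0.
    by rewrite lee_fin delta2; lra.
  apply: le_trans (sq_integral_triangle (measurable_big_cube k) (measurable_U N)
    (mS p) mv swap Svk) _.
  by rewrite lee_fin -/e; lra.
have [s s1 s2] := extraction Uv.
by exists s => //; exists v.
Unshelve. all: by end_near. Qed.

End lattice_rellich.

(** * Weak derivatives of the limit *)

Lemma cvge0_le (R : realType) (u : nat -> \bar R) : u k @[k --> \oo] --> 0%E ->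
  forall t : R, 0 < t -> \forall k \near \oo, (u k <= t%:E)%E.
Proof.
move=> /fine_cvgP[ufin /cvgr_le u0] t t0.
apply: filterS2 ufin (u0 _ t0) => k uk ut.
by rewrite -(fineK uk) lee_fin.
Qed.

Section Rintegral_mul.
Context d (X : measurableType d) (R : realType) (mu : {measure set X -> \bar R}).

(** Expands a b - a0 b0 into (a - a0) b0 + a0 (b - b0) + (a - a0)(b - b0) and applies weighted Young
    to each term: [lam] is fixed by [A], [B] and e, and then [dl] by [lam]. *)
Lemma Rintegral_mul_cvg (a b : nat -> X -> R) (a0 b0 : X -> R) (A B : R) :
  (forall k, measurable_fun setT (a k)) -> (forall k, measurable_fun setT (b k)) ->
  measurable_fun setT a0 -> measurable_fun setT b0 ->
  (\int[mu]_x (a0 x ^+ 2)%:E <= A%:E)%E -> (\int[mu]_x (b0 x ^+ 2)%:E <= B%:E)%E ->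
  (forall e, 0 < e -> \forall k \near \oo, (\int[mu]_x ((a k x - a0 x) ^+ 2)%:E <= e%:E)%E) ->
  (forall e, 0 < e -> \forall k \near \oo, (\int[mu]_x ((b k x - b0 x) ^+ 2)%:E <= e%:E)%E) ->
  \int[mu]_x (a k x * b k x) @[k --> \oo] --> \int[mu]_x (a0 x * b0 x).
Proof.
move=> ma mb ma0 mb0 a0A b0B aa bb.
have A0 : 0 <= A.
  by rewrite -lee_fin; apply: le_trans a0A; apply: integral_ge0 => x _; rewrite lee_fin sqr_ge0.
have B0 : 0 <= B.
  by rewrite -lee_fin; apply: le_trans b0B; apply: integral_ge0 => x _; rewrite lee_fin sqr_ge0.
apply/cvgrPdistC_le => e e0.
pose lam : R := 4 * (A + B + 1) / e.
have l0 : 0 < lam by rewrite divr_gt0// mulr_gt0// ltr_wpDl// addr_ge0.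
have le4 : lam^-1 * A + lam^-1 * B <= e / 4.
  rewrite -mulrDr /lam invf_div mulrAC ler_pdivrMr ?mulr_gt0 ?ltr_wpDl ?addr_ge0//; nra.
pose dl : R := e / 8 / (1 + lam).
have dl0 : 0 < dl by rewrite !divr_gt0// ltr_wpDl// ltW.
have dle : dl + lam * dl <= e / 8.
  by rewrite -{1}[dl]mul1r -mulrDl mulrC divfK// gt_eqF// ltr_wpDl// ltW.
have ldl0 : 0 < lam * dl by rewrite mulr_gt0.
near=> k.
have HA : (\int[mu]_x ((a k x - a0 x) ^+ 2)%:E <= dl%:E)%E by near: k; exact: aa.
have HB : (\int[mu]_x ((b k x - b0 x) ^+ 2)%:E <= dl%:E)%E by near: k; exact: bb.
have mA : measurable_fun setT (fun x => a k x - a0 x) by exact: measurable_funB.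
have mB : measurable_fun setT (fun x => b k x - b0 x) by exact: measurable_funB.
have I0 := integrable_mul ma0 mb0 a0A b0B.
have I1 := integrable_mul mA mb0 HA b0B.
have I2 := integrable_mul ma0 mB a0A HB.
have I3 := integrable_mul mA mB HA HB.
rewrite (_ : \int[mu]_x (a k x * b k x) = (\int[mu]_x (a0 x * b0 x)) +
  ((\int[mu]_x ((a k x - a0 x) * b0 x)) + ((\int[mu]_x (a0 x * (b k x - b0 x))) +
   (\int[mu]_x ((a k x - a0 x) * (b k x - b0 x)))))); last first.
  have I23 := integrableD measurableT I2 I3.
  have I123 := integrableD measurableT I1 I23.
  rewrite -RintegralD// -RintegralD//.
  rewrite -RintegralD//; apply: eq_Rintegral => x _; ring.
rewrite addrAC subrr add0r.
apply: le_trans (ler_normD _ _) _; rewrite -lerBrDl.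
apply: le_trans (ler_normD _ _) _; rewrite lerBrDl.
have h1 := norm_Rintegral_mul_le l0 mA mb0 HA b0B.
have l0' : 0 < lam^-1 by rewrite invr_gt0.
have h2 := norm_Rintegral_mul_le l0' ma0 mB a0A HB.
have h3 := norm_Rintegral_mul_le ltr01 mA mB HA HB.
rewrite invrK in h2; rewrite invr1 !mul1r in h3.
lra.
Unshelve. all: by end_near. Qed.

End Rintegral_mul.

Section test_functions.
Context {R : realType} {n : nat}.
Implicit Types (phi : 'rV[R]_n -> R) (Omega : set 'rV[R]_n).
Local Notation e m := (delta_mx ord0 m : 'rV[R]_n).

Lemma coord_lt_norm (x : 'rV[R]_n) (M : R) i : `|x| < M -> `|x ord0 i| < M.
Proof.
move=> xM; have : ball (0 : 'rV[R]_n) M x by rewrite -ball_normE /ball_/= sub0r normrN.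
by move=> /rV_ballE[_ /(_ i)]; rewrite mxE sub0r normrN.
Qed.

Lemma compact_big_cube (C : set 'rV[R]_n) : compact C -> exists r, C `<=` big_cube r.
Proof.
move=> /compact_bounded[M [_ HM]].
exists (Num.truncn (`|M| + 2)).+1 => x Cx; apply/big_cubeP => i.
have xM : `|x| <= `|M| + 1 by apply: HM => //; rewrite ltr_pwDr// ler_norm.
have xi : `|x ord0 i| < `|M| + 2 by apply: coord_lt_norm; lra.
have := truncnS_gt (`|M| + 2); move: xi; rewrite ltr_norml => /andP[h1 h2] h3.
by apply/andP; split; lra.
Qed.

Lemma test_function_continuous Omega phi : test_function Omega phi ->
  continuous (phi : _ -> R^o).
Proof. by case=> /(_ 0%N)[]. Qed.

Lemma test_function_measurable Omega phi : test_function Omega phi ->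
  measurable_fun setT phi.
Proof. by move=> /test_function_continuous; exact: continuous_measurable_rV. Qed.

Lemma partial_deriv_continuous Omega phi m : test_function Omega phi ->
  continuous (partial_deriv m phi : _ -> R^o).
Proof. by case=> /(_ 1%N)[_ /(_ m)[_ []]]. Qed.

Lemma partial_deriv_measurable Omega phi m : test_function Omega phi ->
  measurable_fun setT (partial_deriv m phi).
Proof.
move=> tphi; apply: continuous_measurable_rV; exact: partial_deriv_continuous tphi.
Qed.

(** The quotient is backward because discrete integration by parts moves the forward quotient of the
    lattice function onto [phi] in this form. *)
Lemma partial_deriv_quotient_cvg Omega phi m (h : nat -> R) x :
  test_function Omega phi -> (forall k, 0 < h k) -> h k @[k --> \oo] --> 0 ->
  (phi x - phi (x - h k *: e m)) / h k @[k --> \oo] --> partial_deriv m phi x.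
Proof.
move=> [/(_ 1%N)[_ /(_ m)[dphi _]] _ _] h0 hto0.
have := dphi x; rewrite /derivable => dx.
have hN : - h k @[k --> \oo] --> 0^'.
  move=> B HB; have {}HB : nbhs (0 : R) (fun y => y != 0 -> B y) by [].
  have : - h k @[k --> \oo] --> (0 : R) by rewrite -oppr0; exact: cvgN.
  move=> /(_ _ HB) H; have {}H : \forall k \near \oo, - h k != 0 -> B (- h k) by exact: H.
  by near_simpl; apply: filterS H => k; apply; rewrite oppr_eq0 gt_eqF.
have := cvg_comp _ _ hN dx.
rewrite /partial_deriv /derive; apply: cvg_trans; apply: near_eq_cvg; apply: nearW => k.
rewrite /= scaleNr [- _ + x]addrC -[LHS]/((- h k)^-1 * (phi (x - h k *: e m) - phi x)).
by rewrite invrN mulNr -mulrN opprB mulrC.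
Qed.

Lemma derivable_is_derive_line phi m x t : (forall y, derivable phi y (e m)) ->
  is_derive t (1 : R) (fun s : R => phi (x + s *: e m)) (partial_deriv m phi (x + t *: e m)).
Proof.
move=> dphi.
have E : (fun h : R => h^-1 *: (((fun s : R => phi (x + s *: e m)) \o shift t) (h *: 1) -
      phi (x + t *: e m))) =
    (fun h : R => h^-1 *: ((phi \o shift (x + t *: e m)) (h *: e m) - phi (x + t *: e m))).
  by apply/funext => h /=; rewrite [h *: 1]mulr1 scalerDl [in LHS]addrCA.
by split; rewrite /derivable /derive E//; exact: dphi.
Qed.

(** Mean value theorem along the segment; it supplies the dominating function for the difference
    quotients. *)
Lemma quotient_bound phi m b : (forall y, derivable phi y (e m)) ->
  (forall y, `|partial_deriv m phi y| <= b) ->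
  forall x h, 0 < h -> `|(phi x - phi (x - h *: e m)) / h| <= b.
Proof.
move=> dphi pb x h h0.
have dl t := derivable_is_derive_line (x - h *: e m) t dphi.
pose g (s : R) := phi (x - h *: e m + s *: e m).
have cg : {within `[0, h], continuous g}.
  by apply: derivable_within_continuous => t _; have [] := dl t.
have [c _ ] := MVT h0 (fun t _ => dl t) cg.
by rewrite /g scale0r addr0 subrK subr0 => ->; rewrite mulfK ?gt_eqF.
Qed.

Lemma test_function_support Omega phi : test_function Omega phi ->
  exists r, forall x, phi x != 0 -> big_cube r x.
Proof.
move=> [_ cS _]; have [r Hr] := compact_big_cube cS.
by exists r => x px; apply: Hr; exact: subset_closure.
Qed.

Lemma partial_deriv_off_support Omega phi m x : test_function Omega phi ->
  ~ closure [set x | phi x != 0] x -> partial_deriv m phi x = 0.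
Proof.
move=> tphi nS.
have E : \near x, phi x = (cst 0 : _ -> R^o) x.
  have : nbhs x (~` closure [set x | phi x != 0]).
    by apply: open_nbhs_nbhs; split=> //; exact/closed_openC/closed_closure.
  apply: filterS => y ny /=; apply/eqP; apply: contrapT => /negP py.
  by apply: ny; exact: subset_closure.
rewrite /partial_deriv (near_eq_derive _ E).
exact: derive_cst.
Qed.

Lemma test_function_bounded Omega phi : test_function Omega phi ->
  exists b, forall x, `|phi x| <= b.
Proof.
move=> tphi; have [_ cS _] := tphi.
have /compact_bounded[M [_ HM]] : compact ((phi : _ -> R^o) @` closure [set x | phi x != 0]).
  apply: continuous_compact => //; apply: continuous_subspaceT.
  exact: test_function_continuous tphi.
exists (`|M| + 1) => x.
have [->|nSx] := eqVneq (phi x) 0; first by rewrite normr0 addr_ge0.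
by apply: HM; [rewrite ltr_pwDr// ler_norm|exists x => //; exact: subset_closure].
Qed.

Lemma sq_integral_bounded r (g : 'rV[R]_n -> R) (c : R) :
  (forall x, big_cube r x -> `|g x| <= c) -> (forall x, ~ big_cube r x -> g x = 0) ->
  (\int[lebesgue_rV R n]_x (g x ^+ 2)%:E <= (c ^+ 2 * (r%:R + r%:R) ^+ n)%:E)%E.
Proof.
move=> gc g0; have mB := @measurable_big_cube R n r.
rewrite (_ : (_ * _)%:E = \int[lebesgue_rV R n]_(x in big_cube r) (cst (c ^+ 2)%:E) x)%E; last first.
  rewrite integral_cst// [LHS]EFinM; congr (_ * _)%E.
  by apply/esym/lebesgue_cube; exact: addr_ge0.
rewrite [leRHS]integral_mkcond; apply: le_integral_ge0 => x _; rewrite ?patchE ?lee_fin ?sqr_ge0//.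
  by case: ifP => // _; rewrite lee_fin sqr_ge0.
split=> //; case: ifPn => [/set_mem Bx|/negP nB].
  rewrite lee_fin -(real_normK (num_real (g x))) lerXn2r ?nnegrE ?gc//.
  by apply: le_trans (gc _ Bx).
by rewrite g0 ?expr0n// => Bx; apply: nB; rewrite inE.
Qed.

Lemma partial_deriv_bounded Omega phi m : test_function Omega phi ->
  exists b, forall x, `|partial_deriv m phi x| <= b.
Proof.
move=> tphi; have [_ cS _] := tphi.
have /compact_bounded[M [_ HM]] : compact ((partial_deriv m phi : _ -> R^o) @` closure [set x | phi x != 0]).
  apply: continuous_compact => //; apply: continuous_subspaceT.
  exact: partial_deriv_continuous tphi.
exists (`|M| + 1) => x.
have [Sx|nSx] := pselect (closure [set x | phi x != 0] x).
  by apply: HM; [rewrite ltr_pwDr// ler_norm|exists x].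
by rewrite (partial_deriv_off_support m tphi nSx) normr0 addr_ge0.
Qed.

End test_functions.

Section lattice_limit.
Context {R : realType} {n : nat}.
Variables (eta : nat -> R) (f : nat -> 'rV[int]_n -> R) (K : R).
Variables (Omega : set 'rV[R]_n) (A : nat -> set 'rV[int]_n) (v : 'rV[R]_n -> R).
Hypotheses (eta_gt0 : forall k, 0 < eta k) (eta_to0 : eta k @[k --> \oo] --> 0).
Hypothesis f_grad : forall k m, sum_le setT
  (fun l => (f k (l + delta_mx ord0 m) - f k l) ^+ 2) (K * eta k ^+ 2 / eta k ^+ n).
Hypothesis f_L2 : forall k, sum_le (A k) (fun l => f k l ^+ 2) (K / eta k ^+ n).
Hypothesis A_near : forall x, Omega x ->
  \forall k \near \oo, A k (lattice_floor (eta k) x).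
Hypothesis v_meas : measurable_fun setT v.

Let mu := lebesgue_rV R n.
Let U k x := f k (lattice_floor (eta k) x).

Hypothesis U_cvg : forall k,
  (\int[mu]_(x in big_cube k) ((U k x - v x) ^+ 2)%:E <= (k.+1%:R^-1)%:E)%E.

Let U_meas k : measurable_fun setT (U k).
Proof. exact: measurable_lattice_comp. Qed.

(** On [D k] the splitting v^2 <= 2 U^2 + 2 (U - v)^2 costs 2 K + 2, because the rate is at most 1.
    Every point of [Omega] eventually belongs to [D k], so Fatou's lemma removes the truncation. *)
Lemma lattice_limit_L2 : open Omega ->
  (\int[mu]_(x in Omega) (v x ^+ 2)%:E <= (2 * K + 2 * 1)%:E)%E.
Proof.
move=> oO; have mO := open_measurable_rV oO.
pose D k := Omega `&` (big_cube k `&` (lattice_floor (eta k) @^-1` (A k))).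
have mD k : measurable (D k).
  apply: measurableI => //; apply: measurableI; first exact: measurable_big_cube.
  exact: measurable_lattice_preimage.
pose g k x := v x ^+ 2 * \1_(D k) x.
have g0 k x : 0 <= g k x by rewrite mulr_ge0 ?sqr_ge0.
have mg k : measurable_fun setT (g k).
  by apply: measurable_funM; [exact: measurable_funX|exact: measurable_indic].
have Ig k : (\int[mu]_(x in Omega) (g k x)%:E <= (2 * K + 2 * 1)%:E)%E.
  apply: (@le_trans _ _ (\int[mu]_(x in D k) (v x ^+ 2)%:E)%E).
    rewrite [leLHS]integral_mkcond [leRHS]integral_mkcond.
    apply: le_integral_ge0 => x _; rewrite !patchE.
    - by case: ifP => // _; rewrite lee_fin.
    - by case: ifP => // _; rewrite lee_fin sqr_ge0.
    split=> //; rewrite /g indicE; case: (boolP (x \in D k)) => [xD|xD].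
      by rewrite mulr1; case: ifP => // _; rewrite lee_fin sqr_ge0.
    by rewrite mulr0; case: ifP.
  have UK : (\int[mu]_(x in D k) (U k x ^+ 2)%:E <= K%:E)%E.
    have hn : eta k ^+ n != 0 by rewrite expf_neq0// gt_eqF.
    pose G l := if l \in A k then f k l ^+ 2 else 0.
    have G0 l : 0 <= G l by rewrite /G; case: ifP => // _; exact: sqr_ge0.
    apply: (@le_trans _ _ (\int[mu]_x (G (lattice_floor (eta k) x))%:E)%E).
      apply: le_integral_ge0 => x; rewrite ?lee_fin ?sqr_ge0//.
      by move=> [_ [_ Ax]]; rewrite /G mem_set.
    rewrite (_ : K = eta k ^+ n * (K / eta k ^+ n)); last by field.
    apply: integral_lattice_le => // s us _; rewrite /G -big_mkcond/= -big_filter.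
    apply: f_L2; first by rewrite filter_uniq.
    by move=> l; rewrite mem_filter => /andP[/set_mem].
  have Uv : (\int[mu]_(x in D k) ((U k x - v x) ^+ 2)%:E <= 1%:E)%E.
    apply: (@le_trans _ _ (k.+1%:R^-1)%:E); last by rewrite lee_fin invf_le1 ?ler1n.
    apply: le_trans (U_cvg k).
    by apply: le_integral_ge0 => x; rewrite ?lee_fin ?sqr_ge0// => -[_ []].
  apply: (le_integral_lin2 (G := fun x => U k x ^+ 2) (H := fun x => (U k x - v x) ^+ 2)) => //.
  - by move=> x _; exact: sqr_ge0.
  - by move=> x _; exact: sqr_ge0.
  - by move=> x _; exact: sqr_ge0.
  - by apply/measurable_funTS; exact: measurable_funX.
  - by apply/measurable_funTS/measurable_funX; exact: measurable_funB.
  by move=> x _; have := sqr_ge0 (2 * U k x - v x); lra.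
have := @fatou _ _ R mu Omega mO (fun k x => (g k x)%:E) _ _.
move=> /(_ (fun k => (measurable_EFinP _ _).2 (measurable_funTS (mg k)))).
move=> /(_ (fun k x _ => g0 k x)) F.
apply: le_trans (le_trans F _).
  rewrite le_eqVlt; apply/orP; left; apply/eqP; apply: eq_integral => x /set_mem Ox.
  have [r xr] := in_big_cube x.
  suff cg : (g k x)%:E @[k --> \oo] --> (v x ^+ 2)%:E.
    rewrite is_cvg_limn_einfE ?(cvg_lim _ cg)//; by apply/cvg_ex; exists (v x ^+ 2)%:E.
  apply: cvg_near_cst; near=> k; rewrite /g indicE mem_set ?mulr1//; split=> //; split.
    by apply: big_cube_le xr; near: k; exact: nbhs_infty_ge.
  by near: k; exact: A_near.
rewrite limn_einf_lim; apply: lime_le; first exact: is_cvg_einfs.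
apply: nearW => k; apply: le_trans (Ig k).
by apply: ereal_inf_lbound; exists k => /=.
Unshelve. all: by end_near. Qed.

(** A bound that may depend on [r], obtained from the single function [U r], which takes finitely
    many values on the box. It serves only to make products with test functions integrable. *)
Lemma lattice_limit_locally_L2 r : exists c,
  (\int[mu]_(x in big_cube r) (v x ^+ 2)%:E <= c%:E)%E.
Proof.
have [b Ub] := step_function_bounded (f r) r (eta_gt0 r).
have mB := @measurable_big_cube R n r.
exists (2 * (b ^+ 2 * (r%:R + r%:R) ^+ n) + 2 * r.+1%:R^-1).
have UK : (\int[mu]_(x in big_cube r) (U r x ^+ 2)%:E <= (b ^+ 2 * (r%:R + r%:R) ^+ n)%:E)%E.
  have H := @sq_integral_bounded R n r (fun x => U r x * \1_(big_cube r) x) b _ _.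
  apply: le_trans (H _ _) => [|x Bx|x nB].
  - apply: le_integral_ge0 => x; rewrite ?lee_fin ?sqr_ge0// => Bx; split=> //.
    by rewrite indicE mem_set// mulr1.
  - by rewrite indicE mem_set// mulr1 Ub.
  - by rewrite indicE memNset// mulr0.
apply: (le_integral_lin2 (G := fun x => U r x ^+ 2) (H := fun x => (U r x - v x) ^+ 2)) => //.
- by move=> x _; exact: sqr_ge0.
- by move=> x _; exact: sqr_ge0.
- by move=> x _; exact: sqr_ge0.
- by apply/measurable_funTS; exact: measurable_funX.
- by apply/measurable_funTS/measurable_funX; exact: measurable_funB.
by move=> x _; have := sqr_ge0 (2 * U r x - v x); lra.
Qed.

Lemma lattice_floor_shift (h : R) (x : 'rV[R]_n) m : 0 < h ->
  lattice_floor h (x + h *: delta_mx ord0 m) = lattice_floor h x + delta_mx ord0 m.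
Proof.
move=> h0; apply/lattice_floorP => // i.
have := lattice_floor_close x i h0; rewrite !mxE; set z := Num.floor _.
by rewrite intrD mulrDr eqxx/=; case: (i == m) => /andP[z1 z2]/=; rewrite ?mulr1z ?mulr0z; lra.
Qed.

(** The forward quotients [H k] are bounded in L^2 of the whole space. Their pairings with [phi]
    converge by discrete integration by parts, and this convergence identifies the pairing of
    [G]. *)
Lemma lattice_limit_weak_partial m : exists (G : 'rV[R]_n -> R) (D : R), [/\ measurable_fun setT G,
  (\int[mu]_x (G x ^+ 2)%:E <= D%:E)%E & weak_partial Omega m v G].
Proof.
pose e : 'rV[R]_n := delta_mx ord0 m.
pose H k x := (f k (lattice_floor (eta k) x + delta_mx ord0 m) -
               f k (lattice_floor (eta k) x)) / eta k.
have mH k : measurable_fun setT (H k).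
  exact: (measurable_lattice_comp (fun l => (f k (l + delta_mx ord0 m) - f k l) / eta k)).
have HK k : (\int[mu]_x (H k x ^+ 2)%:E <= K%:E)%E.
  have hn : eta k ^+ n != 0 by rewrite expf_neq0// gt_eqF.
  have h0 : eta k != 0 by rewrite gt_eqF.
  rewrite (_ : K = eta k ^+ n * ((eta k ^+ 2)^-1 * (K * eta k ^+ 2 / eta k ^+ n))); last by field; rewrite hn h0.
  apply: (integral_lattice_le (g := fun l => ((f k (l + delta_mx ord0 m) - f k l) / eta k) ^+ 2)) => //.
    by move=> l; exact: sqr_ge0.
  apply: sum_le_mono (sum_leZ _ (f_grad k m)) => // [l _|]; last by rewrite invr_ge0 sqr_ge0.
  by rewrite exprMn mulrC exprVn.
have [G [D [mG GD GP]]] := L2_weak_compactness mH HK.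
exists G, D; split=> // phi tphi.
have mphi := test_function_measurable tphi.
have mdphi := partial_deriv_measurable m tphi.
have dphi : forall y, derivable phi y (delta_mx ord0 m).
  by move=> y; have [/(_ 1%N)[_ /(_ m)[]]] := tphi.
have [b bP] := partial_deriv_bounded m tphi.
have [r0 r0P] := test_function_support tphi.
(* One unit of margin: for eta <= 1 the support of [phi] and its translate by eta both stay in
   [big_cube r]. *)
pose r := r0.+1.
have mB := @measurable_big_cube R n r.
have rE : r%:R = r0%:R + 1 :> R by rewrite /r -addn1 natrD.
have phiB x : ~ big_cube r x -> phi x = 0.
  move=> nB; apply/eqP; apply: contrapT => /negP /r0P px; apply: nB.
  exact: big_cube_le px.
pose psi k x := (phi x - phi (x - eta k *: e)) / eta k.
have mshift k : measurable_fun setT (fun x : 'rV[R]_n => phi (x - eta k *: e)).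
  exact: (measurableT_comp mphi (measurable_shift_rV (- (eta k *: e)))).
have mpsi k : measurable_fun setT (psi k).
  by apply: measurable_funM => //; exact: measurable_funB.
have psib k x : `|psi k x| <= b by exact: quotient_bound.
have psiB k x : eta k <= 1 -> ~ big_cube r x -> psi k x = 0.
  move=> h1 nB; rewrite /psi phiB//.
  rewrite (_ : phi _ = 0) ?subrr ?mul0r//; apply/eqP; apply: contrapT => /negP /r0P.
  move=> /big_cubeP Hy; apply: nB; apply/big_cubeP => i; have := Hy i; rewrite !mxE rE eqxx/=.
  by have := eta_gt0 k; case: (i == m); rewrite ?mulr1 ?mulr0; lra.
have eta1 : \forall k \near \oo, eta k <= 1.
  by move/cvgr_le : eta_to0; apply; exact: ltr01.
have psi_cvg x : psi k x @[k --> \oo] --> partial_deriv m phi x.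
  exact: partial_deriv_quotient_cvg tphi _ _.
have dphiB x : ~ big_cube r x -> partial_deriv m phi x = 0.
  move=> nB; have p0 : psi k x @[k --> \oo] --> (0 : R).
    by apply: cvg_near_cst; apply: filterS eta1 => k ek; rewrite psiB.
  by rewrite -(cvg_lim _ (psi_cvg x))// (cvg_lim _ p0).
(* [U k] and [v] are only known to be square integrable on boxes; truncation makes the global
   product lemmas applicable. *)
pose cut (g : 'rV[R]_n -> R) x : R := g x * \1_(big_cube r) x.
have mcut g : measurable_fun setT g -> measurable_fun setT (cut g).
  by move=> mg; apply: measurable_funM => //; exact: measurable_indic.
have cutE g x : big_cube r x -> cut g x = g x by move=> Bx; rewrite /cut indicE mem_set ?mulr1.
have cut0 g x : ~ big_cube r x -> cut g x = 0 by move=> Bx; rewrite /cut indicE memNset ?mulr0.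
have cut_sq g (c : R) : (\int[mu]_(x in big_cube r) (g x ^+ 2)%:E <= c%:E)%E ->
    (\int[mu]_x (cut g x ^+ 2)%:E <= c%:E)%E.
  apply: le_trans; rewrite [leRHS]integral_mkcond.
  apply: le_integral_ge0 => x _; rewrite ?patchE ?lee_fin ?sqr_ge0//.
    by case: ifP => // _; rewrite lee_fin sqr_ge0.
  split=> //; case: ifPn => [/set_mem Bx|/negP nB]; first by rewrite cutE.
  by rewrite cut0 ?expr0n// => Bx; apply: nB; rewrite inE.
have [c cP] := lattice_limit_locally_L2 r.
have [b' b'P] := test_function_bounded tphi.
have phiL2 := sq_integral_bounded (fun x _ => b'P x) phiB.
have dphiL2 := sq_integral_bounded (fun x _ => bP x) dphiB.
(* Discrete integration by parts, by translation invariance of the integral of [F]. Wherever [phi]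
   is nonzero, both x and x + eta e_m lie in the box, so the truncation changes nothing. *)
have key k : eta k <= 1 ->
    \int[mu]_x (H k x * phi x) = - (\int[mu]_x (cut (U k) x * psi k x)).
  move=> h1; have h0 := eta_gt0 k.
  have [bU bUP] := step_function_bounded (f k) r h0.
  have UL2 : (\int[mu]_x (cut (U k) x ^+ 2)%:E <= (bU ^+ 2 * (r%:R + r%:R) ^+ n)%:E)%E.
    by apply: sq_integral_bounded => x Bx; [rewrite cutE//; exact: bUP|exact: cut0].
  have shL2 : (\int[mu]_x (phi (x - eta k *: e) ^+ 2)%:E <= (b' ^+ 2 * (r%:R + r%:R) ^+ n)%:E)%E.
    have := ge0_integral_shift (- (eta k *: e)) (measurable_funX 2 mphi) (fun x => sqr_ge0 (phi x)).
    by move=> ->.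
  pose F y := cut (U k) y * phi (y - eta k *: e).
  have IF := integrable_mul (mcut _ (U_meas k)) (mshift k) UL2 shL2.
  have IU := integrable_mul (mcut _ (U_meas k)) mphi UL2 phiL2.
  have IFs := integrable_shift (eta k *: e) IF.
  have E x : H k x * phi x = (eta k)^-1 * (F (x + eta k *: e) - cut (U k) x * phi x).
    rewrite /F addrK; have [->|px] := eqVneq (phi x) 0; first by rewrite !mulr0 subrr mulr0.
    have /big_cubeP Bx := r0P _ px.
    rewrite !cutE.
    - rewrite /U /e lattice_floor_shift// /H; ring.
    - by apply/big_cubeP => i; have := Bx i; rewrite rE; lra.
    - apply/big_cubeP => i; have := Bx i; rewrite !mxE rE eqxx/=.
      by case: (i == m); rewrite ?mulr1 ?mulr0; lra.
  under eq_Rintegral do rewrite E.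
  rewrite RintegralZl//; last exact: (integrableB measurableT IFs IU).
  rewrite RintegralB//; rewrite (Rintegral_shift (eta k *: e) IF) -RintegralB//.
  rewrite -RintegralZl//; last exact: (integrableB measurableT IF IU).
  rewrite -mulN1r -RintegralZl//; last first.
    apply: integrable_mul (mcut _ (U_meas k)) (mpsi k) UL2
      (sq_integral_bounded (fun x _ => psib k x) (fun x => psiB k x h1)).
  by apply: eq_Rintegral => x _; rewrite /F /psi; ring.
have lim1 : \int[mu]_x (cut (U k) x * psi k x) @[k --> \oo] -->
    \int[mu]_x (cut v x * partial_deriv m phi x).
  apply: (Rintegral_mul_cvg _ mpsi _ mdphi (cut_sq _ _ cP) dphiL2).
  - by move=> k; exact: mcut.
  - exact: mcut.
  - move=> t t0; near=> k.
    rewrite (eq_integral (fun x => (cut (fun y => U k y - v y) x ^+ 2)%:E)); last first.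
      by move=> x _; rewrite /cut mulrBl.
    apply: cut_sq; apply: (@le_trans _ _ (k.+1%:R^-1)%:E).
      apply: le_trans (U_cvg k); apply: le_integral_ge0 => x; rewrite ?lee_fin ?sqr_ge0//.
      move=> Bx; split=> //; apply: big_cube_le Bx.
      by near: k; exact: nbhs_infty_ge.
    rewrite lee_fin; near: k; apply: filterS (near_infty_natSinv_lt (PosNum t0)) => k /=.
    exact: ltW.
  move=> t t0.
  (* Pointwise convergence and the bound 2 b on the box upgrade to strong L^2 convergence of the
     quotients of [phi]. *)
  have dct : (\int[mu]_x (((psi k x - partial_deriv m phi x) ^+ 2 * \1_(big_cube r) x)%:E) @[k --> \oo] --> 0)%E.
    pose F k x := ((psi k x - partial_deriv m phi x) ^+ 2 * \1_(big_cube r) x)%:E.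
    pose g (x : 'rV[R]_n) : \bar R := ((2 * b * \1_(@big_cube R n r) x) ^+ 2)%:E.
    have mF k : measurable_fun setT (F k).
      apply/measurable_EFinP; apply: measurable_funM; last exact: measurable_indic.
      by apply: measurable_funX; exact: measurable_funB.
    have ig : mu.-integrable setT g.
      apply: (integrable_sqr (A := (2 * b) ^+ 2 * (r%:R + r%:R) ^+ n)).
        by apply: measurable_funM => //; exact: measurable_indic.
      apply: sq_integral_bounded => x Bx; rewrite indicE.
        by rewrite mem_set// mulr1 ger0_norm// mulr_ge0//; apply: le_trans (bP x).
      by rewrite memNset// mulr0.
    have Fcvg : {ae mu, forall x, setT x -> F k x @[k --> \oo] --> cst 0%E x}.
      apply: aeW => x _; apply: cvg_EFin; first exact: nearW.
      rewrite -[X in _ --> X](mul0r (\1_(big_cube r) x : R)); apply: cvgMl.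
      rewrite -[X in _ --> X](expr0n R 2) -(subrr (partial_deriv m phi x)).
      by apply: cvgM; apply: cvgB; [exact: psi_cvg|exact: cvg_cst|exact: psi_cvg|exact: cvg_cst].
    have Fg : {ae mu, forall x k, setT x -> (`|F k x| <= g x)%E}.
      apply: aeW => x k _; rewrite /F /g /= lee_fin indicE.
      case: (x \in _); last by rewrite !mulr0 normr0 expr0n.
      rewrite !mulr1 ger0_norm ?sqr_ge0//.
      rewrite -(real_normK (num_real (psi k x - _))).
      have b0 : 0 <= b by apply: le_trans (bP x).
      rewrite lerXn2r ?nnegrE ?mulr_ge0//; apply: le_trans (ler_normB _ _) _.
      by have := psib k x; have := bP x; lra.
    have := dominated_convergence measurableT mF (measurable_cst _) Fcvg ig Fg.
    by case=> _ _; rewrite integral0.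
  near=> k.
  rewrite (eq_integral (fun x => ((psi k x - partial_deriv m phi x) ^+ 2 * \1_(big_cube r) x)%:E)).
    by near: k; exact: cvge0_le dct _ t0.
  move=> x _; rewrite indicE; have [Bx|nB] := pselect (big_cube r x).
    by rewrite mem_set// mulr1.
  rewrite memNset// mulr0 dphiB// psiB ?subrr ?expr0n//.
  by near: k.
have lim2 : \int[mu]_x (H k x * phi x) @[k --> \oo] -->
    - (\int[mu]_x (cut v x * partial_deriv m phi x)).
  apply: cvg_trans (cvgN lim1); apply: near_eq_cvg.
  by apply: filterS eta1 => k h1; rewrite key.
have GE := GP _ _ _ mphi phiL2 lim2.
have IG := integrable_mul mG mphi GD phiL2.
have Iv := integrable_mul (mcut _ v_meas) mdphi (cut_sq _ _ cP) dphiL2.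
have [_ _ suppO] := tphi.
have offO x : ~ Omega x -> phi x = 0 /\ partial_deriv m phi x = 0.
  move=> nO; have nS : ~ closure [set x | phi x != 0] x by move=> /suppO.
  split; last exact: partial_deriv_off_support tphi nS.
  by apply/eqP; apply: contrapT => /negP px; apply: nS; exact: subset_closure.
transitivity (\int[mu]_x (cut v x * partial_deriv m phi x)%:E)%E.
  rewrite integral_mkcond; apply: eq_integral => x _; rewrite patchE.
  case: ifPn => [_|/negP nO].
    have [Bx|nB] := pselect (big_cube r x); first by rewrite cutE.
    by rewrite dphiB// !mulr0.
  by rewrite (offO x _).2 ?mulr0// => Ox; apply: nO; rewrite inE.
transitivity (- \int[mu]_x (G x * phi x)%:E)%E.
  rewrite -[LHS]fineK; last exact: integrable_fin_num Iv.
  rewrite -[X in (- X)%E]fineK; last exact: integrable_fin_num IG.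
  by rewrite -EFinN; congr (_%:E); rewrite -[X in - X]/(\int[mu]_x (G x * phi x)) GE opprK.
congr (- _)%E; rewrite [RHS]integral_mkcond; apply: eq_integral => x _; rewrite patchE.
case: ifPn => // /negP nO.
by rewrite (offO x _).1 ?mulr0// => Ox; apply: nO; rewrite inE.
Unshelve. all: by end_near. Qed.

End lattice_limit.

(** * The energy on periodicity cells *)

Section lattice_induction.
Context {d : nat}.

(** The unit vectors and their opposites generate the lattice; this extends periodicity from one
    step to every period. *)
Lemma lattice_ind (P : 'rV[int]_d -> Prop) : P 0 ->
  (forall l l', P l -> P l' -> P (l + l')) ->
  (forall m, P (delta_mx ord0 m)) -> (forall m, P (- delta_mx ord0 m)) -> forall l, P l.
Proof.
move=> P0 PD Pe PN l; rewrite [l]row_sum_delta.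
apply: (big_ind P) => // m _.
have Pn (u : 'rV[int]_d) (j : nat) : P u -> P (u *+ j).
  by move=> Pu; elim: j => [|j IH]; rewrite ?mulr0n// mulrS; exact: PD.
case: (l ord0 m) => j; first by rewrite -[Posz j]natz scaler_nat; exact: Pn.
rewrite NegzE scaleNr -[Posz _]natz scaler_nat -mulNrn; exact: Pn.
Qed.

End lattice_induction.

Lemma esum_ge_seq (R : realType) (I : choiceType) (A : set I) (g : I -> \bar R) (s : seq I) :
  uniq s -> (forall i, i \in s -> A i) -> (\sum_(i <- s) g i <= \esum_(i in A) g i)%E.
Proof.
move=> us sA; apply: esum_ge; exists [set` s]; last by rewrite -fsbig_seq.
by split=> //; exact: finite_seq.
Qed.

Lemma ler_int_slab (R : numDomainType) (T : nat) (x y : int) :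
  (T%:R * y%:~R <= x%:~R :> R) && (x%:~R < T%:R * y%:~R + T%:R :> R) =
  (0 <= x - T%:Z * y < T%:Z).
Proof.
have -> : (T%:R : R) = T%:Z%:~R by rewrite -pmulrn.
by rewrite -intrM -intrD ler_int ltr_int subr_ge0 ltrBlDl.
Qed.

Section periodic_graph.
Context {R : realType} {d k : nat}.
Variables (T : nat) (X : set ('rV[int]_d * 'rV[int]_k)).
Hypothesis T_ge1 : (1 <= T)%N.
Hypothesis X_range : forall i, X i -> forall m, 0 <= i.2 ord0 m < T%:Z.
Hypothesis X_periodic : forall m, translate T m @` X = X.
Variable a : 'rV[int]_d * 'rV[int]_k -> 'rV[int]_d * 'rV[int]_k -> R.
Hypothesis a_periodic : forall m i j, X i -> X j ->
  a (translate T m i) (translate T m j) = a i j.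
Hypothesis X_connected : forall i j, X i -> X j ->
  exists (N : nat) (p : nat -> 'rV[int]_d * 'rV[int]_k),
    [/\ p 0%N = i, p N = j, forall n, (n <= N)%N -> X (p n) &
        forall n, (n < N)%N -> 0 < a (p n) (p n.+1)].
Implicit Types (i j : 'rV[int]_d * 'rV[int]_k) (l : 'rV[int]_d).

Definition period_shift l i : 'rV[int]_d * 'rV[int]_k := (i.1 + T%:Z *: l, i.2).

Lemma period_shiftD l l' i : period_shift l (period_shift l' i) = period_shift (l + l') i.
Proof. by rewrite /period_shift/= -addrA -scalerDr [l' + l]addrC. Qed.

Lemma period_shift0 i : period_shift 0 i = i.
Proof. by case: i => i1 i2; rewrite /period_shift scaler0 addr0. Qed.

Lemma period_shift_inj i : injective (period_shift^~ i).
Proof.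
move=> l l' [] /addrI /rowP H; apply/rowP => m; have := H m; rewrite !mxE.
by apply: mulfI; rewrite eqz_nat -lt0n.
Qed.

Lemma X_period_shift l i : X i -> X (period_shift l i).
Proof.
move: l i; apply: lattice_ind => [i|l l' H H' i /H' /H|m i Xi|m i].
- by rewrite period_shift0.
- by rewrite period_shiftD.
- by rewrite -(X_periodic m); exists i.
rewrite -[X in X i -> _](X_periodic m) => -[j Xj <-].
by rewrite [translate _ _ _](_ : _ = period_shift (delta_mx ord0 m) j)// period_shiftD addNr period_shift0.
Qed.

Lemma a_period_shift l i j : X i -> X j -> a (period_shift l i) (period_shift l j) = a i j.
Proof.
move: l i j; apply: lattice_ind => [i j|l l' H H' i j Xi Xj|m i j Xi Xj|m i j Xi Xj].
- by rewrite !period_shift0.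
- by rewrite -!period_shiftD H ?H'//; exact: X_period_shift.
- exact: a_periodic.
rewrite -(a_periodic m (X_period_shift _ Xi) (X_period_shift _ Xj)).
have E i' : translate T m (period_shift (- delta_mx ord0 m) i') = i'.
  by rewrite [LHS](_ : _ = period_shift (delta_mx ord0 m) (period_shift (- delta_mx ord0 m) i'))// period_shiftD subrr period_shift0.
by rewrite !E.
Qed.

(* Along a path from i to j each edge difference is controlled, uniformly over
   all its lattice translates, by the total energy. *)
Lemma energy_controls_pair i j : X i -> X j -> exists2 kappa : R, 0 <= kappa &
  forall (w : 'rV[int]_d * 'rV[int]_k -> R) (D : R),
    sum_le (X `*` X) (fun ij => a ij.1 ij.2 * (w ij.1 - w ij.2) ^+ 2) D ->
    sum_le setT (fun l => (w (period_shift l j) - w (period_shift l i)) ^+ 2) (kappa * D).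
Proof.
move=> Xi Xj; have [N [p [p0 pN Xp ap]]] := X_connected Xi Xj.
exists (N%:R * \sum_(n < N) (a (p n) (p n.+1))^-1).
  by rewrite mulr_ge0// sumr_ge0// => n _; rewrite invr_ge0 ltW// ap.
move=> w D HD; rewrite -mulrA big_distrl/= -p0 -pN.
apply: (@sum_le_path _ _ _ N (fun n l => w (period_shift l (p n)))
  (fun n => (a (p n) (p n.+1))^-1 * D)) => n nN.
have hI : injective (fun l => (period_shift l (p n), period_shift l (p n.+1))).
  by move=> l l' [] E1 _; apply: (@period_shift_inj (p n)); rewrite /period_shift E1.
have XX l : setT l -> (X `*` X) (period_shift l (p n), period_shift l (p n.+1)).
  by move=> _; split; apply: X_period_shift; apply: Xp => //; exact: ltnW.
have := sum_leZ _ (sum_le_reindex hI XX HD).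
move=> /(_ (a (p n) (p n.+1))^-1); rewrite invr_ge0 (ltW (ap _ nN)) => /(_ isT).
apply: sum_le_mono => // l _ /=.
have Xpn := Xp n (ltnW nN); have Xpn1 := Xp n.+1 nN; rewrite a_period_shift//.
rewrite mulrA mulVf ?mul1r ?gt_eqF ?ap//.
by rewrite -sqrrN opprB.
Qed.

(** Integer form of cell membership; the condition on the last k coordinates is implied by
    [X_range]. *)
Lemma cellP l i : cell (R := R) T X l i <->
  X i /\ forall m, 0 <= i.1 ord0 m - T%:Z * l ord0 m < T%:Z.
Proof.
split=> [[Xi H _]|[Xi H]].
  by split=> // m; have := H m; rewrite !mxE ler_int_slab.
split=> // m; first by rewrite !mxE ler_int_slab.
have := X_range Xi m; rewrite !mxE add0r => /andP[h1 h2].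
by apply/andP; split; [rewrite ler0z|rewrite pmulrn ltr_int].
Qed.

Lemma cell_shift l i : cell (R := R) T X l (period_shift l i) <-> cell (R := R) T X 0 i.
Proof.
split=> /cellP[Xi H]; apply/cellP; split.
- by rewrite -[i]period_shift0 -(addNr l) -period_shiftD; exact: X_period_shift.
- by move=> m; have := H m; rewrite /period_shift/= !mxE mulr0 subr0 addrK.
- exact: X_period_shift.
by move=> m; have := H m; rewrite /period_shift/= !mxE mulr0 subr0 addrK.
Qed.

Lemma finite_cell0 : finite_set (cell (R := R) T X 0).
Proof.
apply: (@sub_finite_set _ _
  ((fun h : 'rV['I_T]_d * 'rV['I_T]_k => (box_point h.1, box_point h.2)) @` setT)).
  move=> i /cellP[Xi H].
  have l1 m : (`|i.1 ord0 m| < T)%N by have := H m; rewrite !mxE mulr0 subr0; lia.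
  have l2 m : (`|i.2 ord0 m| < T)%N by have := X_range Xi m; lia.
  exists (\row_m Ordinal (l1 m), \row_m Ordinal (l2 m)) => //=.
  case: i Xi H l1 l2 => i1 i2 /= Xi H l1 l2; congr (_, _); apply/rowP => m; rewrite !mxE/= gez0_abs//.
    by have := H m; rewrite !mxE mulr0 subr0 => /andP[].
  by have /andP[] := X_range Xi m.
by apply: finite_image; exact: finite_finset.
Qed.

Definition cell_seq : seq ('rV[int]_d * 'rV[int]_k) := fset_set (cell (R := R) T X 0).

Lemma cell_seq_uniq : uniq cell_seq. Proof. exact: fset_uniq. Qed.

Lemma cell_seqP i : i \in cell_seq <-> cell (R := R) T X 0 i.
Proof.
by rewrite /cell_seq in_fset_set; [split=> [/set_mem|/mem_set]|exact: finite_cell0].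
Qed.

(** Euclidean division by T brings any point of [X] back to the base cell. *)
Lemma cell_seq_size_gt0 : X !=set0 -> (0 < size cell_seq)%N.
Proof.
move=> [i Xi]; pose l : 'rV[int]_d := \row_m (i.1 ord0 m %/ T%:Z)%Z.
suff : period_shift (- l) i \in cell_seq by case: cell_seq.
apply/cell_seqP/cellP; split; first exact: X_period_shift.
move=> m; rewrite /period_shift/= !mxE mulr0 subr0 mulrN.
have T0 : T%:Z != 0 by rewrite eqz_nat -lt0n.
rewrite {1 3}(divz_eq (i.1 ord0 m) T%:Z) [_ * T%:Z]mulrC addrAC subrr add0r.
by rewrite modz_ge0//= ltz_pmod.
Qed.

Lemma cell_image l : cell (R := R) T X l = [set` map (period_shift l) cell_seq].
Proof.
apply/seteqP; split=> i; last by move=> /mapP[j /cell_seqP cj ->]; apply/cell_shift.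
move=> ci; apply/mapP; exists (period_shift (- l) i).
  by apply/cell_seqP/(cell_shift l); rewrite period_shiftD subrr period_shift0.
by rewrite period_shiftD subrr period_shift0.
Qed.

Lemma period_shift_injr l : injective (period_shift l).
Proof.
by move=> i j H; rewrite -[i]period_shift0 -[j]period_shift0 -(addNr l) -!period_shiftD H.
Qed.

Lemma cell_averageE eps (u : 'rV[R]_d * 'rV[R]_k -> R) l :
  cell_average T X eps u l =
  (size cell_seq)%:R^-1 * \sum_(i <- cell_seq) u (node eps (period_shift l i)).
Proof.
rewrite /cell_average cardfE -/cell_seq; congr (_ * _).
rewrite cell_image -fsbig_seq; first by rewrite big_map.
by rewrite map_inj_uniq ?cell_seq_uniq//; exact: period_shift_injr.
Qed.

Definition cell_mean (w : 'rV[int]_d * 'rV[int]_k -> R) l : R :=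
  (size cell_seq)%:R^-1 * \sum_(i <- cell_seq) w (period_shift l i).

Lemma sqr_mean_le (I : Type) (s : seq I) (b : I -> R) : (0 < size s)%N ->
  ((size s)%:R^-1 * \sum_(i <- s) b i) ^+ 2 <= (size s)%:R^-1 * \sum_(i <- s) b i ^+ 2.
Proof.
move=> s0; have n0 : 0 < (size s)%:R :> R by rewrite ltr0n.
rewrite exprMn expr2 -mulrA ler_wpM2l ?invr_ge0// ler_pdivrMl//.
exact: sqr_sum_le.
Qed.

Lemma sqr_cell_mean_sub_le w l (x : R) : X !=set0 ->
  (cell_mean w l - x) ^+ 2 <=
  (size cell_seq)%:R^-1 * \sum_(i <- cell_seq) (w (period_shift l i) - x) ^+ 2.
Proof.
move=> /cell_seq_size_gt0 s0; have n0 : 0 < (size cell_seq)%:R :> R by rewrite ltr0n.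
apply: le_trans (sqr_mean_le _ s0); rewrite le_eqVlt; apply/orP; left; apply/eqP.
congr (_ ^+ 2); rewrite sumrB mulrBr -/(cell_mean w l); congr (_ - _).
by rewrite big_const_seq count_predT iter_addr_0 -[x *+ _]mulr_natl mulrA mulVf ?mul1r ?gt_eqF.
Qed.

Lemma energy_sum_le (eps C : R) (u : 'rV[R]_d * 'rV[R]_k -> R) : 0 < eps ->
  (energy X a eps u <= C%:E)%E ->
  sum_le (X `*` X)
    (fun ij => a ij.1 ij.2 * (u (node eps ij.1) - u (node eps ij.2)) ^+ 2)
    (C * eps ^+ 2 / eps ^+ d).
Proof.
move=> e0 HC s us sX.
have ed : eps ^+ d != 0 by rewrite expf_neq0// gt_eqF.
have e20 : eps != 0 by rewrite gt_eqF.
have := le_trans (esum_ge_seq (fun ij =>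
  (eps ^+ d * a ij.1 ij.2 * ((u (node eps ij.1) - u (node eps ij.2)) / eps) ^+ 2)%:E) us sX) HC.
rewrite sumEFin lee_fin => H.
rewrite (_ : \sum_(i <- s) _ = eps ^+ 2 / eps ^+ d * \sum_(ij <- s)
  (eps ^+ d * a ij.1 ij.2 * ((u (node eps ij.1) - u (node eps ij.2)) / eps) ^+ 2)).
  rewrite [leRHS](_ : _ = eps ^+ 2 / eps ^+ d * C); last by ring.
  by rewrite ler_wpM2l// divr_ge0 ?exprn_ge0// ltW.
rewrite big_distrr/=; apply: eq_bigr => ij _; field.
by rewrite e20 ed.
Qed.

(** Up to translation only finitely many pairs occur: a point with its copy in a neighbouring cell,
    and two points of one cell. The sum of their path constants serves for both estimates, by
    Jensen's inequality. *)
Lemma energy_controls_cells : X !=set0 -> exists2 kappa : R, 0 <= kappa &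
  forall (w : 'rV[int]_d * 'rV[int]_k -> R) (D : R),
    sum_le (X `*` X) (fun ij => a ij.1 ij.2 * (w ij.1 - w ij.2) ^+ 2) D ->
    (forall m, sum_le setT
       (fun l => (cell_mean w (l + delta_mx ord0 m) - cell_mean w l) ^+ 2) (kappa * D)) /\
    sum_le setT (fun l => \sum_(i <- cell_seq) (w (period_shift l i) - cell_mean w l) ^+ 2)
      (kappa * D).
Proof.
move=> X0; have s0 := cell_seq_size_gt0 X0.
have n0 : 0 < (size cell_seq)%:R :> R by rewrite ltr0n.
have kap_ex (ij : ('rV[int]_d * 'rV[int]_k) * ('rV[int]_d * 'rV[int]_k)) : exists kappa : R,
    0 <= kappa /\ (X ij.1 -> X ij.2 -> forall (w : 'rV[int]_d * 'rV[int]_k -> R) (D : R),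
    sum_le (X `*` X) (fun ij => a ij.1 ij.2 * (w ij.1 - w ij.2) ^+ 2) D ->
    sum_le setT (fun l => (w (period_shift l ij.2) - w (period_shift l ij.1)) ^+ 2) (kappa * D)).
  (* Pairs outside [X] get the constant 0, so that a total choice function exists. *)
  have [[Xi Xj]|nX] := pselect (X ij.1 /\ X ij.2).
    by have [kappa k0 H] := energy_controls_pair Xi Xj; exists kappa.
  by exists 0; split=> // Xi Xj; case: nX.
have [kap kapP] := choice kap_ex.
pose k1 := \sum_m \sum_(i <- cell_seq) kap (i, period_shift (delta_mx ord0 m) i).
pose k2 := \sum_(i <- cell_seq) \sum_(j <- cell_seq) kap (i, j).
have k10 : 0 <= k1 by apply: sumr_ge0 => m _; apply: sumr_ge0 => i _; exact: (kapP _).1.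
have k20 : 0 <= k2 by apply: sumr_ge0 => i _; apply: sumr_ge0 => j _; exact: (kapP _).1.
exists ((size cell_seq)%:R^-1 * (k1 + k2)).
  by rewrite mulr_ge0 ?invr_ge0 ?addr_ge0.
move=> w D HD.
have D0 := sum_le_ge0 HD.
have Xs i : i \in cell_seq -> X i by move=> /cell_seqP/cellP[].
have kapw i j : X i -> X j ->
    sum_le setT (fun l => (w (period_shift l j) - w (period_shift l i)) ^+ 2) (kap (i, j) * D).
  by move=> Xi Xj; exact: (kapP (i, j)).2.
split.
  move=> m.
  have H : sum_le setT (fun l => (size cell_seq)%:R^-1 * \sum_(i <- cell_seq)
      (w (period_shift l (period_shift (delta_mx ord0 m) i)) - w (period_shift l i)) ^+ 2)
      ((size cell_seq)%:R^-1 * \sum_(i <- cell_seq) (kap (i, period_shift (delta_mx ord0 m) i) * D)).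
    apply: sum_leZ; first by rewrite invr_ge0.
    move=> s us _; rewrite exchange_big/= big_seq [leRHS]big_seq; apply: ler_sum => i /Xs Xi.
    exact: (kapw _ _ Xi (X_period_shift _ Xi) s us (fun _ _ => I)).
  apply: sum_le_mono H => [l _|].
    rewrite /cell_mean -mulrBr -sumrB.
    under eq_bigr do rewrite -period_shiftD.
    exact: sqr_mean_le.
  rewrite -mulrA ler_wpM2l ?invr_ge0// -big_distrl/= ler_wpM2r//.
  rewrite -[leLHS]addr0 lerD// /k1 (bigD1 m)//= lerDl.
  by apply: sumr_ge0 => m' _; apply: sumr_ge0 => i _; exact: (kapP _).1.
have H : sum_le setT (fun l => (size cell_seq)%:R^-1 * \sum_(i <- cell_seq) \sum_(j <- cell_seq)
      (w (period_shift l j) - w (period_shift l i)) ^+ 2)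
      ((size cell_seq)%:R^-1 * \sum_(i <- cell_seq) \sum_(j <- cell_seq) (kap (i, j) * D)).
  apply: sum_leZ; first by rewrite invr_ge0.
  move=> s us _; rewrite exchange_big/= big_seq [leRHS]big_seq; apply: ler_sum => i /Xs Xi.
  rewrite exchange_big/= big_seq [leRHS]big_seq; apply: ler_sum => j /Xs Xj.
  exact: (kapw _ _ Xi Xj s us (fun _ _ => I)).
apply: sum_le_mono H => [l _|].
  rewrite big_distrr/=; apply: ler_sum => i _.
  by rewrite -sqrrN opprB; exact: sqr_cell_mean_sub_le.
rewrite -mulrA ler_wpM2l ?invr_ge0//.
under eq_bigr do rewrite -big_distrl/=.
by rewrite -big_distrl/= ler_wpM2r// lerDr.
Qed.

Lemma cell_mean_sq_sum (Omega : set 'rV[R]_d) (eps C : R) (u : 'rV[R]_d * 'rV[R]_k -> R) :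
  X !=set0 -> 0 < eps -> (sum_sq T X Omega eps u <= C%:E)%E ->
  sum_le (deep_cells T Omega eps)
    (fun l => cell_mean (fun i => u (node eps i)) l ^+ 2) (C / eps ^+ d).
Proof.
move=> X0 e0 HC s us sA; have s0 := cell_seq_size_gt0 X0.
have ed : 0 < eps ^+ d by rewrite exprn_gt0.
have n0 : 0 < (size cell_seq)%:R :> R by rewrite ltr0n.
rewrite ler_pdivlMr// mulrC big_distrr/= -lee_fin; apply: le_trans HC.
apply: le_trans (esum_ge_seq (fun l => \esum_(i in cell T X l)
  (eps ^+ d * `|u (node eps i)| ^+ 2)%:E)%E us sA).
rewrite -sumEFin; apply: lee_sum => l _.
apply: (@le_trans _ _ (\sum_(i <- map (period_shift l) cell_seq)
    (eps ^+ d * `|u (node eps i)| ^+ 2)%:E)%E); last first.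
  apply: esum_ge_seq => [|i]; first by rewrite map_inj_uniq ?cell_seq_uniq//; exact: period_shift_injr.
  by rewrite cell_image.
rewrite sumEFin lee_fin big_map -big_distrr/= ler_wpM2l ?(ltW ed)//.
rewrite -[cell_mean _ _]subr0; apply: le_trans (sqr_cell_mean_sub_le _ _ _ X0) _.
rewrite (eq_bigr (fun i => `|u (node eps (period_shift l i))| ^+ 2)); last first.
  by move=> i _; rewrite subr0 real_normK ?num_real.
rewrite ler_piMl ?sumr_ge0//.
by rewrite invf_le1// ler1n.
Qed.

End periodic_graph.

(** * Deep cells, voxels and the interpolation *)

Section euclidean_norm.
Context {R : realType} {n : nat}.
Implicit Types (x y z : 'rV[R]_n) (A : set 'rV[R]_n).

Lemma coord_le_enorm x i : `|x ord0 i| <= enorm x.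
Proof.
rewrite -sqrtr_sqr; apply: ler_wsqrtr; rewrite /dotp (bigD1 i)//= -expr2 lerDl.
by apply: sumr_ge0 => j _; rewrite -expr2 sqr_ge0.
Qed.

Lemma open_rV_box A x : open A -> A x -> exists2 r : R, 0 < r &
  forall y, (forall i, `|x ord0 i - y ord0 i| < r) -> A y.
Proof.
move=> oA Ax; have /nbhs_ballP[r /= r0 rA] := open_nbhs_nbhs (conj oA Ax).
by exists r => // y H; apply: rA; apply/rV_ballE.
Qed.

(** An open set contains none of its boundary points, so each of them differs from [y] by at least r
    in some coordinate, hence in Euclidean norm. An empty boundary is at distance +oo and is covered
    too. *)
Lemma edist_boundary_ge A y (r : R) : open A -> 0 < r ->
  (forall z, (forall i, `|y ord0 i - z ord0 i| < r) -> A z) ->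
  (r%:E <= Defs.edist y (boundary A))%E.
Proof.
move=> oA r0 H; apply: le_ereal_inf_tmp => _ [z [_ nz] <-]; rewrite lee_fin leNgt.
apply/negP => zr; apply: nz; have -> : interior A = A by exact/interior_id.
apply: H => i.
by apply: le_lt_trans zr; have := coord_le_enorm (y - z) i; rewrite !mxE.
Qed.

Lemma scale_cube (e : R) p s : 0 < e -> scale e (@cube R n p s) = cube (e *: p) (e * s).
Proof.
move=> e0; apply/seteqP; split=> [_ [x H <-] i|x H].
  by have := H i; rewrite !mxE -mulrDr ler_pM2l// ltr_pM2l.
exists (e^-1 *: x); last by rewrite scalerA mulfV ?gt_eqF// scale1r.
move=> i; have := H i; rewrite !mxE -mulrDr => /andP[h1 h2].
by rewrite ler_pdivlMl// h1 ltr_pdivrMl.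
Qed.

Lemma scale_QdP (T : nat) (e : R) (l : 'rV[int]_n) x : 0 < e -> (1 <= T)%N ->
  scale e (Qd T l) x <-> lattice_floor (e * T%:R) x = l.
Proof.
move=> e0 T1; have T0 : 0 < T%:R :> R by rewrite ltr0n.
rewrite /Qd scale_cube// scalerA; split=> H.
  by apply/lattice_floorP => //; rewrite mulr_gt0.
by apply/lattice_floorP => //; rewrite mulr_gt0.
Qed.

End euclidean_norm.

Section sobolev_facts.
Context {R : realType} {n : nat}.

Lemma L2_of_sq_integral (A : set 'rV[R]_n) (f : 'rV[R]_n -> R) (D : R) :
  measurable_fun setT f ->
  (\int[lebesgue_rV R n]_(x in A) (f x ^+ 2)%:E <= D%:E)%E -> L2 A f.
Proof.
move=> mf fD; split; first exact: measurable_funTS.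
rewrite /finite_norm unlock; apply: poweR_lty.
apply: le_lt_trans (ltry D); apply: le_trans fD.
rewrite [leRHS]integral_mkcond; apply: le_integral_ge0 => x _.
- exact: poweR_ge0.
- by rewrite patchE; case: ifP => // _; rewrite lee_fin sqr_ge0.
split=> //=; rewrite !patchE; case: ifP => _; rewrite /= lee_fin powR_mulrn ?normr_ge0//.
  by rewrite real_normK ?num_real.
by rewrite normr0 expr0n.
Qed.

Lemma H1_set0 : H1 (set0 : set 'rV[R]_n) (fun=> 0).
Proof.
have L20 : L2 (set0 : set 'rV[R]_n) (fun=> 0).
  by apply: (@L2_of_sq_integral _ _ 0) => //; rewrite integral_set0.
by split=> // m; exists (fun=> 0) => // phi _; rewrite !integral_set0 oppe0.
Qed.

End sobolev_facts.

Section squeeze.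
Context {R : realType}.

Lemma cvg_ereal0 (u : nat -> \bar R) : (forall k, (0 <= u k)%E) ->
  (forall t : R, 0 < t -> \forall k \near \oo, (u k <= t%:E)%E) -> u k @[k --> \oo] --> 0%E.
Proof.
move=> u0 ut; apply/fine_cvgP; split.
  apply: filterS (ut 1 ltr01) => k uk.
  by rewrite ge0_fin_numE// (le_lt_trans uk)// ltry.
apply/cvgrPdist_le => t t0; apply: filterS (ut t t0) => k uk.
rewrite sub0r normrN ger0_norm ?fine_ge0// -lee_fin fineK//.
by rewrite ge0_fin_numE// (le_lt_trans uk)// ltry.
Qed.

End squeeze.

Section voxels.
Context {R : realType} {d k : nat}.
Variables (T : nat) (X : set ('rV[int]_d * 'rV[int]_k)).
Hypothesis T_ge1 : (1 <= T)%N.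
Hypothesis X_range : forall i, X i -> forall m, 0 <= i.2 ord0 m < T%:Z.
Implicit Types (i j : 'rV[int]_d * 'rV[int]_k) (x : 'rV[R]_d * 'rV[R]_k).

Lemma voxelP (eps : R) i x : 0 < eps ->
  voxel eps i x <-> lattice_floor eps x.1 = i.1 /\ lattice_floor 1 x.2 = i.2.
Proof.
move=> e0; rewrite /voxel /= scale_cube// mulr1.
split=> [[/lattice_floorP h1 h2]|[/(lattice_floorP _ _ e0) h1 /lattice_floorP h2]].
  by split; [exact: h1|apply/lattice_floorP => //; rewrite scale1r].
by split=> //; have := h2 ltr01; rewrite scale1r.
Qed.

(** Voxels are half-open and pairwise disjoint, so a single term of the sum survives at x. *)
Lemma interpolationE (eps : R) u i x : 0 < eps -> X i -> voxel eps i x ->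
  interpolation X eps u x = u (node eps i).
Proof.
move=> e0 Xi vx; rewrite /interpolation -(@fsbig_widen _ _ _ _ [set i])/=.
- by rewrite fsbig_set1 indicE mem_set// mulr1.
- by move=> _ ->.
move=> j [Xj /= ji]; rewrite indicE memNset ?mulr0//.
move=> /(voxelP _ _ e0)[h1 h2]; move: vx => /(voxelP _ _ e0)[h3 h4]; apply: ji.
by case: i j Xi Xj h1 h2 h3 h4 => ? ? [? ?] /= _ _ -> -> -> ->.
Qed.

Lemma voxel_cell (eps : R) i x : 0 < eps -> X i -> voxel eps i x ->
  cell (R := R) T X (lattice_floor (eps * T%:R) x.1) i.
Proof.
move=> e0 Xi /(voxelP _ _ e0)[h1 h2].
have T0 : 0 < T%:R :> R by rewrite ltr0n.
have eT0 : 0 < eps * T%:R by rewrite mulr_gt0.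
apply/(cellP X_range); split=> // m; rewrite -(ler_int_slab R).
have := lattice_floor_close x.1 m e0; rewrite h1.
have := lattice_floor_close x.1 m eT0.
set l := lattice_floor _ _ => /andP[l1 l2] /andP[i1 i2].
rewrite (ler_int_slab R).
(* The point x lies in both half-open cubes, which yields strict real inequalities; integrality
   sharpens this one to T l <= i. *)
have c1 : T%:Z * l ord0 m < i.1 ord0 m + 1.
  rewrite -(ltr_int R) intrM intrD -pmulrn -(ltr_pM2l e0) mulrA mulrDr mulr1; lra.
have c2 : i.1 ord0 m < T%:Z * l ord0 m + T%:Z.
  rewrite -(ltr_int R) intrD intrM -pmulrn -(ltr_pM2l e0) mulrDr mulrA; lra.
by move: c1 c2; lia.
Qed.

Lemma coarseE (Omega : set 'rV[R]_d) (eps : R) u (x : 'rV[R]_d) : 0 < eps ->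
  inner_cells T Omega eps (lattice_floor (eps * T%:R) x) ->
  coarse T X Omega eps u x = cell_average T X eps u (lattice_floor (eps * T%:R) x).
Proof.
move=> e0; set l := lattice_floor _ _ => il.
rewrite /coarse -(@fsbig_widen _ _ _ _ [set l])/=.
- by rewrite fsbig_set1 indicE mem_set ?mulr1//; apply/scale_QdP.
- by move=> _ ->.
move=> l' [_ /= ll']; rewrite indicE memNset ?mulr0//.
by move=> /(scale_QdP _ _ e0 T_ge1) E; apply: ll'.
Qed.

(** Splits u - v at the cell mean. [V] dominates the deviation of every node of a cell, so the
    majorant depends on the last k variables only through [Qk], and Tonelli's theorem, applied to
    this measurable majorant, produces T^k. *)
Lemma sq_error_le (eps : R) (u : 'rV[R]_d * 'rV[R]_k -> R) (v : 'rV[R]_d -> R)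
    (D : set ('rV[R]_d * 'rV[R]_k)) (f V : 'rV[int]_d -> R) (N : nat) (A B : R) :
  0 < eps -> measurable_fun setT v ->
  (forall x, D x -> big_cube N x.1 /\ Qk T x.2) ->
  (forall l, 0 <= V l) ->
  (forall l i, cell (R := R) T X l i -> (u (node eps i) - f l) ^+ 2 <= V l) ->
  (\int[lebesgue_rV R d]_y (V (lattice_floor (eps * T%:R) y))%:E <= A%:E)%E ->
  (\int[lebesgue_rV R d]_(y in big_cube N)
     ((f (lattice_floor (eps * T%:R) y) - v y) ^+ 2)%:E <= B%:E)%E ->
  (sq_error X eps u v D <= (T%:R ^+ k * (2 * A + 2 * B))%:E)%E.
Proof.
move=> e0 mv DB V0 uV VA fB; rewrite /sq_error.
have T0 : 0 < T%:R :> R by rewrite ltr0n.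
have eT0 : 0 < eps * T%:R by rewrite mulr_gt0.
have mB := @measurable_big_cube R d N.
have mQ : measurable (Qk T : set 'rV[R]_k) by exact: measurable_cube.
pose F (y : 'rV[R]_d) : R := (f (lattice_floor (eps * T%:R) y) - v y) ^+ 2 * \1_(@big_cube R d N) y.
pose G (y : 'rV[R]_d) : R := 2 * V (lattice_floor (eps * T%:R) y) + 2 * F y.
have F0 y : 0 <= F y by rewrite mulr_ge0 ?sqr_ge0.
have G0 y : 0 <= G y by apply: addr_ge0; apply: mulr_ge0.
have mV : measurable_fun setT (fun y : 'rV[R]_d => V (lattice_floor (eps * T%:R) y)).
  exact: measurable_lattice_comp.
have mF : measurable_fun setT F.
  apply: measurable_funM; last exact: measurable_indic.
  by apply: measurable_funX; apply: measurable_funB => //; exact: measurable_lattice_comp.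
have mG : measurable_fun setT G.
  by apply: measurable_funD; apply: measurable_funM.
have GAB : (\int[lebesgue_rV R d]_y (G y)%:E <= (2 * A + 2 * B)%:E)%E.
  apply: (le_integral_lin2 _ _ _ _ _ _ mV mF) => //.
  apply: le_trans fB; rewrite [leRHS]integral_mkcond; apply: le_integral_ge0 => y _.
  - by rewrite lee_fin.
  - by rewrite patchE; case: ifP => // _; rewrite lee_fin sqr_ge0.
  split=> //; rewrite patchE /F indicE; case: ifP => _; first by rewrite mulr1.
  by rewrite mulr0.
pose H (x : 'rV[R]_d * 'rV[R]_k) : R := G x.1 * \1_(Qk T : set 'rV[R]_k) x.2.
have H0 x : (0 <= (H x)%:E)%E by rewrite lee_fin mulr_ge0.
have mH : measurable_fun setT (EFin \o H).
  apply/measurable_EFinP; apply: measurable_funM.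
    exact: (measurableT_comp mG measurable_fst).
  by apply: (measurableT_comp _ measurable_snd); exact: measurable_indic.
apply: (@le_trans _ _ (\int[lebesgue_rV R d \x lebesgue_rV R k]_x (H x)%:E)%E).
  apply: le_integral_ge0 => x; rewrite ?lee_fin ?mulr_ge0 ?exprn_ge0//.
  move=> Dx; have [Bx Qx] := DB _ Dx; split=> //.
  rewrite /H indicE [in X in _ <= X]indicE (mem_set Qx) mulr1.
  have [[i Xi vx]|nv] := pselect ((\bigcup_(i in X) voxel eps i) x); last first.
    by rewrite memNset// mulr0.
  rewrite (mem_set (_ : (\bigcup_(i in X) voxel eps i) x)); last by exists i.
  rewrite mulr1 real_normK ?num_real// (interpolationE _ e0 Xi vx).
  rewrite /G /F indicE (mem_set Bx) mulr1.
  have := uV _ _ (voxel_cell e0 Xi vx).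
  set a := u _; set b := f _; set c := v _; set V1 := V _ => ab.
  by have := sqr_ge0 ((a - b) - (b - c)); lra.
have := @fubini_tonelli1 _ _ _ _ R (lebesgue_rV R d) (lebesgue_rV R k) (EFin \o H) mH H0.
move=> ->; rewrite /fubini_F.
apply: (@le_trans _ _ (\int[lebesgue_rV R d]_y ((T%:R ^+ k)%:E * (G y)%:E))%E).
  apply: le_integral_ge0 => y _.
  - by apply: integral_ge0 => z _; exact: H0.
  - by rewrite -EFinM lee_fin mulr_ge0 ?exprn_ge0// ltW.
  split=> //; rewrite /H /=; under eq_integral do rewrite EFinM.
  rewrite ge0_integralZl_EFin//; last by apply/measurable_EFinP; exact: measurable_indic.
  rewrite integral_indic// setIT muleC.
  apply: lee_wpmul2r; first by rewrite lee_fin.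
  by rewrite le_eqVlt; apply/orP; left; apply/eqP; apply: lebesgue_cube; exact: ltW.
rewrite ge0_integralZl_EFin//; last 2 first.
- by move=> y _; rewrite lee_fin.
- exact/measurable_EFinP.
by rewrite [leRHS]EFinM lee_wpmul2l// lee_fin exprn_ge0// ltW.
Qed.

End voxels.

(** On an unbounded [Omega] mass may escape to infinity, so the error is claimed on every ball, and
    on all of [Omega_tilde] when [Omega] is bounded. *)
Theorem proposition4p2 (R : realType) (d k T : nat)
  (d_ge1 : (1 <= d)%N) (k_ge1 : (1 <= k)%N) (T_ge1 : (1 <= T)%N)
  (X : set ('rV[int]_d * 'rV[int]_k))
  (X_neq0 : X !=set0)
  (X_range : forall i, X i -> forall m, 0 <= i.2 ord0 m < T%:Z)
  (X_periodic : forall m, translate T m @` X = X)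
  (E : set (('rV[int]_d * 'rV[int]_k) * ('rV[int]_d * 'rV[int]_k)))
  (E_sub : E `<=` X `*` X)
  (E_connected : forall i j, X i -> X j ->
    exists (N : nat) (p : nat -> 'rV[int]_d * 'rV[int]_k),
      [/\ p 0%N = i, p N = j, forall n, (n <= N)%N -> X (p n) &
          forall n, (n < N)%N -> E (p n, p n.+1)])
  (E_periodic : forall m i j, E (translate T m i, translate T m j) <-> E (i, j))
  (rho : R) (rho_gt0 : 0 < rho) (rho_leT : rho <= T%:R)
  (E_range : forall i j, E (i, j) -> lattice_dist i j <= rho)
  (a : 'rV[int]_d * 'rV[int]_k -> 'rV[int]_d * 'rV[int]_k -> R)
  (a_periodic : forall m i j, X i -> X j ->
    a (translate T m i) (translate T m j) = a i j)
  (a_gt0 : forall i j, E (i, j) -> 0 < a i j)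
  (a_eq0 : forall i j, X i -> X j -> ~ E (i, j) -> a i j = 0)
  (Omega : set 'rV[R]_d)
  (Omega_open : open Omega) (Omega_lipschitz : lipschitz_boundary Omega)
  (u : R -> 'rV[R]_d * 'rV[R]_k -> R) (C : R)
  (u_bound : (ereal_sup
    [set sum_sq T X Omega eps (u eps) + energy X a eps (u eps)
      | eps in [set eps : R | (0 < eps)%R]] <= C%:E)%E)
  (eps : nat -> R) (eps_gt0 : forall n, 0 < eps n)
  (eps_to0 : eps n @[n --> \oo] --> 0) :
  exists2 s : nat -> nat, {homo s : m n / (m < n)%N} &
  exists v : 'rV[R]_d -> R,
    [/\ H1 Omega v,
        forall K : set 'rV[R]_d, compact K -> K `<=` Omega ->
          (\int[lebesgue_rV R d]_(x in K)
             (`|coarse T X Omega (eps (s n)) (u (eps (s n))) x - v x| ^+ 2)%:E)%E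
          @[n --> \oo] --> 0%E,
        forall r : R,
          sq_error X (eps (s n)) (u (eps (s n))) v
            (Omega_tilde T Omega (eps (s n)) `&` [set x | enorm x.1 < r])
          @[n --> \oo] --> 0%E &
        bounded_set Omega ->
          sq_error X (eps (s n)) (u (eps (s n))) v
            (Omega_tilde T Omega (eps (s n)))
          @[n --> \oo] --> 0%E].
Proof.
have T0 : 0 < T%:R :> R by rewrite ltr0n.
have T1 : 1 <= T%:R :> R by rewrite ler1n.
have a_ge0 i j : X i -> X j -> 0 <= a i j.
  move=> Xi Xj; have [Eij|nE] := pselect (E (i, j)); first exact/ltW/a_gt0.
  by rewrite a_eq0.
have X_conn i j : X i -> X j -> exists (N : nat) (p : nat -> 'rV[int]_d * 'rV[int]_k),
    [/\ p 0%N = i, p N = j, forall n, (n <= N)%N -> X (p n) &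
        forall n, (n < N)%N -> 0 < a (p n) (p n.+1)].
  move=> Xi Xj; have [N [p [p0 pN Xp Ep]]] := E_connected i j Xi Xj.
  by exists N, p; split=> // n nN; exact/a_gt0/Ep.
(* An empty [Omega] offers no point at which to anchor the mesh averages, and every claim is then
   trivial. *)
have [->|/set0P[x0 Ox0]] := eqVneq Omega set0.
  have Ot e : Omega_tilde T (set0 : set 'rV[R]_d) e = set0 :> set ('rV[R]_d * 'rV[R]_k).
    by rewrite /Omega_tilde (_ : deep_cells _ _ _ = set0) ?bigcup_set0 ?set0X//;
      apply/seteqP; split=> // l [].
  exists id => //; exists (fun=> 0); split.
  - exact: H1_set0.
  - move=> C0 _; rewrite subset0 => ->.
    by under eq_fun do rewrite integral_set0; exact: cvg_cst.
  - move=> r; under eq_fun do rewrite Ot set0I /sq_error integral_set0; exact: cvg_cst.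
  - move=> _; under eq_fun do rewrite Ot /sq_error integral_set0; exact: cvg_cst.
have sq_ge0 e : 0 < e -> (0 <= sum_sq T X Omega e (u e))%E.
  move=> e0; apply: esum_ge0 => l _; apply: esum_ge0 => i _.
  by rewrite lee_fin mulr_ge0 ?exprn_ge0// ltW.
have en_ge0 e : 0 < e -> (0 <= energy X a e (u e))%E.
  move=> e0; apply: esum_ge0 => ij [Xi Xj]; rewrite lee_fin.
  by rewrite mulr_ge0 ?sqr_ge0// mulr_ge0 ?a_ge0// exprn_ge0// ltW.
have uC e : 0 < e -> (sum_sq T X Omega e (u e) + energy X a e (u e) <= C%:E)%E.
  by move=> e0; apply: le_trans u_bound; apply: ereal_sup_ubound; exists e.
have sqC e : 0 < e -> (sum_sq T X Omega e (u e) <= C%:E)%E.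
  by move=> e0; apply: le_trans (uC _ e0); rewrite leeDl// en_ge0.
have enC e : 0 < e -> (energy X a e (u e) <= C%:E)%E.
  by move=> e0; apply: le_trans (uC _ e0); rewrite leeDr// sq_ge0.
have C0 : 0 <= C by rewrite -lee_fin; apply: le_trans (sqC 1 ltr01); exact: sq_ge0.
have [kappa kappa0 kappaP] := energy_controls_cells T_ge1 X_range X_periodic a_periodic X_conn X_neq0.
pose eta N := eps N * T%:R.
have eta_gt0 N : 0 < eta N by rewrite mulr_gt0.
have eta_to0 : eta N @[N --> \oo] --> 0.
  by rewrite -(mul0r (T%:R : R)); apply: cvgMl.
pose w N i := u (eps N) (node (eps N) i).
pose f N l := cell_mean (R := R) T X (w N) l.
pose V N l := \sum_(i <- cell_seq (R := R) T X) (w N (period_shift T l i) - f N l) ^+ 2.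
have fE N l : cell_average T X (eps N) (u (eps N)) l = f N l.
  exact: cell_averageE.
have HE N := energy_sum_le (eps_gt0 N) (enC _ (eps_gt0 N)).
have ed N : 0 < eps N ^+ d by rewrite exprn_gt0.
have Td : 0 < T%:R ^+ d :> R by rewrite exprn_gt0.
(* The sums are normalized by eps^d while the mesh is eta = eps T, whence T^d; one constant serves
   the gradient and the L^2 bounds. *)
pose K := (kappa * C + C) * T%:R ^+ d.
have KE N (z : R) : K * z / eta N ^+ d = (kappa * C + C) * z / eps N ^+ d.
  by rewrite /K /eta exprMn; field; rewrite !gt_eqF.
have eta_small (t : R) : 0 < t -> \forall N \near \oo, eta N < t.
  move=> t0; move/cvgrPdist_lt : eta_to0 => /(_ _ t0); apply: filterS => N.
  by rewrite sub0r normrN gtr0_norm.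
have eps_eta N : eps N ^+ 2 <= eta N ^+ 2.
  by rewrite /eta exprMn ler_peMr ?sqr_ge0// exprn_ege1.
have f_grad N m : sum_le setT (fun l => (f N (l + delta_mx ord0 m) - f N l) ^+ 2)
    (K * eta N ^+ 2 / eta N ^+ d).
  have := (kappaP (w N) _ (HE N)).1 m; apply: sum_le_mono => //.
  rewrite KE mulrA ler_pM2r ?invr_gt0// mulrA.
  by apply: ler_pM => //; [exact: mulr_ge0|exact: sqr_ge0|rewrite lerDl].
have f_L2 N : sum_le (deep_cells T Omega (eps N)) (fun l => f N l ^+ 2) (K / eta N ^+ d).
  have := cell_mean_sq_sum T_ge1 X_range X_periodic X_neq0 (eps_gt0 N) (sqC _ (eps_gt0 N)).
  apply: sum_le_mono => //.
  rewrite -[K]mulr1 KE mulr1 ler_pM2r ?invr_gt0//.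
  by rewrite lerDr mulr_ge0.
have VD N : sum_le setT (V N) (kappa * (C * eps N ^+ 2 / eps N ^+ d)).
  exact: (kappaP (w N) _ (HE N)).2.
have V0 N l : 0 <= V N l by apply: sumr_ge0 => i _; exact: sqr_ge0.
have A_near x : Omega x -> exists2 r : R, 0 < r & \forall N \near \oo,
    forall l : 'rV[int]_d, (forall i, `|eta N * (l ord0 i)%:~R - x ord0 i| < r) ->
    deep_cells T Omega (eps N) l.
  move=> Ox; have [r r0 rO] := open_rV_box Omega_open Ox.
  (* One half of r covers the way from x to the corner of the cell, the other the distance from the
     corner to the boundary; the threshold on eta below makes 2 sqrt(d) eta < r / 2, as [deep_cells]
     requires. *)
  exists (r / 2); first by rewrite divr_gt0.
  have r20 : 0 < r / (4 * (Num.sqrt d%:R + 1)) :> R.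
    by rewrite divr_gt0// mulr_gt0// ltr_wpDl// sqrtr_ge0.
  apply: filterS (eta_small _ r20) => N eN l lx.
  split.
    apply: rO => i; rewrite !mxE distrC; apply: lt_trans (lx i) _.
    by rewrite ltr_pdivrMr// ltr_pMr// ltr1n.
  apply: (@lt_le_trans _ _ (r / 2)%:E); last first.
    apply: edist_boundary_ge; rewrite ?divr_gt0// => z pz; apply: rO => i.
    have -> : x ord0 i - z ord0 i =
      ((eps N * T%:R) *: of_int l) ord0 i - z ord0 i - (eta N * (l ord0 i)%:~R - x ord0 i).
      by rewrite !mxE /eta; ring.
    by apply: le_lt_trans (ler_normB _ _) _; rewrite [ltRHS]splitr ltrD.
  move: eN; rewrite lte_fin ltr_pdivlMr ?mulr_gt0 ?ltr_wpDl ?sqrtr_ge0//.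
  by have := eta_gt0 N; rewrite /eta; nra.
have [s s_homo [v mv Uv]] := lattice_rellich d_ge1 eta_gt0 eta_to0 f_grad f_L2 A_near Ox0.
have s_ge n : (n <= s n)%N.
  by elim: n => // n IH; exact: leq_ltn_trans IH (s_homo _ _ (ltnSn n)).
have sub (P : nat -> Prop) : (\forall N \near \oo, P N) -> \forall n \near \oo, P (s n).
  move=> [N0 _ HP]; exists N0 => // n /= Nn; apply: HP => /=.
  exact: leq_trans Nn (s_ge n).
have etas_to0 : eta (s n) @[n --> \oo] --> 0.
  by move: eta_to0 => /cvgrPdist_lt e0; apply/cvgrPdist_lt => t /e0 /sub.
have etas_small (t : R) : 0 < t -> \forall n \near \oo, eta (s n) < t by move=> /eta_small /sub.
have A_near' x : Omega x -> \forall n \near \oo,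
    deep_cells T Omega (eps (s n)) (lattice_floor (eta (s n)) x).
  move=> /A_near[r r0 /sub H]; apply: filterS2 H (etas_small _ r0) => n Hn er.
  apply: Hn => i; have := lattice_floor_close x i (eta_gt0 (s n)).
  by rewrite distrC => /andP[h1 h2]; rewrite ger0_norm//; exact: lt_trans er.
have tail_small (t : R) : 0 < t -> \forall n \near \oo, n.+1%:R^-1 <= t.
  by move=> t0; near=> n; apply/ltW; near: n; exact: near_infty_natSinv_lt (PosNum t0).
(* Both error claims concern sets that eventually lie over the n-th box, where the n-th rate in [Uv]
   applies. *)
have sq_error_to0 (D : nat -> set ('rV[R]_d * 'rV[R]_k)) :
    (\forall n \near \oo, forall x, D n x -> big_cube n x.1 /\ Qk T x.2) ->
    sq_error X (eps (s n)) (u (eps (s n))) v (D n) @[n --> \oo] --> 0%E.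
  move=> DB; apply: cvg_ereal0 => [n|t t0].
    by apply: integral_ge0 => x _; rewrite lee_fin mulr_ge0// exprn_ge0.
  pose t' := t / (4 * T%:R ^+ k).
  have Tk : 0 < T%:R ^+ k :> R by rewrite exprn_gt0.
  have t'0 : 0 < t' by rewrite divr_gt0// mulr_gt0.
  pose M := kappa * C * T%:R ^+ d.
  have M0 : 0 <= M by rewrite mulr_ge0 ?mulr_ge0// ltW.
  have M1 : 0 < M + 1 by rewrite ltr_wpDl.
  near=> n.
  have e1 : eta (s n) < 1 by near: n; exact: etas_small.
  have e2 : eta (s n) < t' / (M + 1).
    by near: n; apply: etas_small; rewrite divr_gt0.
  have nt : n.+1%:R^-1 <= t' by near: n; exact: tail_small.
  have DBn : forall x, D n x -> big_cube n x.1 /\ Qk T x.2 by near: n.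
  (* The deviation inside the cells is M eps^2 <= M eta^2 <= M eta, by T >= 1 and eta < 1. *)
  have At : eta (s n) ^+ d * (kappa * (C * eps (s n) ^+ 2 / eps (s n) ^+ d)) <= t'.
    have -> : eta (s n) ^+ d * (kappa * (C * eps (s n) ^+ 2 / eps (s n) ^+ d)) =
        M * eps (s n) ^+ 2 by rewrite /M /eta exprMn; field; rewrite gt_eqF.
    apply: le_trans (ler_wpM2l M0 (eps_eta _)) _.
    apply: (@le_trans _ _ (M * eta (s n))).
      by apply: ler_wpM2l => //; rewrite expr2 ger_pMl// ltW.
    move: e2; rewrite ltr_pdivlMr// mulrDr mulr1 mulrC => /ltW; apply: le_trans.
    by rewrite lerDl ltW.
  have cellV l i : cell (R := R) T X l i ->
      (u (eps (s n)) (node (eps (s n)) i) - f (s n) l) ^+ 2 <= V (s n) l.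
    rewrite (cell_image T_ge1 X_range X_periodic) => /mapP[i0 i0s ->].
    by rewrite /V (big_rem _ i0s)/= lerDl; apply: sumr_ge0 => j _; exact: sqr_ge0.
  apply: le_trans (sq_error_le T_ge1 X_range (eps_gt0 _) mv DBn (V0 _) cellV _ (Uv n)) _.
    exact: (integral_lattice_le (eta_gt0 (s n)) (V0 _) (VD _)).
  rewrite lee_fin mulrC -ler_pdivlMr//.
  have -> : t / T%:R ^+ k = 2 * t' + 2 * t' by rewrite /t'; field; rewrite gt_eqF.
  by apply: lerD; rewrite ler_pM2l.
exists s => //; exists v; split.
- split.
    apply: (L2_of_sq_integral mv).
    exact: (lattice_limit_L2 (fun n => eta_gt0 (s n)) (fun n => f_L2 (s n)) A_near' mv Uv Omega_open).
  move=> m.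
  have [G [D [mG GD Gv]]] := lattice_limit_weak_partial Omega (fun n => eta_gt0 (s n))
    etas_to0 (fun n => f_grad (s n)) mv Uv m.
  exists G => //; apply: (L2_of_sq_integral mG (D := D)).
  apply: le_trans GD; apply: le_integral_ge0 => x _; rewrite ?lee_fin ?sqr_ge0//.
- move=> C1 cC1 C1O.
  have [r0 C1r] := compact_big_cube cC1.
  have inner : \forall n \near \oo, forall x, C1 x ->
      inner_cells T Omega (eps (s n)) (lattice_floor (eta (s n)) x).
    apply: (sub (fun N => forall x, C1 x ->
      inner_cells T Omega (eps N) (lattice_floor (eta N) x))).
    (* Around a single point, half of r absorbs the move to a nearby x' and half the side of its
       cell; compactness makes the threshold on eta uniform over [C1]. *)
    have /compact_near_coveringP cov := cC1.
    apply: (cov nat \oo (fun N x => inner_cells T Omega (eps N) (lattice_floor (eta N) x))) => x C1x.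
    have [r rp rO] := open_rV_box Omega_open (C1O _ C1x).
    have r2 : 0 < r / 2 by rewrite divr_gt0.
    near=> x' N => y /(scale_QdP _ _ (eps_gt0 N) T_ge1) yE.
    apply: rO => i.
    have xx' : `|x ord0 i - x' ord0 i| < r / 2.
      have : ball x (r / 2) x' by near: x'; exact: nbhsx_ballx.
      by move=> /rV_ballE[].
    have eN : eta N < r / 2 by near: N; exact: eta_small.
    have := lattice_floor_close x' i (eta_gt0 N).
    have := lattice_floor_close y i (eta_gt0 N); rewrite yE /=.
    move: xx'; rewrite !ltr_norml => /andP[? ?] /andP[? ?] /andP[? ?].
    apply/andP; split; lra.
  apply: cvg_ereal0 => [n|t t0].
    by apply: integral_ge0 => x _; rewrite lee_fin exprn_ge0.
  near=> n.
  apply: (@le_trans _ _ (n.+1%:R^-1)%:E); last first.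
    by rewrite lee_fin; near: n; exact: tail_small.
  apply: le_trans (Uv n); apply: le_integral_ge0 => x.
  + by rewrite lee_fin exprn_ge0.
  + by rewrite lee_fin sqr_ge0.
  move=> C1x; split.
    by apply: (@big_cube_le _ _ r0); [near: n; exact: nbhs_infty_ge|exact: C1r].
  have In : forall x, C1 x -> inner_cells T Omega (eps (s n)) (lattice_floor (eta (s n)) x).
    by near: n.
  by rewrite (coarseE X T_ge1 _ (eps_gt0 _) (In _ C1x)) fE real_normK ?num_real.
- move=> r; apply: sq_error_to0; near=> n => x [[_ Qx] /= xr]; split=> //.
  have rn : r <= n%:R by near: n; exact: nbhs_infty_ger.
  apply/big_cubeP => i; have := le_lt_trans (coord_le_enorm x.1 i) xr.
  by rewrite ltr_norml => /andP[? ?]; apply/andP; split; lra.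
- move=> [M [_ OM]]; apply: sq_error_to0.
  near=> n => x [[l [Ol _] /(scale_QdP _ _ (eps_gt0 _) T_ge1) lx] Qx]; split=> //.
  (* Only the corner of the cell is placed in [Omega]: its norm is at most M + 1, one unit makes
     this strict, and one covers the side of the cell. *)
  have Mn : M + 3 <= n%:R by near: n; exact: nbhs_infty_ger.
  have e1 : eta (s n) < 1 by near: n; exact: etas_small.
  apply/big_cubeP => i; have := lattice_floor_close x.1 i (eta_gt0 (s n)).
  have M1 : M < M + 1 by rewrite ltrDl.
  rewrite lx; have /= Mp := OM _ M1 _ Ol.
  have : `|((eps (s n) * T%:R) *: of_int l) ord0 i| < M + 2.
    by apply: coord_lt_norm; lra.
  rewrite !mxE -/(eta (s n)) ltr_norml => /andP[? ?] /andP[? ?]; apply/andP; split; lra.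
Unshelve. all: by end_near.
Qed.
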